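(* Let $1<p<\infty$ where $p\ne2$. Then (a) $B_p\not\overset{c}{\hookrightarrow}\left(\sum^{\oplus}\ell^2\right)_{\ell^p}$; (b) $\left(\sum^{\oplus}\ell^2\right)_{\ell^p}\oplus X_p\not\overset{c}{\hookrightarrow}\left(\sum^{\oplus}\ell^2\right)_{\ell^p}$; (c) $B_p\not\overset{c}{\hookrightarrow}\left(\sum^{\oplus}\ell^2\right)_{\ell^p}\oplus X_p$; (d) $\left(\sum^{\oplus}\ell^2\right)_{\ell^p}\oplus X_p\not\overset{c}{\hookrightarrow}B_p$; (e) $B_p\oplus X_p\not\overset{c}{\hookrightarrow}B_p$; (f) $B_p\oplus X_p\not\overset{c}{\hookrightarrow}\left(\sum^{\oplus}\ell^2\right)_{\ell^p}\oplus X_p$; (g) $\left(\sum^{\oplus}X_p\right)_{\ell^p}\not\overset{c}{\hookrightarrow}B_p\oplus X_p$.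
   Context: For Banach spaces $X,Y$: $X\overset{c}{\hookrightarrow}Y$ means $X$ is isomorphic to a complemented subspace of $Y$ (the range of a bounded linear projection on $Y$); a slashed symbol denotes negation. $\left(\sum^{\oplus}X\right)_{\ell^p}$ is the $\ell^p$-sum of countably infinitely many copies of $X$. For $2<p<\infty$ and a sequence $w=\{w_n\}$ of positive scalars, $X_{p,w}$ is the Banach space of all scalar sequences $x=\{x_n\}$ with finite norm $\max\{(\sum|x_n|^p)^{1/p},(\sum|w_nx_n|^2)^{1/2}\}$. The sequence $w$ satisfies condition $( * )$ if for each $\epsilon>0$, $\sum_{w_n<\epsilon}w_n^{2p/(p-2)}=\infty$. For fixed $p$, all $X_{p,w}$ with $w$ satisfying $( * )$ are mutually isomorphic; $X_p$ denotes any such $X_{p,w}$. For $2<p<\infty$ and $N\in\mathbb N$, let $v^{(N)}$ be the constant sequence with value $(1/N)^{(p-2)/(2p)}$; then $B_p=\left(X_{p,v^{(1)}}\oplus X_{p,v^{(2)}}\oplus\cdots\right)_{\ell^p}$ (the $\ell^p$-sum). For $1<q<2$ with conjugate index $p$, $X_q$ is the dual of $X_p$ and $B_q$ is the dual of $B_p$. *)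

(* Defs.v *)
From HB Require Import structures.
From mathcomp Require Import all_boot all_order all_algebra.
From mathcomp Require Import complex.
From mathcomp Require Import all_classical all_reals all_analysis.
Import Order.TTheory GRing.Theory Num.Theory.
Import numFieldNormedType.Exports.

Set Implicit Arguments.
Unset Strict Implicit.
Unset Printing Implicit Defensive.

Local Open Scope classical_set_scope.
Local Open Scope ring_scope.

Variant scalar_kind := real_scalars | complex_scalars.

Section scalar_field.
Variable R : realType.

Definition scalar (k : scalar_kind) : numFieldType :=
  match k with real_scalars => R | complex_scalars => R[i] end.

Definition of_real (k : scalar_kind) : R -> scalar k :=
  match k return R -> scalar k with
  | real_scalars => id
  | complex_scalars => fun r => (r +i* 0)%C
  end.

Definition real_part (k : scalar_kind) : scalar k -> R :=
  match k return scalar k -> R with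
  | real_scalars => id
  | complex_scalars => @complex.Re R
  end.

End scalar_field.

Section scalar_theory.
Variables (R : realType) (k : scalar_kind).
Local Notation K := (scalar R k).
Implicit Types (r s : R) (z : K).

Lemma of_realK : cancel (@of_real R k) (@real_part R k).
Proof. by case: k. Qed.

Lemma real_partK z : 0 <= z -> of_real k (real_part z) = z.
Proof.
case: k z => //= -[a b] /=.
by rewrite lecE/= => /andP[/eqP-> _].
Qed.

Lemma of_real0 : of_real k 0 = 0 :> K. Proof. by case: k. Qed.

Lemma of_realD r s : of_real k (r + s) = of_real k r + of_real k s.
Proof. by case: k => //=; rewrite -[RHS]/(_ +i* _)%C addr0. Qed.

Lemma of_realM r s : of_real k (r * s) = of_real k r * of_real k s.
Proof.
by case: k => //=; rewrite -[RHS]/(_ +i* _)%C !mulr0 mul0r subr0 addr0.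
Qed.

Lemma ler_of_real r s : (of_real k r <= of_real k s) = (r <= s).
Proof. by case: k => //=; rewrite lecE /= eqxx. Qed.

Lemma of_real_inj : injective (@of_real R k).
Proof. exact: can_inj of_realK. Qed.

Lemma real_part0 : @real_part R k 0 = 0.
Proof. by apply: of_real_inj; rewrite real_partK ?of_real0. Qed.

End scalar_theory.

Section real_norm.
Variables (R : realType) (k : scalar_kind) (V : normedModType (scalar R k)).
Implicit Types x y : V.

(* MathComp-Analysis norms take their values in the scalar field. *)
Definition rnorm x : R := real_part `|x|.

Lemma of_real_rnorm x : of_real k (rnorm x) = `|x|.
Proof. exact: real_partK. Qed.

Lemma rnorm_ge0 x : 0 <= rnorm x.
Proof. by rewrite -(ler_of_real k) of_real_rnorm of_real0. Qed.

Lemma ler_rnormD x y : rnorm (x + y) <= rnorm x + rnorm y.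
Proof. by rewrite -(ler_of_real k) of_realD !of_real_rnorm ler_normD. Qed.

Lemma rnorm0_eq0 x : rnorm x = 0 -> x = 0.
Proof.
by move=> x0; apply: normr0_eq0; rewrite -of_real_rnorm x0 of_real0.
Qed.

End real_norm.

Section rnormZ.
Variables (R : realType) (k : scalar_kind) (V : normedModType (scalar R k)).

Lemma rnormZ (a : scalar R k) (x : V) :
  rnorm (a *: x) = rnorm (a : (scalar R k)^o) * rnorm x.
Proof.
by apply: (@of_real_inj R k); rewrite of_realM !of_real_rnorm normrZ.
Qed.

End rnormZ.

(* Extended-valued norms on a vector space; the vectors of finite norm form a
   normed space. *)
Section finite_part.
Variables (R : realType) (k : scalar_kind).
Local Notation K := (scalar R k).

Record enorm (V : lmodType K) := Enorm {
  enorm_fun :> V -> \bar R;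
  enormD : forall x y : V,
    (enorm_fun (x + y)%R <= enorm_fun x + enorm_fun y)%E;
  enormZ : forall (a : K) (x : V),
    enorm_fun (a *: x) = ((rnorm (a : K^o))%:E * enorm_fun x)%E;
  enorm_eq0 : forall x : V, enorm_fun x = 0%E -> x = 0;
}.

Variables (V : lmodType K) (N : enorm V).

Lemma enorm0 : N 0 = 0%E.
Proof.
rewrite -(scale0r 0) enormZ.
have -> : rnorm (0 : K^o) = 0 by rewrite /rnorm normr0 real_part0.
by rewrite mul0e.
Qed.

Lemma enormN x : N (- x) = N x.
Proof.
rewrite -scaleN1r enormZ.
have -> : rnorm (-1 : K^o) = 1.
  by apply: (@of_real_inj R k); rewrite of_real_rnorm normrN1; case: k.
by rewrite mul1e.
Qed.

Lemma enorm_ge0 x : (0 <= N x)%E.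
Proof.
have := enormD N x (- x); rewrite subrr enorm0 enormN.
by case: (N x) => [r| |]//; rewrite -EFinD !lee_fin -mulr2n pmulrn_lge0.
Qed.

Definition finite_pred : {pred V} := [pred x | (N x < +oo)%E].

Lemma finite_pred_submod_closed : submod_closed finite_pred.
Proof.
split => [|a x y xfin yfin]; first by rewrite inE enorm0 ltry.
rewrite inE (le_lt_trans (enormD _ _ _))// lte_add_pinfty//.
rewrite enormZ lte_mul_pinfty// ?lee_fin ?rnorm_ge0//.
Qed.

HB.instance Definition _ :=
  GRing.isSubmodClosed.Build _ _ finite_pred finite_pred_submod_closed.

Record finite_part := FinitePart {
  finite_part_val :> V;
  _ : finite_part_val \in finite_pred
}.

HB.instance Definition _ := [isSub for finite_part_val].
HB.instance Definition _ := [Choice of finite_part by <:].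
HB.instance Definition _ := [SubChoice_isSubLmodule of finite_part by <:].

Definition finite_part_norm (x : finite_part) : K :=
  of_real k (fine (N (finite_part_val x))).

Lemma finite_part_fin_num (x : finite_part) :
  N (finite_part_val x) \is a fin_num.
Proof. by rewrite ge0_fin_numE ?enorm_ge0//; exact: (valP x). Qed.

Let normD x y :
  finite_part_norm (x + y) <= finite_part_norm x + finite_part_norm y.
Proof.
rewrite /finite_part_norm -of_realD ler_of_real -lee_fin EFinD.
by rewrite !fineK ?finite_part_fin_num// enormD.
Qed.

Let normZ (a : K) x : finite_part_norm (a *: x) = `|a| * finite_part_norm x.
Proof.
rewrite /finite_part_norm -(@of_real_rnorm R k K^o) -of_realM; congr of_real.
by rewrite /= enormZ fineM ?finite_part_fin_num.
Qed.

Let norm0_eq0 x : finite_part_norm x = 0 -> x = 0.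
Proof.
rewrite /finite_part_norm -(of_real0 R k) => /of_real_inj x0.
apply/val_inj/(@enorm_eq0 _ N); rewrite /= -[LHS]fineK ?x0//.
exact: finite_part_fin_num.
Qed.

HB.instance Definition _ :=
  Lmodule_isNormed.Build K finite_part normD normZ norm0_eq0.

End finite_part.

Section lp_norm.
Variables (R : realType) (k : scalar_kind).
Local Notation K := (scalar R k).

Definition lp_norm (p : R) (X : nat -> normedModType K) (x : forall n, X n) :
  \bar R := Lnorm counting p%:E (fun n => (rnorm (x n))%:E).

Variables (p : R) (p1 : 1 <= p) (X : nat -> normedModType K).
Implicit Types x y : forall n, X n.

Let p0 : 0 < p. Proof. exact: lt_le_trans p1. Qed.

Lemma lp_normE x :
  lp_norm p x = ((\sum_(n <oo) ((rnorm (x n)) `^ p)%:E) `^ p^-1)%E.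
Proof.
rewrite /lp_norm Lnorm_counting//; congr (_ `^ _)%E.
by apply: eq_eseriesr => n _; rewrite abse_EFin ger0_norm ?rnorm_ge0.
Qed.

Let sum_ge0 x : (0 <= \sum_(n <oo) ((rnorm (x n)) `^ p)%:E)%E.
Proof. by apply: nneseries_ge0 => n _ _; rewrite lee_fin powR_ge0. Qed.

Lemma le_lp_norm x y : (forall n, rnorm (x n) <= rnorm (y n)) ->
  (lp_norm p x <= lp_norm p y)%E.
Proof.
move=> xy; rewrite !lp_normE gt0_ler_poweR ?invr_ge0 ?(ltW p0)//.
- by rewrite in_itv/= sum_ge0 leey.
- by rewrite in_itv/= sum_ge0 leey.
apply: lee_nneseries => [n _ _|n _]; rewrite lee_fin ?powR_ge0//.
by rewrite ge0_ler_powR ?nnegrE ?rnorm_ge0 ?(ltW p0).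
Qed.

Lemma lp_normD x y :
  (lp_norm p (fun n => x n + y n)%R <= lp_norm p x + lp_norm p y)%E.
Proof.
apply: le_trans (eminkowski counting (f := fun n => rnorm (x n))
  (g := fun n => rnorm (y n)) _ _ _) => //=.
have N0 (f : nat -> R) : (forall n, 0 <= f n) -> 
    Lnorm counting p%:E (fun n => (f n)%:E) =
    ((\sum_(n <oo) ((f n) `^ p)%:E) `^ p^-1)%E.
  move=> f0; rewrite Lnorm_counting//; congr (_ `^ _)%E.
  by apply: eq_eseriesr => n _; rewrite abse_EFin ger0_norm.
rewrite lp_normE [leRHS](N0 (fun n => rnorm (x n) + rnorm (y n))); last first.
  by move=> n; rewrite addr_ge0// rnorm_ge0.
rewrite gt0_ler_poweR ?invr_ge0 ?(ltW p0)//.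
- by rewrite in_itv/= sum_ge0 leey.
- rewrite in_itv/= leey andbT.
  by apply: nneseries_ge0 => n _ _; rewrite lee_fin powR_ge0.
apply: lee_nneseries => [n _ _|n _]; rewrite lee_fin ?powR_ge0//.
rewrite ge0_ler_powR ?nnegrE ?addr_ge0 ?rnorm_ge0// ?(ltW p0)//.
exact: ler_rnormD.
Qed.

Lemma lp_normZ (a : K) x :
  lp_norm p (fun n => a *: x n) = ((rnorm (a : K^o))%:E * lp_norm p x)%E.
Proof.
rewrite !lp_normE.
under eq_eseriesr => n _ do rewrite rnormZ powRM ?rnorm_ge0// EFinM.
rewrite nneseriesZl//; last by move=> n _; rewrite lee_fin powR_ge0.
rewrite poweRM ?lee_fin ?powR_ge0//; congr (_ * _)%E.
by rewrite poweR_EFin -powRrM mulfV ?gt_eqF// powRr1// rnorm_ge0.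
Qed.

Lemma lp_norm_eq0 x : lp_norm p x = 0%E -> forall n, x n = 0.
Proof.
rewrite lp_normE => /poweR_eq0_eq0 s0 n; apply: rnorm0_eq0.
apply: (@powR_eq0_eq0 _ _ p); apply/eqP.
rewrite eq_le powR_ge0 andbT -lee_fin -[leRHS]s0 ?sum_ge0//.
rewrite (@nneseriesD1 _ _ n)//; last by move=> m _; rewrite lee_fin powR_ge0.
by rewrite leeDl//; apply: nneseries_ge0 => m _ _; rewrite lee_fin powR_ge0.
Qed.

End lp_norm.

Arguments lp_normD {R k p} p1 {X}.
Arguments lp_normZ {R k p} p1 {X}.
Arguments lp_norm_eq0 {R k p} p1 {X}.

Local Notation fdext := functional_extensionality_dep.

Section lp_sum.
Variables (R : realType) (k : scalar_kind).
Local Notation K := (scalar R k).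

Section sequences.
Variable X : nat -> normedModType K.

Definition sequences := forall n, X n.

HB.instance Definition _ := gen_eqMixin sequences.
HB.instance Definition _ := gen_choiceMixin sequences.

Implicit Types x y z : sequences.

Let add x y : sequences := fun n => x n + y n.
Let opp x : sequences := fun n => - x n.
Let scale (a : K) x : sequences := fun n => a *: x n.

Let addA : associative add.
Proof. by move=> x y z; apply: fdext => n; exact: addrA. Qed.
Let addC : commutative add.
Proof. by move=> x y; apply: fdext => n; exact: addrC. Qed.
Let add0 : left_id (fun=> 0) add.
Proof. by move=> x; apply: fdext => n; exact: add0r. Qed.
Let addN : left_inverse (fun=> 0) opp add.
Proof. by move=> x; apply: fdext => n; exact: addNr. Qed.

HB.instance Definition _ := GRing.isZmodule.Build sequences addA addC add0 addN.

Let scaleA a b x : scale a (scale b x) = scale (a * b) x.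
Proof. by apply: fdext => n; exact: scalerA. Qed.
Let scale1 : left_id 1 scale.
Proof. by move=> x; apply: fdext => n; exact: scale1r. Qed.
Let scaleDr : right_distributive scale +%R.
Proof. by move=> a x y; apply: fdext => n; exact: scalerDr. Qed.
Let scaleDl x : {morph scale^~ x : a b / a + b}.
Proof. by move=> a b; apply: fdext => n; exact: scalerDl. Qed.

HB.instance Definition _ :=
  GRing.Zmodule_isLmodule.Build K sequences scaleA scale1 scaleDr scaleDl.

End sequences.

Section lp_sum.
Variables (p : R) (p1 : 1 <= p) (X : nat -> normedModType K).

Let eq0 (x : sequences X) : lp_norm p x = 0%E -> x = 0.
Proof. by move=> /(lp_norm_eq0 p1) x0; apply: fdext. Qed.

Definition lp_enorm : enorm (sequences X) :=
  @Enorm R k (sequences X) (@lp_norm R k p X) (lp_normD p1) (lp_normZ p1) eq0.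

Definition lp_sum : normedModType K := finite_part lp_enorm.

End lp_sum.

Definition ell2 : normedModType K := lp_sum (ler1n R 2) (fun=> K^o).

End lp_sum.

Section Xpw.
Variables (R : realType) (k : scalar_kind).
Local Notation K := (scalar R k).
Variables (p : R) (p1 : 1 <= p) (w : nat -> R).

Local Notation seqK := (sequences (fun=> K^o)).

Definition weighted (x : seqK) : seqK := fun n => of_real k (w n) *: x n.

Definition Xpw_fun (x : seqK) : \bar R :=
  maxe (lp_norm p x) (lp_norm 2 (weighted x)).

Let XpwD x y : (Xpw_fun (x + y)%R <= Xpw_fun x + Xpw_fun y)%E.
Proof.
have -> : Xpw_fun (x + y)%R = maxe (lp_norm p (fun n => x n + y n))
    (lp_norm 2 (fun n => weighted x n + weighted y n)).
  congr maxe; congr lp_norm; apply: fdext => n.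
  exact: scalerDr.
rewrite ge_max; apply/andP; split.
  by rewrite (le_trans (lp_normD p1 _ _))// leeD// le_max lexx.
by rewrite (le_trans (lp_normD (ler1n R 2) _ _))// leeD// le_max lexx orbT.
Qed.

Let XpwZ (a : K) x : Xpw_fun (a *: x) = ((rnorm (a : K^o))%:E * Xpw_fun x)%E.
Proof.
rewrite /Xpw_fun maxeMr ?lee_fin ?rnorm_ge0//; congr maxe.
  exact: lp_normZ.
rewrite -(lp_normZ (ler1n R 2)); congr lp_norm.
apply: fdext => n.
by rewrite /weighted !scalerA mulrC.
Qed.

Let Xpw0 x : Xpw_fun x = 0%E -> x = 0.
Proof.
move=> x0; apply: fdext; apply: (lp_norm_eq0 p1).
apply/eqP; rewrite eq_le Lnorm_ge0 andbT -[leRHS]x0.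
by rewrite /Xpw_fun le_max lexx.
Qed.

Definition Xpw_enorm := Enorm XpwD XpwZ Xpw0.

Definition Xpw : normedModType K := finite_part Xpw_enorm.

End Xpw.

Section dual.
Variables (R : realType) (k : scalar_kind).
Local Notation K := (scalar R k).
Variable X : normedModType K.

Definition dual_pred : {pred X -> K^o} :=
  [pred f : X -> K^o | `[< linear f /\ continuous f >]].

Lemma dual_pred_submod_closed : submod_closed dual_pred.
Proof.
split.
  apply/asboolP; split=> [a x y|x]; last exact: cst_continuous.
  by rewrite /= scaler0 addr0.
move=> a f g /asboolP[lf cf] /asboolP[lg cg]; apply/asboolP; split.
  move=> b x y; rewrite -[LHS]/(a *: f (b *: x + y) + g (b *: x + y)) lf lg.
  rewrite -[RHS]/(b *: (a *: f x + g x) + (a *: f y + g y)) !scalerDr addrACA.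
  by rewrite !scalerA (mulrC a).
by move=> x; apply: continuousD; [apply: continuousZr; exact: cf|exact: cg].
Qed.

HB.instance Definition _ :=
  GRing.isSubmodClosed.Build _ _ dual_pred dual_pred_submod_closed.

Record dual_type := Dual {
  dual_val :> X -> K^o;
  _ : dual_val \in dual_pred
}.

HB.instance Definition _ := [isSub for dual_val].
HB.instance Definition _ := [Choice of dual_type by <:].
HB.instance Definition _ := [SubChoice_isSubLmodule of dual_type by <:].

Implicit Types f g : dual_type.

Definition opnorm f : R := sup [set rnorm (f x) | x in [set x | rnorm x <= 1]].

Lemma dual_linear f : linear (f : X -> K^o).
Proof. by have /asboolP[] := valP f. Qed.

Lemma dual_continuous f : continuous (f : X -> K^o).
Proof. by have /asboolP[] := valP f. Qed.

Lemma dual_bounded f : exists M : R, forall x, rnorm (f x) <= M * rnorm x.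
Proof.
pose g := GRing.isLinear.Build _ _ _ _ (f : X -> K^o) (dual_linear f).
pose F : {linear X -> K^o} := HB.pack (f : X -> K^o) g.
have Fb : bounded_near F (nbhs 0).
  by apply: continuous_linear_bounded; exact: dual_continuous.
have [M M0 FM] := pinfty_ex_gt0 ((linear_boundedP F).1 Fb).
exists (real_part M) => x; rewrite -(ler_of_real k) of_realM !of_real_rnorm.
by rewrite real_partK ?(ltW M0)//; exact: FM.
Qed.

Let dual0 f : f 0 = 0.
Proof.
by have := dual_linear f 1 0 0; rewrite !scale1r addr0 -[LHS]addr0 => /addrI.
Qed.

Let dualZ f (a : K) x : f (a *: x) = a *: f x.
Proof. by have := dual_linear f a x 0; rewrite dual0 !addr0. Qed.

Let rnorm0 (V : normedModType K) : rnorm (0 : V) = 0.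
Proof. by rewrite /rnorm normr0 real_part0. Qed.

Let opnorm_has_sup f :
  has_sup [set rnorm (f x) | x in [set x | rnorm x <= 1]].
Proof.
split; first by exists (rnorm (f 0)), 0; rewrite //= rnorm0.
have [M fM] := dual_bounded f; exists `|M| => _ [x x1 <-].
rewrite (le_trans (fM x))// (le_trans (ler_wpM2r (rnorm_ge0 _) (ler_norm M)))//.
by rewrite ler_piMr.
Qed.

Lemma opnorm_ub f x : rnorm x <= 1 -> rnorm (f x) <= opnorm f.
Proof.
by move=> x1; apply: ub_le_sup; [case: (opnorm_has_sup f)|exists x].
Qed.

Lemma opnorm_le f M :
  (forall x, rnorm x <= 1 -> rnorm (f x) <= M) -> opnorm f <= M.
Proof.
move=> fM; apply: ge_sup; first by case: (opnorm_has_sup f).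
by move=> _ [x x1 <-]; exact: fM.
Qed.

Lemma opnorm_ge0 f : 0 <= opnorm f.
Proof.
by apply: le_trans (rnorm_ge0 (f 0)) _; rewrite opnorm_ub// rnorm0 ler01.
Qed.

Definition dual_norm f : K := of_real k (opnorm f).

Let normD f g : dual_norm (f + g) <= dual_norm f + dual_norm g.
Proof.
rewrite -of_realD ler_of_real; apply: opnorm_le => x x1.
by rewrite (le_trans (ler_rnormD _ _))// lerD// opnorm_ub.
Qed.

Let opnormZ_le (a : K) f : opnorm (a *: f) <= rnorm (a : K^o) * opnorm f.
Proof.
apply: opnorm_le => x x1; rewrite rnormZ.
by rewrite ler_wpM2l ?rnorm_ge0 ?opnorm_ub.
Qed.

Let opnormZ (a : K) f : opnorm (a *: f) = rnorm (a : K^o) * opnorm f.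
Proof.
apply/eqP; rewrite eq_le opnormZ_le /=.
have [->|a0] := eqVneq a 0; first by rewrite rnorm0 mul0r opnorm_ge0.
have a_gt0 : 0 < rnorm (a : K^o).
  rewrite lt_neqAle rnorm_ge0 andbT eq_sym; apply/eqP => /rnorm0_eq0 /eqP.
  by rewrite (negbTE a0).
have aV : rnorm (a : K^o) * rnorm (a^-1 : K^o) = 1.
  rewrite -rnormZ; apply: (@of_real_inj R k); rewrite of_real_rnorm.
  by rewrite -[_ *: _]/(a * a^-1) mulfV// normr1; case: k.
have := opnormZ_le a^-1 (a *: f); rewrite scalerA mulVf// scale1r => h.
by rewrite (le_trans (ler_wpM2l (ltW a_gt0) h))// mulrA aV mul1r.
Qed.

Let normZ (a : K) f : dual_norm (a *: f) = `|a| * dual_norm f.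
Proof. by rewrite /dual_norm opnormZ of_realM of_real_rnorm. Qed.

Let norm0_eq0 f : dual_norm f = 0 -> f = 0.
Proof.
rewrite /dual_norm -(of_real0 R k) => /of_real_inj f0.
apply: val_inj; apply: funext => x /=.
have [->|x0] := eqVneq x 0; first exact: dual0.
have nx0 : `|x| != 0 by rewrite normr_eq0.
have : rnorm (f (`|x|^-1 *: x)) <= 0.
  rewrite -f0; apply: opnorm_ub; rewrite -(ler_of_real k) of_real_rnorm.
  by rewrite normrZ normfV normr_id mulVf//; case: k.
rewrite dualZ => h; have /rnorm0_eq0 /eqP : rnorm (`|x|^-1 *: f x) = 0.
  by apply/eqP; rewrite eq_le h rnorm_ge0.
by rewrite scaler_eq0 invr_eq0 (negbTE nx0) => /eqP.
Qed.

HB.instance Definition _ :=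
  Lmodule_isNormed.Build K dual_type normD normZ norm0_eq0.

Definition dual : normedModType K := dual_type.

End dual.

Section complemented.
Variables (K : numFieldType) (X Y : normedModType K).

Definition isomorphism_into (T : {linear X -> Y}) : Prop :=
  continuous T /\ exists2 c : K, 0 < c & forall x, c * `|x| <= `|T x|.

Definition bounded_projection (P : {linear Y -> Y}) : Prop :=
  continuous P /\ forall y, P (P y) = P y.

Definition complemented_embedding : Prop :=
  exists (T : {linear X -> Y}) (P : {linear Y -> Y}),
    [/\ isomorphism_into T, bounded_projection P & range T = range P].

End complemented.

Section exponents.
Variables (R : realType) (p : R).

Definition conjugate_exponent : R := p / (p - 1).

Lemma conjugate_exponent_ge1 : 1 < p -> 1 <= conjugate_exponent.
Proof.
move=> p1; rewrite /conjugate_exponent ler_pdivlMr ?subr_gt0//.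
by rewrite mul1r lerBlDr lerDl ler01.
Qed.

(* Whichever of p and its conjugate exceeds 2 (for p != 2). *)
Definition upper_exponent : R := if 2 < p then p else conjugate_exponent.

Definition condition_star (w : nat -> R) : Prop :=
  forall e : R, 0 < e ->
    (\sum_(n <oo | (w n < e)%R) ((w n) `^ (2 * p / (p - 2)))%:E = +oo)%E.

Definition v_weight (N : nat) : R := (1 / N%:R) `^ ((p - 2) / (2 * p)).

End exponents.

Section spaces.
Variables (R : realType) (k : scalar_kind).
Local Notation K := (scalar R k).

(* v^(N) starts at N = 1, sequences are indexed from 0. *)
Definition Bp (p : R) (p1 : 1 <= p) : normedModType K :=
  lp_sum p1 (fun n => Xpw k p1 (fun=> v_weight p n.+1)).

Variables (p : R) (p1 : 1 < p).

Definition X_space (w : nat -> R) : normedModType K :=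
  if 2 < p then Xpw k (ltW p1) w
  else dual (Xpw k (conjugate_exponent_ge1 p1) w).

Definition B_space : normedModType K :=
  if 2 < p then Bp (ltW p1) else dual (Bp (conjugate_exponent_ge1 p1)).

Definition lp_power (X : normedModType K) : normedModType K :=
  lp_sum (ltW p1) (fun=> X).

Definition direct_sum (X Y : normedModType K) : normedModType K := (X * Y)%type.

End spaces.

(* Main.v *)
(* A space embeds complementably in another only if its identity factors through
   the other, E --A--> F --B--> E with B A = 1. For p > 2 every space involved is,
   up to such factorizations, an l^p-sum of spaces X_{p,W_0}, X_{p,W_1}, ..., where
   W_N is constant for N >= 1. For p < 2 the spaces are the duals of those for the
   conjugate exponent and are reflexive, so a factorization can be dualized.

   Assume B A = 1 and consider the diagonal pairings <B T A e_i, e_i*> = 1 of basis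
   vectors of weight v, where T = 1 is decomposed along the target sum.
   - Far summands. Signs +-1 turn a sum of m diagonal pairings into one pairing of a
     signed sum of vectors with a signed sum of functionals. If the vectors are cut
     off to disjoint windows of the target sum, their sum has norm O(m^(1/p)), and
     the functionals sum to norm O(m^(1/2)). As 1/p + 1/2 < 1, only finitely many
     target summands matter (gliding hump).
   - The finitely many remaining summands with constant weights are Hilbert spaces.
     On a large block of basis vectors of weight v their contribution to the mean
     pairing tends to 0 with v. When the weight v is fixed and the target weights
     are 1, infinitely many pairings are at most about 4 C^2 v.
   - A summand X_{p,W_0} cannot be handled in this way, but the source
     l^p-sum of copies of X_p contains it too often: if the weighted l^2 part of the
     images in X_{p,W_0} of basis vectors of weight v in the L-th copy were not
     o(v) as L grows, then m of these copies would give vectors of norm m^(1/p) with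
     images of norm at least c m^(1/2). So this part is negligible, and the
     contribution of the l^p part is again excluded by a gliding hump.
   The condition [condition_star] enters through block vectors: it makes X_{p,w'} a complemented
   subspace of X_{p,w} for every positive w', so that basis vectors with infinitely
   many repetitions of arbitrarily small weights are available in X_p. *)

From HB Require Import structures.
Require Import Defs.
From mathcomp Require Import all_boot all_order all_algebra.
From mathcomp Require Import complex ring lra.
From mathcomp Require Import all_classical all_reals all_analysis.
Import Order.TTheory GRing.Theory Num.Theory.
Import numFieldNormedType.Exports.

Set Implicit Arguments.
Unset Strict Implicit.
Unset Printing Implicit Defensive.

Local Open Scope classical_set_scope.
Local Open Scope ring_scope.

(** * Scalars and norms *)

(** The order in which constants are chosen shapes the proof. The cutoff n0 beyond which target
    summands are negligible comes from a gliding hump, without control on its size. The summands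
    before n0 then contribute a constant that depends on n0 and on their weights. In X_p many
    weights occur in one space, so v can be made small after n0 is known, and a crude estimate
    suffices. In B_p each summand has a single weight v and n0 depends on it; the bound 4 C^2 v
    therefore has to be free of n0, and it is obtained from the pigeonhole principle and the p-th
    powers of the component norms. The zeroth summand X_{p,W_0} escapes both estimates, as a basis
    vector may be mapped there with its full weighted norm. It is controlled only by comparing many
    source summands L with each other. The resulting bound is relative to the weight v_L, so that
    v_L may vary with L in any way; this freedom is used when the weight has to be chosen for each
    copy separately. All estimates are made on finite sums: a norm bound is read as a bound on every
    partial sum. *)

Section scalars.
Variables (R : realType) (k : scalar_kind).
Local Notation K := (Defs.scalar R k).
Local Notation re := (@real_part R k).
Local Notation r2K := (@of_real R k).

Lemma real_partD (a b : K) : re (a + b) = re a + re b.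
Proof. by case: k a b => //= -[? ?] [? ?]. Qed.

Lemma real_partN (a : K) : re (- a) = - re a.
Proof. by case: k a => //= -[? ?]. Qed.

Lemma real_partB (a b : K) : re (a - b) = re a - re b.
Proof. by rewrite real_partD real_partN. Qed.

Lemma real_part_sum (I : Type) (s : seq I) (a : I -> K) :
  re (\sum_(i <- s) a i) = \sum_(i <- s) re (a i).
Proof.
elim: s => [|i s IHs]; first by rewrite !big_nil real_part0.
by rewrite !big_cons real_partD IHs.
Qed.

Lemma real_partMl (r : R) (a : K) : re (r2K r * a) = r * re a.
Proof. by case: k a => //= -[? ?] /=; rewrite mul0r subr0. Qed.

Lemma rnorm_complex (a b : R) :
  rnorm ((a +i* b)%C : (Defs.scalar R complex_scalars)^o) =
  Num.sqrt (a ^+ 2 + b ^+ 2).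
Proof.
rewrite /rnorm -[`|_|]/(@Num.norm _ R[i] (a +i* b)%C).
by rewrite normc_def.
Qed.

Lemma ler_real_part (a : K) : re a <= rnorm (a : K^o).
Proof.
case: k a => [a|[a b]]; first exact: ler_norm.
rewrite rnorm_complex; apply: le_trans (ler_norm _) _.
by rewrite -sqrtr_sqr ler_wsqrtr// lerDl sqr_ge0.
Qed.

Lemma of_real1 : r2K 1 = 1 :> K. Proof. by case: k. Qed.

Lemma of_real_sum (I : Type) (s : seq I) (a : I -> R) :
  r2K (\sum_(i <- s) a i) = \sum_(i <- s) r2K (a i).
Proof.
elim: s => [|i s IHs]; first by rewrite !big_nil of_real0.
by rewrite !big_cons of_realD IHs.
Qed.

Lemma rnorm_of_real r : rnorm (r2K r : K^o) = `|r|.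
Proof.
case: k => //=.
by rewrite [LHS](rnorm_complex r 0) expr0n addr0 sqrtr_sqr.
Qed.

Lemma rnormM (a b : K) : rnorm (a * b : K^o) = rnorm (a : K^o) * rnorm (b : K^o).
Proof. by rewrite -rnormZ. Qed.

Lemma rnorm_phase (a : K) :
  exists c : K, rnorm (c : K^o) <= 1 /\ c * a = r2K (rnorm (a : K^o)).
Proof.
have [->|a0] := eqVneq a 0.
  by exists 0; rewrite mulr0 /rnorm normr0 real_part0 of_real0.
exists (`|a| / a); split; last by rewrite divfK// of_real_rnorm.
by rewrite -(ler_of_real k) of_real_rnorm normrM normr_id normfV mulfV ?normr_eq0// of_real1.
Qed.

Lemma parallelogram (a b : K) : rnorm (a + b : K^o) ^+ 2 + rnorm (a - b : K^o) ^+ 2 =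
  2 * rnorm (a : K^o) ^+ 2 + 2 * rnorm (b : K^o) ^+ 2.
Proof.
case: k a b => [a b|[a a'] [b b']].
  by rewrite /rnorm /= !real_normK ?num_real//; ring.
rewrite -[X in _ + rnorm X ^+ 2 = _]/((a - b) +i* (a' - b'))%C.
rewrite -[X in rnorm X ^+ 2 + _ = _]/((a + b) +i* (a' + b'))%C.
by rewrite !rnorm_complex !sqr_sqrtr ?addr_ge0 ?sqr_ge0//; ring.
Qed.

End scalars.

Section normed.
Variables (R : realType) (k : scalar_kind).
Local Notation K := (Defs.scalar R k).
Implicit Types V : normedModType K.

Lemma rnorm0 V : rnorm (0 : V) = 0.
Proof. by rewrite /rnorm normr0 real_part0. Qed.

Lemma rnormN V (x : V) : rnorm (- x) = rnorm x.
Proof. by rewrite /rnorm normrN. Qed.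

Lemma ler_rnormB V (x y : V) : rnorm (x - y) <= rnorm x + rnorm y.
Proof. by rewrite (le_trans (ler_rnormD _ _))// rnormN. Qed.

Lemma ler_rnorm_sum V (I : Type) (s : seq I) (x : I -> V) :
  rnorm (\sum_(i <- s) x i) <= \sum_(i <- s) rnorm (x i).
Proof.
elim: s => [|i s IHs]; first by rewrite !big_nil rnorm0.
by rewrite !big_cons (le_trans (ler_rnormD _ _))// lerD2l.
Qed.

Lemma rnorm_sign V (b : bool) (x : V) : rnorm ((-1) ^+ b *: x) = rnorm x.
Proof. by rewrite rnormZ /rnorm normr_sign; case: k V x => V x; rewrite /= mul1r. Qed.

End normed.

(** * Signs, gliding humps and real powers *)

Section signs.
Variable R : realDomainType.

(* Choosing the signs one at a time replaces averaging over all of them. *)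
Lemma signs_bilinear (beta : nat -> nat -> R) n : exists e : nat -> bool,
  \sum_(i < n) beta i i <=
  \sum_(i < n) \sum_(j < n) (-1) ^+ e i * (-1) ^+ e j * beta i j.
Proof.
elim: n => [|n [e IH]]; first by exists xpredT; rewrite !big_ord0.
(* [c] collects the cross terms with the new index n; giving n the sign of [c] turns their
   contribution into [|c|]. *)
pose c := \sum_(i < n) (-1) ^+ e i * (beta i n + beta n i).
exists (fun i => if i == n then c < 0 else e i).
have eE (i : 'I_n) : (if i == n :> nat then c < 0 else e i) = e i.
  by rewrite ltn_eqF.
rewrite big_ord_recr /= [leRHS]big_ord_recr /= [in leRHS]big_ord_recr /= eqxx.
under [in leRHS]eq_bigr => i _.
  rewrite big_ord_recr /= eqxx eE; under eq_bigr => j _ do rewrite eE.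
  over.
rewrite big_split /= -addrA lerD// addrA.
rewrite -signr_addb addbb mul1r lerDr.
under [X in _ + X]eq_bigr => j _ do rewrite eE (mulrC ((-1) ^+ (c < 0)%R)).
rewrite -big_split /=.
have -> : \sum_(i < n) ((-1) ^+ e i * (-1) ^+ (c < 0)%R * beta i n +
    (-1) ^+ e i * (-1) ^+ (c < 0)%R * beta n i) = (-1) ^+ (c < 0)%R * c.
  by rewrite mulr_sumr; apply: eq_bigr => i _; ring.
by rewrite -normrEsign.
Qed.

(** The mean of Q over S + a n and S - a n is at least Q S + Q (a n), so the sign with the larger
    value can be kept. Q will be a squared Hilbert norm or a finite weighted sum of such squares. *)
Lemma signs_quadratic (K : pzRingType) (W : lmodType K)
  (Q : W -> R) : Q 0 = 0 ->
  (forall a b, 2 * Q a + 2 * Q b <= Q (a + b) + Q (a - b)) ->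
  forall (a : nat -> W) n, exists e : nat -> bool,
  \sum_(i < n) Q (a i) <= Q (\sum_(i < n) (-1) ^+ e i *: a i).
Proof.
move=> Q0 QP a; elim=> [|n [e IH]]; first by exists xpredT; rewrite !big_ord0 Q0.
set S := \sum_(i < n) (_ *: _) in IH.
exists (fun i => if i == n then Q (S + a n) < Q (S - a n) else e i).
rewrite !big_ord_recr /= eqxx.
have -> : \sum_(i < n)
    (-1) ^+ (if i == n :> nat then Q (S + a n) < Q (S - a n) else e i) *: a i = S.
  by apply: eq_bigr => i _; rewrite ltn_eqF.
have := QP S (a n).
by case: ltP => /= [h|h]; rewrite ?expr1 ?expr0 ?scaleN1r ?scale1r; lra.
Qed.

End signs.

Section gliding_hump.
Variable R : realFieldType.

(** Two choices alternate: given a cutoff, an element of larger label that is still above e there;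
    given the element, a cutoff beyond which it is below e / 2. Each element thus loses more than e
    / 2 between consecutive cutoffs, and the increasing labels keep the chosen elements distinct. *)
Lemma gliding_hump (T : Type) (label : T -> nat) (A : T -> nat -> R) (e : R) :
  0 < e ->
  (forall t d, 0 < d -> exists n0, forall n, (n0 <= n)%N -> A t n < d) ->
  (forall n l, exists2 t, (l <= label t)%N & e < A t n) ->
  exists (t : nat -> T) (n : nat -> nat),
    [/\ {homo n : i j / (i <= j)%N}, {homo label \o t : i j / (i < j)%N} &
        forall i, e / 2 < A (t i) (n i) - A (t i) (n i.+1)].
Proof.
move=> e0 A0 Abig.
have /choice[f fP] : forall nl : nat * nat, exists t,
    (nl.2 <= label t)%N /\ e < A t nl.1.
  by move=> [n l]; have [t] := Abig n l; exists t.
have /choice[g gP] : forall t, exists n0, forall n, (n0 <= n)%N -> A t n < e / 2.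
  by move=> t; apply: A0; lra.
pose next (s : nat * T) := let n := maxn s.1 (g s.2) in (n, f (n, (label s.2).+1)).
pose s i := iter i next (0%N, f (0%N, 0%N)).
exists (fun i => (s i).2), (fun i => (s i).1); split.
- apply: homo_leq => // [n m p|i]; first exact: leq_trans.
  exact: leq_maxl.
- apply: homo_ltn => [n m p|i]; first exact: ltn_trans.
  exact: (fP (_, _)).1.
move=> i; have big : e < A (s i).2 (s i).1.
  by case: i => [|i]; [exact: (fP (0, 0)%N).2|exact: (fP (_, _)).2].
have : A (s i).2 (s i.+1).1 < e / 2 by apply: gP; exact: leq_maxr.
lra.
Qed.

End gliding_hump.

Lemma sum_disjoint (R : numDomainType) (I : eqType) (V : nmodType) (f : V -> R)
    (s : seq I) (a : I -> V) :
  f 0 = 0 -> (forall x, 0 <= f x) -> uniq s ->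
  {in s &, forall i j, a i <> 0 -> a j <> 0 -> i = j} ->
  f (\sum_(i <- s) a i) <= \sum_(i <- s) f (a i).
Proof.
move=> f0 f_ge0; elim: s => [|i s IHs]; first by rewrite !big_nil f0.
move=> /= /andP[iNs us] dis; rewrite !big_cons.
have IH : f (\sum_(j <- s) a j) <= \sum_(j <- s) f (a j).
  by apply: IHs => // j l js ls; apply: dis; rewrite inE ?js ?ls orbT.
have [a0|/eqP a0] := eqVneq (a i) 0; first by rewrite a0 add0r f0 add0r.
rewrite big1_seq ?addr0 ?lerDl ?sumr_ge0// => j /= js.
have [//|/eqP aj0] := eqVneq (a j) 0.
by move: iNs; rewrite (dis i j)// ?js// inE ?eqxx// js orbT.
Qed.

Lemma sum_ord_disjoint (R : numDomainType) (V : nmodType) (f : V -> R)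
    n (a : nat -> V) :
  f 0 = 0 -> (forall x, 0 <= f x) ->
  (forall i j, (i < n)%N -> (j < n)%N -> a i <> 0 -> a j <> 0 -> i = j) ->
  f (\sum_(i < n) a i) <= \sum_(i < n) f (a i).
Proof.
move=> f0 f_ge0 dis.
rewrite -(big_mkord xpredT a) -(big_mkord xpredT (fun i => f (a i))).
apply: sum_disjoint => //; first exact: iota_uniq.
by move=> i j; rewrite !mem_index_iota => /andP[_ ?] /andP[_ ?]; exact: dis.
Qed.

(** * Real powers, the Hoelder inequality and its converse *)

Section real_powers.
Variable R : realType.
Implicit Types (a b p q C D : R).

Lemma ler_powR2r a b p : 0 < p -> 0 <= a -> 0 <= b -> (a `^ p <= b `^ p) = (a <= b).
Proof.
move=> p0 a0 b0; apply/idP/idP; last by apply: ge0_ler_powR; rewrite ?ltW.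
by apply: contraTT; rewrite -!ltNge; apply: gt0_ltr_powR.
Qed.

Lemma powRV a p : 0 < p -> 0 <= a -> (a `^ p^-1) `^ p = a.
Proof. by move=> p0 a0; rewrite -powRrM mulVf ?gt_eqF// powRr1. Qed.

Lemma powRK a p : 0 < p -> 0 <= a -> (a `^ p) `^ p^-1 = a.
Proof. by move=> p0 a0; rewrite -powRrM mulfV ?gt_eqF// powRr1. Qed.

(** Supplies the number of terms at which an upper estimate of order n^a contradicts a linear lower
    one, and the block length at which n^(1/p) falls below v n^(1/2). *)
Lemma powR_dominated C v a b : 0 < v -> a < b -> exists n0 : nat,
  forall n, (n0 <= n)%N -> C * n%:R `^ a <= v * n%:R `^ b.
Proof.
move=> v0 ab; pose t := (`|C| / v) `^ (b - a)^-1.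
have ba0 : 0 < b - a by rewrite subr_gt0.
exists (Num.truncn t).+1 => n tn.
have n0 : 0 < n%:R :> R by rewrite ltr0n; apply: leq_trans tn.
have tn' : t <= n%:R.
  by rewrite (le_trans (ltW (truncnS_gt t)))// ler_nat.
have -> : n%:R `^ b = n%:R `^ (b - a) * n%:R `^ a :> R.
  by rewrite -powRD ?subrK// (gt_eqF n0) implybT.
rewrite mulrA ler_wpM2r ?powR_ge0//.
apply: le_trans (ler_norm _) _; rewrite -ler_pdivrMl// mulrC.
rewrite -[leLHS](powRV ba0) ?divr_ge0 ?(ltW v0)// ler_powR2r ?powR_ge0 ?ler0n//.
Qed.

(** Young's inequality, term by term, for the normalized sequences a / A and b / B. A zero bound is
    treated apart: it forces the sequence to vanish. *)
Lemma hoelder_sum p q n (a b : nat -> R) A B : 0 < p -> 0 < q -> p^-1 + q^-1 = 1 ->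
  (forall i, 0 <= a i) -> (forall i, 0 <= b i) -> 0 <= A -> 0 <= B ->
  \sum_(i < n) a i `^ p <= A `^ p -> \sum_(i < n) b i `^ q <= B `^ q ->
  \sum_(i < n) a i * b i <= A * B.
Proof.
move=> p0 q0 pq a0 b0.
have zero r (c : nat -> R) : 0 < r -> (forall i, 0 <= c i) ->
    \sum_(i < n) c i `^ r <= 0 `^ r -> forall i : 'I_n, c i = 0.
  move=> r0 c0 sc i; apply: (@powR_eq0_eq0 _ _ r); apply/eqP.
  rewrite eq_le powR_ge0 andbT; move: sc; rewrite powR0 ?gt_eqF//; apply: le_trans.
  by rewrite (bigD1 i)//= lerDl sumr_ge0// => *; rewrite powR_ge0.
rewrite le_eqVlt => /predU1P[<- _ /(zero _ _ p0 a0) aE _|A0].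
  by rewrite mul0r big1// => i _; rewrite aE mul0r.
rewrite le_eqVlt => /predU1P[<- _ /(zero _ _ q0 b0) bE|B0 aA bB].
  by rewrite mulr0 big1// => i _; rewrite bE mulr0.
have -> : A * B = A * B * (p^-1 + q^-1) by rewrite pq mulr1.
have -> : \sum_(i < n) a i * b i = A * B * \sum_(i < n) (a i / A) * (b i / B).
  by rewrite mulr_sumr; apply: eq_bigr => i _; field; rewrite !gt_eqF.
rewrite ler_wpM2l ?mulr_ge0 ?(ltW A0) ?(ltW B0)//.
apply: (@le_trans _ _ (\sum_(i < n) ((a i / A) `^ p / p + (b i / B) `^ q / q))).
  by apply: ler_sum => i _; apply: conjugate_powR => //; rewrite divr_ge0// ?(ltW A0) ?(ltW B0).
rewrite big_split /= -!mulr_suml lerD//.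
- rewrite ler_piMl ?invr_ge0 ?(ltW p0)//.
  under eq_bigr => i _ do rewrite powRM ?invr_ge0 ?(ltW A0)//.
  by rewrite -mulr_suml -powR_inv1 ?(ltW A0)// powRAC powR_inv1 ?powR_ge0//
     ler_pdivrMr ?powR_gt0// mul1r.
- rewrite ler_piMl ?invr_ge0 ?(ltW q0)//.
  under eq_bigr => i _ do rewrite powRM ?invr_ge0 ?(ltW B0)//.
  by rewrite -mulr_suml -powR_inv1 ?(ltW B0)// powRAC powR_inv1 ?powR_ge0//
     ler_pdivrMr ?powR_gt0// mul1r.
Qed.

(** Converse Hoelder inequality. Tested on t i = s i ^ (p - 1), where (p - 1) q = p, the hypothesis
    reads S <= D S^(1/q). *)
Lemma dual_sum_le p q n (s : nat -> R) D : 0 < p -> 0 < q -> p^-1 + q^-1 = 1 ->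
  0 <= D -> (forall i, 0 <= s i) ->
  (forall (t : nat -> R) T, 0 <= T -> (forall i, 0 <= t i) ->
     \sum_(i < n) t i `^ q <= T `^ q -> \sum_(i < n) t i * s i <= D * T) ->
  \sum_(i < n) s i `^ p <= D `^ p.
Proof.
move=> p0 q0 pq D0 s0 sD; set S := \sum_(i < n) _.
have S0 : 0 <= S by rewrite sumr_ge0// => *; rewrite powR_ge0.
have p1q : (p - 1) * q = p.
  have := congr1 (fun x => p * q * x) pq.
  rewrite mulrDr mulr1 mulrAC mulfV ?gt_eqF// -mulrA mulfV ?gt_eqF//; lra.
have /(sD _ (S `^ q^-1) (powR_ge0 _ _)) : forall i, 0 <= s i `^ (p - 1).
  by move=> i; exact: powR_ge0.
rewrite powRV//; under eq_bigr => i _ do rewrite -powRrM p1q.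
move=> /(_ (lexx _)).
have sE i : s i `^ (p - 1) * s i = s i `^ p.
  have [->|si0] := eqVneq (s i) 0; first by rewrite mulr0 powR0 ?gt_eqF.
  by rewrite -[X in _ * X]powRr1// -powRD ?subrK// si0 implybT.
under eq_bigr => i _ do rewrite sE.
rewrite -/S.
have [->|Sn0] := eqVneq S 0; first by rewrite powR_ge0.
have S_gt0 : 0 < S by rewrite lt_neqAle eq_sym Sn0.
rewrite -ler_pdivrMr ?powR_gt0// -{1}[S]powRr1// -powRB ?Sn0 ?implybT//.
have -> : 1 - q^-1 = p^-1 by lra.
by rewrite -(ler_powR2r p0) ?powR_ge0// powRV.
Qed.

Lemma cauchy_schwarz_sum n (a b : nat -> R) A B :
  (forall i, 0 <= a i) -> (forall i, 0 <= b i) -> 0 <= A -> 0 <= B ->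
  \sum_(i < n) a i ^+ 2 <= A ^+ 2 -> \sum_(i < n) b i ^+ 2 <= B ^+ 2 ->
  \sum_(i < n) a i * b i <= A * B.
Proof.
move=> a0 b0 A0 B0 aA bB; apply: (@hoelder_sum 2 2) => //; first by lra.
- by rewrite powR_mulrn//; under eq_bigr => i _ do rewrite powR_mulrn//.
- by rewrite powR_mulrn//; under eq_bigr => i _ do rewrite powR_mulrn//.
Qed.

Lemma ler_sum_widen (f : nat -> R) m n : (m <= n)%N -> (forall i, 0 <= f i) ->
  \sum_(i < m) f i <= \sum_(i < n) f i.
Proof.
by move=> mn f0; rewrite -(subnKC mn) big_split_ord /= lerDl sumr_ge0.
Qed.

Lemma sum_tail (f : nat -> R) C e : (forall i, 0 <= f i) ->
  (forall n, \sum_(i < n) f i <= C) -> 0 < e -> exists n0, forall n m, (n0 <= n)%N ->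
  \sum_(i < m) (if (n <= i)%N then f i else 0) <= e.
Proof.
move=> f0 fC e0; pose s n := \sum_(i < n) f i.
have sup_s : has_sup (range s).
  by split; [exists (s 0), 0|exists C => _ [n _ <-]; exact: fC].
have [_ [n0 _ <-] hn0] := sup_adherent e0 sup_s.
exists n0 => n m nn0.
have : s (maxn m n) <= sup (range s).
  by apply: ub_le_sup; [case: sup_s|exists (maxn m n)].
have : \sum_(i < m) (if (n <= i)%N then f i else 0) <= s (maxn m n) - s n0.
  rewrite lerBrDr; apply: (@le_trans _ _ (\sum_(i < maxn m n) (if (n <= i)%N then f i else 0)
    + \sum_(i < maxn m n) (if (n <= i)%N then 0 else f i))).
    apply: lerD.
      apply: (ler_sum_widen (f := fun i => if (n <= i)%N then f i else 0)).
        exact: leq_maxl.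
      by move=> i; case: ifP.
    apply: (@le_trans _ _ (\sum_(i < n0) (if (n <= i)%N then 0 else f i))).
      by apply: ler_sum => i _; rewrite leqNgt (leq_trans (ltn_ord i) nn0).
    apply: (ler_sum_widen (f := fun i => if (n <= i)%N then 0 else f i)).
      by rewrite (leq_trans nn0)// leq_maxr.
    by move=> i; case: ifP.
  rewrite -big_split /=; apply: ler_sum => i _.
  by case: ifP => _; rewrite ?addr0 ?add0r.
lra.
Qed.

Lemma sum_uniq_le (f : nat -> R) (t : seq nat) n : (forall i, 0 <= f i) -> uniq t ->
  (forall i, i \in t -> (i < n)%N) -> \sum_(i <- t) f i <= \sum_(i < n) f i.
Proof.
move=> f0 ut tn; rewrite (perm_big [seq i <- iota 0 n | i \in t]) /=; last first.
  apply: uniq_perm => //; first by rewrite filter_uniq// iota_uniq.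
  by move=> i; rewrite mem_filter mem_iota; case: (boolP (i \in t)) => // /tn ->.
rewrite big_filter big_mkcond -(big_mkord xpredT f) /index_iota subn0.
by apply: ler_sum => i _; case: ifP.
Qed.

Lemma ler_sum_term (f : nat -> R) n : (forall i, 0 <= f i) ->
  f n <= \sum_(i < n.+1) f i.
Proof. by move=> f0; rewrite big_ord_recr /= lerDr sumr_ge0. Qed.

Lemma powR_split_sqr p a : 2 < p -> 0 <= a -> a `^ p = a `^ (p - 2) * a ^+ 2.
Proof.
move=> p2 a0; have [->|an0] := eqVneq a 0.
  by rewrite expr0n mulr0 powR0// gt_eqF// (lt_trans _ p2).
by rewrite -powR_mulrn// -powRD ?subrK// an0 implybT.
Qed.

(** Every a i is at most C, hence a i ^ p <= C ^ (p - 2) a i ^ 2. *)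
Lemma sum_powR_le_sqr p (a : nat -> R) C : 2 < p -> 0 <= C -> (forall i, 0 <= a i) ->
  (forall m, \sum_(i < m) a i ^+ 2 <= C ^+ 2) ->
  forall m, \sum_(i < m) a i `^ p <= C `^ p.
Proof.
move=> p2 C0 a0 aC m; rewrite (powR_split_sqr p2 C0).
apply: (@le_trans _ _ (\sum_(i < m) C `^ (p - 2) * a i ^+ 2)).
  apply: ler_sum => i _; rewrite powR_split_sqr// ler_wpM2r ?sqr_ge0//.
  rewrite ler_powR2r ?subr_gt0// -(@ler_pXn2r _ 2)// ?nnegrE//.
  apply: le_trans (aC i.+1).
  by apply: (ler_sum_term (f := fun i => a i ^+ 2)) => j; exact: sqr_ge0.
by rewrite -mulr_sumr ler_wpM2l ?powR_ge0.
Qed.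

End real_powers.

(** * The spaces l^p(X_n) and X_{p,w} *)

Section lp_norm_finite.
Variables (R : realType) (k : scalar_kind).
Local Notation K := (Defs.scalar R k).
Variables (p : R) (p1 : 1 <= p) (X : nat -> normedModType K).

Lemma lp_norm_leP (x : forall n, X n) (C : R) : 0 <= C ->
  (lp_norm p x <= C%:E)%E <->
  forall n, \sum_(i < n) rnorm (x i) `^ p <= C `^ p.
Proof.
move=> C0; have p0 : 0 < p by exact: lt_le_trans p1.
have t0 (i : nat) : (0 <= (rnorm (x i) `^ p)%:E)%E by rewrite lee_fin powR_ge0.
have s0 : (0 <= \sum_(n <oo) (rnorm (x n) `^ p)%:E)%E.
  by apply: nneseries_ge0 => n _ _; exact: t0.
rewrite lp_normE//; split=> [le n|le].
  have : (\sum_(i <oo) (rnorm (x i) `^ p)%:E <= (C `^ p)%:E)%E.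
    have -> : (\sum_(i <oo) (rnorm (x i) `^ p)%:E =
        ((\sum_(i <oo) (rnorm (x i) `^ p)%:E) `^ p^-1) `^ p)%E.
      by rewrite -poweRrM mulVf ?gt_eqF// poweRe1.
    rewrite -poweR_EFin gt0_ler_poweR ?(ltW p0)//.
      by rewrite in_itv/= poweR_ge0 leey.
    by rewrite in_itv/= lee_fin C0 leey.
  rewrite -lee_fin; apply: le_trans.
  rewrite -sumEFin -(big_mkord xpredT (fun i => (rnorm (x i) `^ p)%:E)).
  by apply: nneseries_lim_ge => i _ _; exact: t0.
have -> : C%:E = (((C `^ p)%:E) `^ p^-1)%E by rewrite poweR_EFin powRK.
rewrite gt0_ler_poweR ?invr_ge0 ?(ltW p0)//.
- by rewrite in_itv/= s0 leey.
- by rewrite in_itv/= lee_fin powR_ge0 leey.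
apply: lime_le; first by apply: is_cvg_nneseries => n _ _; exact: t0.
by apply: nearW => n; rewrite sumEFin lee_fin big_mkord.
Qed.

End lp_norm_finite.

Section lp_sum_interface.
Variables (R : realType) (k : scalar_kind).
Local Notation K := (Defs.scalar R k).
Variables (p : R) (p1 : 1 <= p) (X : nat -> normedModType K).
Local Notation Y := (lp_sum p1 X).

Definition comp (x : Y) (n : nat) : X n := (finite_part_val x : sequences X) n.

(* Junk value: 0 if [f] has infinite norm. *)
Definition lp_mk (f : forall n, X n) : Y :=
  insubd (0 : finite_part (lp_enorm p1 X)) (f : sequences X).

Lemma comp_linear (a : K) (x y : Y) n : comp (a *: x + y) n = a *: comp x n + comp y n.
Proof. by []. Qed.

Lemma comp0 n : comp 0 n = 0.
Proof. by []. Qed.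

Lemma compD (x y : Y) n : comp (x + y) n = comp x n + comp y n.
Proof. by []. Qed.

Lemma compB (x y : Y) n : comp (x - y) n = comp x n - comp y n.
Proof. by []. Qed.

Lemma compZ (a : K) (x : Y) n : comp (a *: x) n = a *: comp x n.
Proof. by []. Qed.

Lemma comp_sum (I : Type) (s : seq I) (x : I -> Y) n :
  comp (\sum_(i <- s) x i) n = \sum_(i <- s) comp (x i) n.
Proof.
elim: s => [|i s IHs]; first by rewrite !big_nil comp0.
by rewrite !big_cons compD IHs.
Qed.

Lemma lp_ext (x y : Y) : (forall n, comp x n = comp y n) -> x = y.
Proof. by move=> xy; apply/val_inj/functional_extensionality_dep. Qed.

Lemma rnorm_lpE (x : Y) : (rnorm x)%:E = lp_norm p (comp x).
Proof.
rewrite /rnorm -[`|x|]/(finite_part_norm (x : finite_part (lp_enorm p1 X))).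
by rewrite /finite_part_norm of_realK fineK// finite_part_fin_num.
Qed.

Lemma rnorm_lpP (x : Y) (C : R) : 0 <= C ->
  rnorm x <= C <-> forall n, \sum_(i < n) rnorm (comp x i) `^ p <= C `^ p.
Proof.
by move=> C0; rewrite -lee_fin rnorm_lpE; exact: lp_norm_leP.
Qed.

Lemma comp_lp_mk (f : forall n, X n) (C : R) n : 0 <= C ->
  (forall n, \sum_(i < n) rnorm (f i) `^ p <= C `^ p) -> comp (lp_mk f) n = f n.
Proof.
move=> C0 fC; rewrite /comp /lp_mk -[finite_part_val _]/(val _) val_insubd.
rewrite inE (_ : _ < _)%E//.
by apply: le_lt_trans (ltry C); exact/(lp_norm_leP p1).
Qed.

Lemma sum_rnorm_comp (x : Y) n :
  \sum_(i < n) rnorm (comp x i) `^ p <= rnorm x `^ p.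
Proof. exact: (rnorm_lpP x (rnorm_ge0 x)).1. Qed.

Lemma rnorm_comp (x : Y) n : rnorm (comp x n) <= rnorm x.
Proof.
have p0 : 0 < p by exact: lt_le_trans p1.
rewrite -(ler_powR2r p0) ?rnorm_ge0//.
apply: le_trans (sum_rnorm_comp x n.+1).
by rewrite big_ord_recr /= lerDr sumr_ge0// => *; rewrite powR_ge0.
Qed.

Definition restrict (S : pred nat) (x : Y) : Y :=
  lp_mk (fun n => if S n then comp x n else 0).

Lemma comp_restrict S (x : Y) n : comp (restrict S x) n = if S n then comp x n else 0.
Proof.
apply: (comp_lp_mk _ (rnorm_ge0 x)) => m; apply: le_trans (sum_rnorm_comp x m).
apply: ler_sum => i _; rewrite ler_powR2r ?rnorm_ge0 ?(lt_le_trans _ p1)//.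
by case: ifP => // _; rewrite rnorm0 rnorm_ge0.
Qed.

Lemma restrict_linear S : linear (restrict S).
Proof.
move=> a x y; apply: lp_ext => n; rewrite comp_linear !comp_restrict.
by case: ifP => //; rewrite ?comp_linear// scaler0 addr0.
Qed.

(** The space X n varies with n, so y is transported along a proof of n = m. *)
Definition single (n : nat) (y : X n) : Y :=
  lp_mk (fun m => if pselect (n = m) is left e then eq_rect n X y m e else 0).

Lemma comp_single_aux n (y : X n) m : comp (single y) m =
  if pselect (n = m) is left e then eq_rect n X y m e else 0.
Proof.
have p0 : 0 < p by exact: lt_le_trans p1.
apply: (comp_lp_mk _ (rnorm_ge0 y)) => l.
elim: l => [|l IHl]; first by rewrite big_ord0 powR_ge0.
rewrite big_ord_recr /=; case: pselect => [e|_]; last first.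
  by rewrite rnorm0 powR0 ?(gt_eqF p0)// addr0.
case: l / e {IHl} => /=; rewrite big1 ?add0r// => i _.
case: pselect => [e|_]; last by rewrite rnorm0 powR0 ?(gt_eqF p0).
by exfalso; have := ltn_ord i; rewrite -e ltnn.
Qed.

Lemma comp_single n (y : X n) : comp (single y) n = y.
Proof.
rewrite comp_single_aux; case: pselect => // e.
by rewrite (Prop_irrelevance e (erefl n)).
Qed.

Lemma comp_single_neq n m (y : X n) : n != m -> comp (single y) m = 0.
Proof. by move=> /eqP nm; rewrite comp_single_aux; case: pselect. Qed.

Lemma rnorm_single n (y : X n) : rnorm (single y) = rnorm y.
Proof.
have p0 : 0 < p by exact: lt_le_trans p1.
apply: le_anti; apply/andP; split; last first.
  by rewrite -{1}[y]comp_single; exact: rnorm_comp.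
apply/rnorm_lpP => [|m]; first exact: rnorm_ge0.
have [nm|mn] := ltnP n m.
  rewrite (bigD1 (Ordinal nm))//= comp_single big1 ?addr0// => i ni.
  rewrite comp_single_neq ?rnorm0 ?powR0 ?(gt_eqF p0)//.
  by apply: contra ni => /eqP e; apply/eqP/val_inj.
rewrite big1 ?powR_ge0// => i _; rewrite comp_single_neq ?rnorm0 ?powR0 ?(gt_eqF p0)//.
by rewrite neq_ltn (leq_trans (ltn_ord i) mn) orbT.
Qed.

Lemma single_linear n : linear (@single n).
Proof.
move=> a x y; apply: lp_ext => m; rewrite comp_linear.
have [<-|nm] := eqVneq n m; first by rewrite !comp_single.
by rewrite !comp_single_neq// scaler0 addr0.
Qed.

Lemma restrict_ltnE n (x : Y) :
  restrict (fun i => (i < n)%N) x = \sum_(i < n) single (comp x i).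
Proof.
apply: lp_ext => m; rewrite comp_restrict comp_sum.
case: ltnP => [mn|nm].
  rewrite (bigD1 (Ordinal mn))//= comp_single big1 ?addr0// => i im.
  by rewrite comp_single_neq//; apply: contra im => /eqP e; apply/eqP/val_inj.
rewrite big1// => i _; rewrite comp_single_neq//.
by rewrite neq_ltn (leq_trans (ltn_ord i) nm).
Qed.

Lemma restrict_tail (x : Y) (e : R) : 0 < e -> exists n0, forall n, (n0 <= n)%N ->
  rnorm (restrict (fun i => (n <= i)%N) x) < e.
Proof.
move=> e0; have p0 : 0 < p by exact: lt_le_trans p1.
have ep : 0 < (e / 2) `^ p by rewrite powR_gt0// divr_gt0.
have [n0 n0P] := sum_tail (fun i => powR_ge0 (rnorm (comp x i)) p)
  (sum_rnorm_comp x) ep.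
exists n0 => n nn0; apply: (@le_lt_trans _ _ (e / 2)); last by lra.
apply/rnorm_lpP => [|m]; first by rewrite divr_ge0// ltW.
apply: le_trans (n0P n m nn0); apply: ler_sum => i _; rewrite comp_restrict.
by case: ifP => // _; rewrite rnorm0 powR0 ?(gt_eqF p0).
Qed.

End lp_sum_interface.

Section Xpw_interface.
Variables (R : realType) (k : scalar_kind).
Local Notation K := (Defs.scalar R k).
Variables (p : R) (p1 : 1 <= p) (w : nat -> R).
Local Notation Y := (Xpw k p1 w).
Local Notation absK z := (rnorm (z : K^o)).

Definition coord (x : Y) (n : nat) : K := (finite_part_val x : sequences (fun=> K^o)) n.

(* Junk value: 0 if [f] has infinite norm. *)
Definition Xpw_mk (f : nat -> K) : Y :=
  insubd (0 : finite_part (Xpw_enorm k p1 w)) (f : sequences (fun=> K^o)).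

Lemma coord_linear (a : K) (x y : Y) n :
  coord (a *: x + y) n = a * coord x n + coord y n.
Proof. by []. Qed.

Lemma coord0 n : coord 0 n = 0.
Proof. by []. Qed.

Lemma coordD (x y : Y) n : coord (x + y) n = coord x n + coord y n.
Proof. by []. Qed.

Lemma coordB (x y : Y) n : coord (x - y) n = coord x n - coord y n.
Proof. by []. Qed.

Lemma coordZ (a : K) (x : Y) n : coord (a *: x) n = a * coord x n.
Proof. by []. Qed.

Lemma coord_sum (I : Type) (s : seq I) (x : I -> Y) n :
  coord (\sum_(i <- s) x i) n = \sum_(i <- s) coord (x i) n.
Proof.
elim: s => [|i s IHs]; first by rewrite !big_nil coord0.
by rewrite !big_cons coordD IHs.
Qed.

Lemma Xpw_ext (x y : Y) : (forall n, coord x n = coord y n) -> x = y.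
Proof. by move=> xy; apply/val_inj/functional_extensionality_dep. Qed.

Lemma rnorm_XpwE (x : Y) : (rnorm x)%:E = Xpw_fun p w (coord x).
Proof.
rewrite /rnorm -[`|x|]/(finite_part_norm (x : finite_part (Xpw_enorm k p1 w))).
by rewrite /finite_part_norm of_realK fineK// finite_part_fin_num.
Qed.

Lemma Xpw_fun_leP (f : nat -> K) (C : R) : 0 <= C ->
  (Xpw_fun p w (f : sequences (fun=> K^o)) <= C%:E)%E <->
  (forall n, \sum_(i < n) absK (f i) `^ p <= C `^ p) /\
  (forall n, \sum_(i < n) w i ^+ 2 * absK (f i) ^+ 2 <= C ^+ 2).
Proof.
move=> C0; rewrite /Xpw_fun ge_max.
have -> : (forall n, \sum_(i < n) w i ^+ 2 * absK (f i) ^+ 2 <= C ^+ 2) <->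
   (forall n, \sum_(i < n) rnorm (weighted w f i) `^ 2 <= C `^ 2).
  have wE i : rnorm (weighted w f i) `^ 2 = w i ^+ 2 * absK (f i) ^+ 2.
    by rewrite powR_mulrn ?rnorm_ge0// rnormZ exprMn rnorm_of_real real_normK ?num_real.
  split=> h n.
    by rewrite powR_mulrn//; under eq_bigr => i _ do rewrite wE; exact: h.
  by have := h n; rewrite powR_mulrn//; under eq_bigr => i _ do rewrite wE.
have h2 := @lp_norm_leP R k 2 (ler1n R 2) (fun=> K^o) (weighted w f) C C0.
have hp := @lp_norm_leP R k p p1 (fun=> K^o) f C C0.
split=> [/andP[? ?]|[? ?]]; first by split; [apply/hp|apply/h2].
by apply/andP; split; [apply/hp|apply/h2].
Qed.

Lemma rnorm_XpwP (x : Y) (C : R) : 0 <= C -> rnorm x <= C <->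
  (forall n, \sum_(i < n) absK (coord x i) `^ p <= C `^ p) /\
  (forall n, \sum_(i < n) w i ^+ 2 * absK (coord x i) ^+ 2 <= C ^+ 2).
Proof.
by move=> C0; rewrite -lee_fin rnorm_XpwE; exact: Xpw_fun_leP.
Qed.

Lemma coord_Xpw_mk (f : nat -> K) (C : R) n : 0 <= C ->
  (forall n, \sum_(i < n) absK (f i) `^ p <= C `^ p) ->
  (forall n, \sum_(i < n) w i ^+ 2 * absK (f i) ^+ 2 <= C ^+ 2) ->
  coord (Xpw_mk f) n = f n.
Proof.
move=> C0 fp f2; rewrite /coord /Xpw_mk -[finite_part_val _]/(val _) val_insubd.
rewrite inE (_ : _ < _)%E//.
by apply: le_lt_trans (ltry C); exact/Xpw_fun_leP.
Qed.

Lemma sum_coord_p (x : Y) n : \sum_(i < n) absK (coord x i) `^ p <= rnorm x `^ p.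
Proof. exact: ((rnorm_XpwP x (rnorm_ge0 x)).1 (lexx _)).1. Qed.

Lemma sum_coord_2 (x : Y) n :
  \sum_(i < n) w i ^+ 2 * absK (coord x i) ^+ 2 <= rnorm x ^+ 2.
Proof. exact: ((rnorm_XpwP x (rnorm_ge0 x)).1 (lexx _)).2. Qed.

Lemma rnorm_coord (x : Y) n : absK (coord x n) <= rnorm x.
Proof.
have p0 : 0 < p by exact: lt_le_trans p1.
rewrite -(ler_powR2r p0) ?rnorm_ge0//.
apply: le_trans (sum_coord_p x n.+1).
by apply: (ler_sum_term (f := fun i => absK (coord x i) `^ p)) => i; exact: powR_ge0.
Qed.

Definition Xrestrict (S : pred nat) (x : Y) : Y :=
  Xpw_mk (fun n => if S n then coord x n else 0).

Lemma coord_Xrestrict S (x : Y) n : coord (Xrestrict S x) n = if S n then coord x n else 0.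
Proof.
have p0 : 0 < p by exact: lt_le_trans p1.
apply: (coord_Xpw_mk _ (rnorm_ge0 x)) => m.
  apply: le_trans (sum_coord_p x m); apply: ler_sum => i _.
  by case: ifP => // _; rewrite rnorm0 powR0 ?(gt_eqF p0)// powR_ge0.
apply: le_trans (sum_coord_2 x m); apply: ler_sum => i _.
by case: ifP => // _; rewrite rnorm0 expr0n mulr0 mulr_ge0// sqr_ge0.
Qed.

Lemma Xrestrict_linear S : linear (Xrestrict S).
Proof.
move=> a x y; apply: Xpw_ext => n; rewrite coord_linear !coord_Xrestrict.
by case: ifP => //; rewrite ?coord_linear// mulr0 addr0.
Qed.

Lemma Xrestrict_tail (x : Y) (e : R) : 0 < e -> exists n0, forall n, (n0 <= n)%N ->
  rnorm (Xrestrict (fun i => (n <= i)%N) x) < e.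
Proof.
move=> e0; have p0 : 0 < p by exact: lt_le_trans p1.
have ep : 0 < (e / 2) `^ p by rewrite powR_gt0// divr_gt0.
have e2 : 0 < (e / 2) ^+ 2 by rewrite exprn_gt0// divr_gt0.
have [n0 n0P] := sum_tail (fun i => powR_ge0 (absK (coord x i)) p)
  (sum_coord_p x) ep.
have w0 i : 0 <= w i ^+ 2 * absK (coord x i) ^+ 2 by rewrite mulr_ge0// sqr_ge0.
have [n1 n1P] := sum_tail w0 (sum_coord_2 x) e2.
exists (maxn n0 n1) => n; rewrite geq_max => /andP[nn0 nn1].
apply: (@le_lt_trans _ _ (e / 2)); last by lra.
apply/rnorm_XpwP; first by rewrite divr_ge0// ltW.
split=> m.
  apply: le_trans (n0P n m nn0); apply: ler_sum => i _; rewrite coord_Xrestrict.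
  by case: ifP => // _; rewrite rnorm0 powR0 ?(gt_eqF p0).
apply: le_trans (n1P n m nn1); apply: ler_sum => i _; rewrite coord_Xrestrict.
by case: ifP => // _; rewrite rnorm0 expr0n mulr0.
Qed.

Definition unit_vector (n : nat) : Y := Xpw_mk (fun m => (n == m)%:R).

Lemma coord_unit_vector n m : coord (unit_vector n) m = (n == m)%:R.
Proof.
have p0 : 0 < p by exact: lt_le_trans p1.
have abs1 : absK (1 : K) = 1 by rewrite -(of_real1 R k) rnorm_of_real normr1.
have bd (f : K -> R) (g : nat -> R) D l : (forall i, 0 <= g i) -> 0 <= D -> g n <= D ->
    f 0 = 0 -> f 1 = 1 -> \sum_(i < l) g i * f (n == i)%:R <= D.
  move=> g0 D0 gD f0 f1; have [nl|ln] := ltnP n l.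
    rewrite (bigD1 (Ordinal nl))//= eqxx f1 mulr1 big1 ?addr0// => i ni.
    suff /negbTE -> : n != i by rewrite f0 mulr0.
    by apply: contra ni => /eqP e; apply/eqP/val_inj.
  rewrite big1// => i _; suff /negbTE -> : n != i by rewrite f0 mulr0.
  by rewrite neq_ltn (leq_trans (ltn_ord i) ln) orbT.
have wn : 0 <= `|w n| by [].
apply: (@coord_Xpw_mk _ (1 + `|w n|)) => [|l|l]; first by rewrite addr_ge0.
  have := bd (fun z => absK z `^ p) (fun=> 1) ((1 + `|w n|) `^ p) l.
  under eq_bigr => i _ do rewrite mul1r.
  apply => //; rewrite ?powR_ge0//.
  - apply: (@le_trans _ _ (1 `^ p)); first by rewrite powR1.
    by rewrite ler_powR2r// ?addr_ge0// lerDl.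
  - by rewrite rnorm0 powR0 ?(gt_eqF p0).
  - by rewrite abs1 powR1.
have := bd (fun z => absK z ^+ 2) (fun i => w i ^+ 2) ((1 + `|w n|) ^+ 2) l.
apply => [i|||| ]; rewrite ?sqr_ge0//.
- by rewrite -real_normK ?num_real// ler_pXn2r ?nnegrE ?addr_ge0// lerDr.
- by rewrite rnorm0 expr0n.
- by rewrite abs1 expr1n.
Qed.

Lemma Xrestrict_ltnE n (x : Y) :
  Xrestrict (fun i => (i < n)%N) x = \sum_(i < n) coord x i *: unit_vector i.
Proof.
apply: Xpw_ext => m; rewrite coord_Xrestrict coord_sum.
under eq_bigr => i _ do rewrite coordZ coord_unit_vector.
case: ltnP => [mn|nm].
  rewrite (bigD1 (Ordinal mn))//= eqxx mulr1 big1 ?addr0// => i im.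
  suff /negbTE -> : i != m :> nat by rewrite mulr0.
  by apply: contra im => /eqP e; apply/eqP/val_inj.
rewrite big1// => i _; suff /negbTE -> : i != m :> nat by rewrite mulr0.
by rewrite neq_ltn (leq_trans (ltn_ord i) nm).
Qed.

Lemma rnorm_sum_unit_vector (I : eqType) (s : seq I) (j : I -> nat) (c : I -> K) (C : R) :
  0 <= C -> uniq s -> {in s &, injective j} ->
  \sum_(i <- s) absK (c i) `^ p <= C `^ p ->
  \sum_(i <- s) w (j i) ^+ 2 * absK (c i) ^+ 2 <= C ^+ 2 ->
  rnorm (\sum_(i <- s) c i *: unit_vector (j i)) <= C.
Proof.
move=> C0 us injj cp c2; have p0 : 0 < p by exact: lt_le_trans p1.
have dis m : {in s &, forall i i', c i * (j i == m)%:R <> 0 ->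
    c i' * (j i' == m)%:R <> 0 -> i = i'}.
  move=> i i' si si'; have [<-|] := eqVneq (j i) m; last by rewrite mulr0.
  have [/esym/injj ->//|] := eqVneq (j i') (j i); last by rewrite mulr0.
have one (a : I -> R) n : (forall i, 0 <= a i) ->
    \sum_(i < n) \sum_(l <- s) a l * (j l == i)%:R <= \sum_(l <- s) a l.
  move=> a0; rewrite exchange_big /=; apply: ler_sum => l _.
  rewrite -mulr_sumr ler_piMr//.
  have [ln|nl] := ltnP (j l) n.
    rewrite (bigD1 (Ordinal ln))//= eqxx big1 ?addr0// => i li.
    suff /negbTE -> : j l != i by [].
    by apply: contra li => /eqP e; apply/eqP/val_inj.
  rewrite big1// => i _; suff /negbTE -> : j l != i by [].
  by rewrite neq_ltn (leq_trans (ltn_ord i) nl) orbT.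
apply/rnorm_XpwP => //; split=> n.
  apply: le_trans cp; apply: le_trans (one _ n (fun i => powR_ge0 (absK (c i)) p)).
  apply: ler_sum => m _; rewrite coord_sum.
  under eq_bigr => i _ do rewrite coordZ coord_unit_vector.
  apply: le_trans (@sum_disjoint _ _ _ (fun z : K => absK z `^ p) _ _ _ _ us (@dis m)) _.
  - by rewrite rnorm0 powR0 ?(gt_eqF p0).
  - by move=> z; exact: powR_ge0.
  - apply: ler_sum => i _; case: eqP => _; rewrite ?mulr1// !mulr0.
    by rewrite rnorm0 powR0 ?(gt_eqF p0).
apply: le_trans c2.
have a0 i : 0 <= w (j i) ^+ 2 * absK (c i) ^+ 2 by rewrite mulr_ge0// sqr_ge0.
apply: le_trans (one _ n a0); apply: ler_sum => m _; rewrite coord_sum.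
under eq_bigr => i _ do rewrite coordZ coord_unit_vector.
apply: le_trans (ler_wpM2l (sqr_ge0 (w m))
  (@sum_disjoint _ _ _ (fun z : K => absK z ^+ 2) _ _ _ _ us (@dis m))) _.
- by rewrite rnorm0 expr0n.
- by move=> z; exact: sqr_ge0.
- rewrite mulr_sumr; apply: ler_sum => i _; case: eqP => [<-|_]; rewrite ?mulr1// !mulr0.
  by rewrite rnorm0 expr0n mulr0.
Qed.

Lemma sum_coord_2_inj (I : eqType) (s : seq I) (j : I -> nat) (x : Y) :
  uniq s -> {in s &, injective j} ->
  \sum_(i <- s) w (j i) ^+ 2 * absK (coord x (j i)) ^+ 2 <= rnorm x ^+ 2.
Proof.
move=> us injj; have a0 i : 0 <= w i ^+ 2 * absK (coord x i) ^+ 2.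
  by rewrite mulr_ge0// sqr_ge0.
rewrite -(big_map j xpredT (fun i => w i ^+ 2 * absK (coord x i) ^+ 2)).
have : uniq (map j s) by rewrite map_inj_in_uniq.
set t := map j s => ut.
apply: le_trans (sum_coord_2 x (\max_(i <- t) i).+1).
apply: sum_uniq_le => // i it.
by rewrite ltnS; apply: leq_bigmax_seq.
Qed.

End Xpw_interface.

(** * Factorizations of the identity *)

Section linear_functions.
Variables (K : pzRingType) (U V : lmodType K) (f : U -> V).
Hypothesis fL : linear f.

Lemma lin0 : f 0 = 0.
Proof. by have := fL 1 0 0; rewrite !scale1r addr0 -[LHS]addr0 => /addrI. Qed.

Lemma linD x y : f (x + y) = f x + f y.
Proof. by have := fL 1 x y; rewrite !scale1r. Qed.

Lemma linZ a x : f (a *: x) = a *: f x.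
Proof. by have := fL a x 0; rewrite lin0 !addr0. Qed.

Lemma linN x : f (- x) = - f x.
Proof. by rewrite -!scaleN1r linZ. Qed.

Lemma linB x y : f (x - y) = f x - f y.
Proof. by rewrite linD linN. Qed.

Lemma lin_sum (I : Type) (s : seq I) (x : I -> U) :
  f (\sum_(i <- s) x i) = \sum_(i <- s) f (x i).
Proof.
elim: s => [|i s IHs]; first by rewrite !big_nil lin0.
by rewrite !big_cons linD IHs.
Qed.

End linear_functions.

Lemma linear_sub (K : pzRingType) (U V : lmodType K) (f g : U -> V) :
  linear f -> linear g -> linear (fun x => f x - g x).
Proof. by move=> fL gL a x y; rewrite fL gL scalerBr opprD addrACA. Qed.

Section factorization.
Variables (R : realType) (k : scalar_kind).
Local Notation K := (Defs.scalar R k).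
Implicit Types E F G H : normedModType K.

Definition bounded_linear E F (C : R) (f : E -> F) :=
  linear f /\ forall x, rnorm (f x) <= C * rnorm x.

(** No range or projection appears, so the relation composes, and passes to transposes with A and B
    exchanged. *)
Definition factors E F := exists (C : R) (A : E -> F) (B : F -> E),
  [/\ 0 <= C, bounded_linear C A, bounded_linear C B & cancel A B].

Lemma bounded_linear_comp E F G C D (g : F -> G) (f : E -> F) : 0 <= C ->
  bounded_linear C g -> bounded_linear D f -> bounded_linear (C * D) (g \o f).
Proof.
move=> C0 [gL gC] [fL fD]; split=> [a x y|x] /=; first by rewrite fL gL.
by rewrite (le_trans (gC _))// -mulrA ler_wpM2l.
Qed.

Lemma bounded_linear_le E F C D (f : E -> F) : C <= D ->
  bounded_linear C f -> bounded_linear D f.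
Proof.
move=> CD [fL fC]; split=> // x; apply: le_trans (fC x) _.
by rewrite ler_wpM2r// rnorm_ge0.
Qed.

Lemma factorsI E F C D (A : E -> F) (B : F -> E) : 0 <= C -> 0 <= D ->
  bounded_linear C A -> bounded_linear D B -> cancel A B -> factors E F.
Proof.
move=> C0 D0 AC BD AB; exists (C + D), A, B; split=> //; first exact: addr_ge0.
  by apply: bounded_linear_le AC; rewrite lerDl.
by apply: bounded_linear_le BD; rewrite lerDr.
Qed.

Lemma factors_trans F E G : factors E F -> factors F G -> factors E G.
Proof.
move=> [C [A [B [C0 AC BC AB]]]] [D [A' [B' [D0 AD BD AB']]]].
apply: (@factorsI _ _ (D * C) (C * D) (A' \o A) (B \o B')); rewrite ?mulr_ge0//.
- exact: bounded_linear_comp.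
- exact: bounded_linear_comp.
- by move=> x /=; rewrite AB' AB.
Qed.

Lemma continuous_bounded_linear E F (f : {linear E -> F}) : continuous f ->
  exists2 C : R, 0 <= C & bounded_linear C f.
Proof.
move=> fc; have fb : bounded_near f (nbhs 0).
  by apply: continuous_linear_bounded; exact: fc.
have [M M0 fM] := pinfty_ex_gt0 ((linear_boundedP f).1 fb).
exists (real_part M); first by rewrite -(ler_of_real k) of_real0 real_partK ltW.
split=> [a x y|x]; first exact: linearP.
by rewrite -(ler_of_real k) of_realM !of_real_rnorm real_partK ?(ltW M0)// fM.
Qed.

(** The left inverse of T is T^-1 P: it is defined because T is injective with the same range as P,
    and the lower bound c of T bounds it by D / c. *)
Lemma complemented_embedding_factors E F : complemented_embedding E F -> factors E F.
Proof.
move=> [T [P [[Tc [c c0 cT]] [Pc PP] rTP]]].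
have [C C0 [_ TC]] := continuous_bounded_linear Tc.
have [D D0 [_ PD]] := continuous_bounded_linear Pc.
have rc0 : 0 < real_part c.
  rewrite ltNge -(ler_of_real k) of_real0 real_partK ?(ltW c0)//.
  by rewrite -real_ltNge ?ger0_real ?(ltW c0).
have {}cT x : real_part c * rnorm x <= rnorm (T x).
  by rewrite -(ler_of_real k) of_realM !of_real_rnorm real_partK ?(ltW c0).
have T_inj x y : T x = T y -> x = y.
  move=> Txy; apply/eqP; rewrite -subr_eq0; apply/eqP/rnorm0_eq0/eqP.
  rewrite eq_le rnorm_ge0 andbT -(pmulr_rle0 _ rc0) (le_trans (cT _))//.
  by rewrite linearB Txy subrr rnorm0.
have /choice[B TB] y : exists x, T x = P y.
  have [x _ <-] : range T (P y) by rewrite rTP; exists y.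
  by exists x.
apply: (@factorsI _ _ C ((real_part c)^-1 * D) T B) => //.
- by rewrite mulr_ge0// invr_ge0 ltW.
- by split=> // a x y; exact: linearP.
- split=> [a x y|y].
    by apply: T_inj; rewrite linearP !TB linearP.
  by rewrite -mulrA ler_pdivlMl// (le_trans (cT _))// TB.
- move=> x; apply: T_inj; rewrite TB.
  by have [y _ <-] : range P (T x) by rewrite -rTP; exists x.
Qed.

Lemma rnorm_pair E F (x : E) (y : F) :
  rnorm ((x, y) : direct_sum E F) = Num.max (rnorm x) (rnorm y).
Proof.
apply: (@of_real_inj R k); rewrite of_real_rnorm prod_normE /=.
rewrite -(of_real_rnorm x) -(of_real_rnorm y).
case: (leP (rnorm x)) => xy.
  by rewrite max_r ?ler_of_real.
by rewrite max_l ?ler_of_real// ltW.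
Qed.

Lemma bounded_linear_id E : bounded_linear 1 (@id E).
Proof. by split=> // x; rewrite mul1r. Qed.

Lemma factors_refl E : factors E E.
Proof.
exact: (factorsI ler01 ler01 (bounded_linear_id E) (bounded_linear_id E)).
Qed.

Lemma bounded_linear_pair E F G C (f : G -> E) (g : G -> F) :
  bounded_linear C f -> bounded_linear C g ->
  bounded_linear C (fun x => (f x, g x) : direct_sum E F).
Proof.
move=> [fL fC] [gL gC]; split=> [a x y|x]; first by rewrite fL gL.
by rewrite rnorm_pair ge_max fC gC.
Qed.

Lemma bounded_linear_fst E F : bounded_linear 1 (fst : direct_sum E F -> E).
Proof. by split=> // -[x y]; rewrite mul1r rnorm_pair le_max lexx. Qed.

Lemma bounded_linear_snd E F : bounded_linear 1 (snd : direct_sum E F -> F).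
Proof. by split=> // -[x y]; rewrite mul1r rnorm_pair le_max lexx orbT. Qed.

Lemma bounded_linear_zero E F C : 0 <= C -> bounded_linear C (fun _ : E => 0 : F).
Proof.
by move=> C0; split=> [a x y|x]; rewrite ?scaler0 ?addr0// rnorm0 mulr_ge0 ?rnorm_ge0.
Qed.

Lemma factors_inl E F : factors E (direct_sum E F).
Proof.
by apply: (factorsI ler01 ler01 (bounded_linear_pair (bounded_linear_id E)
  (bounded_linear_zero E F ler01)) (bounded_linear_fst E F)).
Qed.

Lemma factors_inr E F : factors F (direct_sum E F).
Proof.
by apply: (factorsI ler01 ler01 (bounded_linear_pair (bounded_linear_zero F E ler01)
  (bounded_linear_id F)) (bounded_linear_snd E F)).
Qed.

Lemma factors_pair E F G H : factors E G -> factors F H ->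
  factors (direct_sum E F) (direct_sum G H).
Proof.
move=> [C [A [B [C0 AC BC AB]]]] [D [A' [B' [D0 AD BD AB']]]].
have CD : C <= C + D by rewrite lerDl.
have DC : D <= C + D by rewrite lerDr.
have pr (E1 F1 E2 F2 : normedModType K) (f : E1 -> E2) (g : F1 -> F2) :
    bounded_linear C f -> bounded_linear D g ->
    bounded_linear (C + D) (fun x : direct_sum E1 F1 => (f x.1, g x.2) : direct_sum E2 F2).
  move=> fC gD; apply: bounded_linear_pair.
    rewrite -[C + D]mulr1; apply: (bounded_linear_comp _ _ (bounded_linear_fst _ _)).
      by rewrite addr_ge0.
    exact: bounded_linear_le fC.
  rewrite -[C + D]mulr1; apply: (bounded_linear_comp _ _ (bounded_linear_snd _ _)).
    by rewrite addr_ge0.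
  exact: bounded_linear_le gD.
apply: (factorsI _ _ (pr _ _ _ _ A A' AC AD) (pr _ _ _ _ B B' BC BD)); rewrite ?addr_ge0//.
by move=> [x y] /=; rewrite AB AB'.
Qed.

End factorization.

Lemma increasing_subsequence (P : nat -> Prop) : (forall l, exists2 j, (l <= j)%N & P j) ->
  exists f : nat -> nat, {homo f : i j / (i < j)%N} /\ forall i, P (f i).
Proof.
move=> Pinf; have /choice[g gP] l : exists j, (l <= j)%N /\ P j.
  by have [j] := Pinf l; exists j.
exists (fun i => iter i (fun j => g j.+1) (g 0)); split.
  by apply: homo_ltn => [n m l|i]; [exact: ltn_trans|exact: (gP _).1].
by case=> [|i]; exact: (gP _).2.
Qed.

Lemma homo_ltn_inj (f : nat -> nat) : {homo f : i j / (i < j)%N} -> injective f.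
Proof.
move=> fm i j fij; apply/eqP; case: ltngtP => // /fm; rewrite fij ltnn //.
Qed.

(** Lists the entries of m blocks of lengths s 0, s 1, ..., so that a double sum becomes a single
    one to which Cauchy-Schwarz applies. *)
Definition index_pairs (m : nat) (s : nat -> nat) : seq (nat * nat) :=
  [seq (x, y) | x <- iota 0 m, y <- iota 0 (s x)].

Lemma index_pairs_uniq m s : uniq (index_pairs m s).
Proof.
apply: allpairs_uniq_dep => [|x _|]; [exact: iota_uniq|exact: iota_uniq|].
by move=> [x1 y1] [x2 y2] _ _ /= [-> ->].
Qed.

Lemma mem_index_pairs m s x : (x \in index_pairs m s) = (x.1 < m)%N && (x.2 < s x.1)%N.
Proof.
apply/allpairsPdep/idP => [[i [j []]]|/andP[xm xs]].
  by rewrite !mem_iota /= => im js ->; rewrite im.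
by exists x.1, x.2; rewrite !mem_iota; split=> //; case: x {xm xs}.
Qed.

Lemma sum_index_pairs (V : nmodType) m s (F : nat -> nat -> V) :
  \sum_(x <- index_pairs m s) F x.1 x.2 = \sum_(i < m) \sum_(j < s i) F i j.
Proof.
rewrite /index_pairs big_allpairs_dep -(big_mkord xpredT (fun i => \sum_(j < s i) F i j)).
rewrite /index_iota subn0; apply: eq_bigr => i _.
by rewrite -(big_mkord xpredT (F i)) /index_iota subn0.
Qed.

Lemma cauchy_schwarz_seq (R : realType) (I : eqType) (s : seq I) (a b : I -> R) A B :
  (forall i, 0 <= a i) -> (forall i, 0 <= b i) -> 0 <= A -> 0 <= B ->
  \sum_(i <- s) a i ^+ 2 <= A ^+ 2 -> \sum_(i <- s) b i ^+ 2 <= B ^+ 2 ->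
  \sum_(i <- s) a i * b i <= A * B.
Proof.
case: s => [|i0 s] a0 b0 A0 B0; first by move=> _ _; rewrite big_nil mulr_ge0.
rewrite !(big_nth i0) !big_mkord => aA bB.
by apply: (cauchy_schwarz_sum (a := fun j => a (nth i0 _ j)) (b := fun j => b (nth i0 _ j))).
Qed.

Lemma sum_const_ord (R : pzSemiRingType) m (a : R) : \sum_(i < m) a = m%:R * a.
Proof. by rewrite sumr_const card_ord mulr_natl. Qed.

Lemma rnorm_signr (R : realType) (k : scalar_kind) (b : bool) (z : Defs.scalar R k) :
  rnorm ((-1) ^+ b * z : (Defs.scalar R k)^o) = rnorm (z : (Defs.scalar R k)^o).
Proof. exact: rnorm_sign. Qed.

(** * Diagonal pairings *)

Section upper_estimates.
Variables (R : realType) (k : scalar_kind).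
Local Notation K := (Defs.scalar R k).
Local Notation absK z := (rnorm (z : K^o)).
Variables (p : R) (p1 : 1 <= p).
Let p0 : 0 < p. Proof. exact: lt_le_trans p1. Qed.

Lemma window_disjoint (V : nmodType) (n : nat -> nat) (x : nat -> V) l i j :
  {homo n : i j / (i <= j)%N} ->
  (if (n i <= l < n i.+1)%N then x i else 0) <> 0 ->
  (if (n j <= l < n j.+1)%N then x j else 0) <> 0 -> i = j.
Proof.
move=> nm; case: ifP => // /andP[il li] _; case: ifP => // /andP[jl lj] _.
apply/eqP; case: ltngtP => // ij.
  by have := leq_trans (leq_ltn_trans jl li) (nm _ _ ij); rewrite ltnn.
by have := leq_trans (leq_ltn_trans il lj) (nm _ _ ij); rewrite ltnn.
Qed.

Section lp.
Variable X : nat -> normedModType K.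
Local Notation Y := (lp_sum p1 X).
Definition tail (n : nat) : Y -> Y := restrict (fun i => (n <= i)%N).

Lemma tail_linear n : linear (tail n).
Proof. exact: restrict_linear. Qed.

Lemma comp_window n m (x : Y) l : (n <= m)%N ->
  comp (tail n x - tail m x) l = if (n <= l < m)%N then comp x l else 0.
Proof.
move=> nm; rewrite compB !comp_restrict.
have [ml|lm] := leqP m l; first by rewrite (leq_trans nm ml) subrr.
by rewrite subr0 andbT.
Qed.

Lemma rnorm_sum_lp (I : eqType) (s : seq I) (x : I -> Y) (C : R) : 0 <= C -> uniq s ->
  (forall i, rnorm (x i) <= C) ->
  (forall l, {in s &, forall i j, comp (x i) l <> 0 -> comp (x j) l <> 0 -> i = j}) ->
  rnorm (\sum_(i <- s) x i) <= (size s)%:R `^ p^-1 * C.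
Proof.
move=> C0 us xC dis; apply/rnorm_lpP => [|n]; first by rewrite mulr_ge0// powR_ge0.
rewrite powRM ?powR_ge0// powRV//.
apply: (@le_trans _ _ (\sum_(l < n) \sum_(i <- s) rnorm (comp (x i) l) `^ p)).
  apply: ler_sum => l _; rewrite comp_sum.
  apply: (@sum_disjoint _ _ _ (fun z : X l => rnorm z `^ p)) => //.
  - by rewrite rnorm0 powR0// gt_eqF.
  - by move=> z; exact: powR_ge0.
  - exact: dis.
rewrite exchange_big /= -sum1_size natr_sum mulr_suml.
apply: ler_sum => i _; rewrite mul1r.
apply: le_trans (sum_rnorm_comp (x i) n) _.
by rewrite ler_powR2r ?rnorm_ge0.
Qed.

Lemma rnorm_sum_window (n : nat -> nat) (x : nat -> Y) (C : R) m : 0 <= C ->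
  {homo n : i j / (i <= j)%N} -> (forall i, rnorm (x i) <= C) ->
  rnorm (\sum_(i < m) (tail (n i) (x i) - tail (n i.+1) (x i))) <= m%:R `^ p^-1 * C.
Proof.
move=> C0 nm xC.
rewrite -(big_mkord xpredT (fun i => tail (n i) (x i) - tail (n i.+1) (x i))).
have -> : m%:R = (size (index_iota 0 m))%:R :> R by rewrite size_iota subn0.
apply: rnorm_sum_lp => //; first exact: iota_uniq.
  move=> i; apply: le_trans (xC i); apply/rnorm_lpP => [|l]; first exact: rnorm_ge0.
  apply: le_trans (sum_rnorm_comp (x i) l); apply: ler_sum => j _.
  rewrite ler_powR2r ?rnorm_ge0// comp_window ?nm//.
  by case: ifP => // _; rewrite rnorm0 rnorm_ge0.
move=> l i j _ _; rewrite !comp_window ?nm//.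
exact: (window_disjoint (x := fun i => comp (x i) l)).
Qed.

End lp.

Section Xpw.
Variable w : nat -> R.
Local Notation X := (Xpw k p1 w).
Definition Xtail (n : nat) : X -> X := Xrestrict (fun i => (n <= i)%N).

Lemma Xtail_linear n : linear (Xtail n).
Proof. exact: Xrestrict_linear. Qed.

Lemma coord_window n m (x : X) l : (n <= m)%N ->
  coord (Xtail n x - Xtail m x) l = if (n <= l < m)%N then coord x l else 0.
Proof.
move=> nm; rewrite coordB !coord_Xrestrict.
have [ml|lm] := leqP m l; first by rewrite (leq_trans nm ml) subrr.
by rewrite subr0 andbT.
Qed.

(** The weighted l^2 bound S is kept apart from the norm bound C because [zeroth_pairing] uses an S
    that carries the small factor d^2 v^2. Accordingly D has to dominate both m^(1/p) C and (m
    S)^(1/2). *)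
Lemma rnorm_sum_Xwindow (n : nat -> nat) (x : nat -> X) (C S D : R) m : 0 <= C -> 0 <= D ->
  {homo n : i j / (i <= j)%N} -> (forall i, rnorm (x i) <= C) ->
  (forall i l, \sum_(j < l) w j ^+ 2 * absK (coord (x i) j) ^+ 2 <= S) ->
  m%:R * C `^ p <= D `^ p -> m%:R * S <= D ^+ 2 ->
  rnorm (\sum_(i < m) (Xtail (n i) (x i) - Xtail (n i.+1) (x i))) <= D.
Proof.
move=> C0 D0 nm xC xS mC mS.
have dis l i j : (i < m)%N -> (j < m)%N ->
    coord (Xtail (n i) (x i) - Xtail (n i.+1) (x i)) l <> 0 ->
    coord (Xtail (n j) (x j) - Xtail (n j.+1) (x j)) l <> 0 -> i = j.
  move=> _ _; rewrite !coord_window ?nm//.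
  exact: (window_disjoint (x := fun i => coord (x i) l : K)).
have le1 i l : absK (coord (Xtail (n i) (x i) - Xtail (n i.+1) (x i)) l) <= absK (coord (x i) l).
  by rewrite coord_window ?nm//; case: ifP => // _; rewrite rnorm0 rnorm_ge0.
apply/rnorm_XpwP => //; split=> l.
  apply: (@le_trans _ _ (\sum_(j < l) \sum_(i < m) absK (coord (x i) j) `^ p)).
    apply: ler_sum => j _; rewrite coord_sum.
    apply: le_trans (@sum_ord_disjoint _ _ (fun z : K => absK z `^ p) _
      (fun i => coord (Xtail (n i) (x i) - Xtail (n i.+1) (x i)) j) _ _ (dis j)) _.
    - by rewrite rnorm0 powR0// gt_eqF.
    - by move=> z; exact: powR_ge0.
    by apply: ler_sum => i _; rewrite ler_powR2r ?rnorm_ge0.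
  rewrite exchange_big /=; apply: le_trans mC; rewrite -sum_const_ord.
  apply: ler_sum => i _; apply: le_trans (sum_coord_p (x i) l) _.
  by rewrite ler_powR2r ?rnorm_ge0.
apply: (@le_trans _ _ (\sum_(j < l) \sum_(i < m) w j ^+ 2 * absK (coord (x i) j) ^+ 2)).
  apply: ler_sum => j _; rewrite coord_sum -mulr_sumr ler_wpM2l ?sqr_ge0//.
  apply: le_trans (@sum_ord_disjoint _ _ (fun z : K => absK z ^+ 2) _
      (fun i => coord (Xtail (n i) (x i) - Xtail (n i.+1) (x i)) j) _ _ (dis j)) _.
  - by rewrite rnorm0 expr0n.
  - by move=> z; exact: sqr_ge0.
  by apply: ler_sum => i _; rewrite ler_pXn2r ?nnegrE ?rnorm_ge0.
rewrite exchange_big /=; apply: le_trans mS; rewrite -sum_const_ord.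
by apply: ler_sum => i _; exact: xS.
Qed.

End Xpw.

End upper_estimates.

(** * Signed sums of basis vectors paired with signed sums of coordinates *)

Section signs_pairing.
Variables (R : realType) (k : scalar_kind).
Local Notation K := (Defs.scalar R k).
Local Notation absK z := (rnorm (z : K^o)).
Local Notation re := (@real_part R k).
Local Notation r2K := (@of_real R k).

Lemma real_part_sign (b : bool) (z : K) : re ((-1) ^+ b * z) = (-1) ^+ b * re z.
Proof. by case: b => /=; rewrite ?expr1 ?expr0 ?mulN1r ?mul1r ?real_partN. Qed.

Variables (p : R) (p1 : 1 <= p) (w : nat -> R) (Y : normedModType K).
Local Notation E := (Xpw k p1 w).
Variables (A : E -> Y) (B : Y -> E) (C : R).
Hypotheses (AL : linear A) (BC : bounded_linear C B) (C0 : 0 <= C).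

Definition block (s : nat) (idx : nat -> nat) (a : R) (e : nat -> bool) : E :=
  \sum_(i < s) ((-1) ^+ e i * r2K a) *: unit_vector k p1 w (idx i).

(** The two parts of the norm are s^(1/p) a and s^(1/2) v a; for fixed v the second one dominates
    once s is large. *)
Lemma rnorm_block s idx a e v D : 0 <= D -> 0 <= a ->
  (forall i, (i < s)%N -> w (idx i) = v) ->
  (forall i j, (i < s)%N -> (j < s)%N -> idx i = idx j -> i = j) ->
  s%:R * a `^ p <= D `^ p -> s%:R * (v ^+ 2 * a ^+ 2) <= D ^+ 2 ->
  rnorm (block s idx a e) <= D.
Proof.
move=> D0 a0 wv inj sa sv.
rewrite /block -(big_mkord xpredT (fun i => ((-1) ^+ e i * r2K a) *: unit_vector k p1 w (idx i))).
have absE i : absK ((-1) ^+ e i * r2K a) = a.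
  by rewrite rnorm_signr rnorm_of_real ger0_norm.
apply: rnorm_sum_unit_vector => //; first exact: iota_uniq.
- by move=> i j; rewrite !mem_index_iota; exact: inj.
- by rewrite big_mkord; under eq_bigr => i _ do rewrite absE; rewrite sum_const_ord.
- rewrite big_mkord; apply: le_trans sv; rewrite -sum_const_ord.
  by apply: ler_sum => i _; rewrite absE wv.
Qed.

(* [signs_bilinear] for the matrix pairing the images of basis vectors with the
   coordinates. A sum of [s] coordinates of weight [v], with coefficients [c], is a
   functional of norm at most [c * s^(1/2) / v], here bounded by [D]. *)
Lemma signs_pairing m (s : nat -> nat) (idx : nat -> nat -> nat) (a c v : nat -> R)
    (D : R) (T : nat -> Y -> Y) : 0 <= D -> (forall i, linear (T i)) ->
  (forall i, 0 < v i) -> (forall i, 0 <= c i) ->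
  (forall i j, (j < s i)%N -> w (idx i j) = v i) ->
  (forall i, (s i)%:R * c i ^+ 2 <= D ^+ 2 * v i ^+ 2) ->
  (forall i i' j j', (i < m)%N -> (i' < m)%N -> (j < s i)%N -> (j' < s i')%N ->
     idx i j = idx i' j' -> i = i' /\ j = j') ->
  exists (e : nat -> nat -> bool) (h : nat -> bool),
  \sum_(i < m) \sum_(j < s i) a i * c i *
    re (coord (B (T i (A (unit_vector k p1 w (idx i j))))) (idx i j)) <=
  m%:R `^ 2^-1 * D * C *
    rnorm (\sum_(i < m) (-1) ^+ h i *: T i (A (block (s i) (idx i) (a i) (e i)))).
Proof.
move=> D0 TL v0 c0 wv sc inj; have [BL BnC] := BC.
pose f i j j' := re (coord (B (T i (A (unit_vector k p1 w (idx i j'))))) (idx i j)).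
(* Signs are chosen twice: [e i] inside block i, bounding the diagonal sum of that block by
   [beta i i], then [h] across the blocks for the matrix [beta]. *)
have /choice[e eP] i : exists e : nat -> bool,
    \sum_(j < s i) a i * c i * f i j j <=
    \sum_(j < s i) \sum_(j' < s i) (-1) ^+ e j * (-1) ^+ e j' * (a i * c i * f i j j').
  exact: signs_bilinear (fun j j' => a i * c i * f i j j') (s i).
pose z i := T i (A (block (s i) (idx i) (a i) (e i))).
pose beta i i' := \sum_(j < s i) (-1) ^+ e i j * c i * re (coord (B (z i')) (idx i j)).
have betaE i : \sum_(j < s i) \sum_(j' < s i)
    (-1) ^+ e i j * (-1) ^+ e i j' * (a i * c i * f i j j') = beta i i.
  apply: eq_bigr => j _; rewrite /z /block (lin_sum AL) (lin_sum (TL i)) (lin_sum BL).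
  rewrite coord_sum real_part_sum mulr_sumr; apply: eq_bigr => j' _.
  rewrite (linZ AL) (linZ (TL i)) (linZ BL) coordZ -(mulrA _ (r2K _)) real_part_sign real_partMl.
  by rewrite /f; ring.
have [h hP] := signs_bilinear beta m.
exists e, h; apply: (@le_trans _ _ (\sum_(i < m) beta i i)).
  by apply: ler_sum => i _; rewrite -betaE; exact: eP.
apply: le_trans hP _.
set Z := \sum_(i < m) _ *: T i _.
have -> : \sum_(i < m) \sum_(j < m) (-1) ^+ h i * (-1) ^+ h j * beta i j =
    \sum_(i < m) \sum_(j < s i) (-1) ^+ h i * ((-1) ^+ e i j * (c i * re (coord (B Z) (idx i j)))).
  apply: eq_bigr => i _; rewrite /beta.
  under eq_bigr => j _ do rewrite mulr_sumr.
  rewrite exchange_big /=; apply: eq_bigr => j _.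
  rewrite /Z (lin_sum BL) coord_sum real_part_sum !mulr_sumr; apply: eq_bigr => i' _.
  by rewrite (linZ BL) coordZ real_part_sign /z; ring.
(* Moving the weight v i from the coefficient to the coordinate brings in the weighted l^2 part of
   the norm of B Z. *)
apply: (@le_trans _ _ (\sum_(i < m) \sum_(j < s i)
  c i / v i * (v i * absK (coord (B Z) (idx i j))))).
  apply: ler_sum => i _; apply: ler_sum => j _.
  rewrite [leRHS]mulrA divfK ?(gt_eqF (v0 i))//.
  apply: le_trans (ler_norm _) _; rewrite !normrM !normr_sign !mul1r ger0_norm//.
  rewrite ler_wpM2l// ler_norml ler_real_part andbT lerNl -real_partN.
  by apply: le_trans (ler_real_part _) _; rewrite rnormN.
rewrite -(sum_index_pairs _ _ (fun i j => c i / v i * (v i * absK (coord (B Z) (idx i j))))).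
rewrite -mulrA; apply: (cauchy_schwarz_seq (a := fun x => c x.1 / v x.1)
  (b := fun x => v x.1 * absK (coord (B Z) (idx x.1 x.2)))).
- by move=> x; rewrite divr_ge0// ltW.
- by move=> x; rewrite mulr_ge0 ?rnorm_ge0// ltW.
- by rewrite mulr_ge0// powR_ge0.
- by rewrite mulr_ge0// rnorm_ge0.
- rewrite (sum_index_pairs _ _ (fun i j => (c i / v i) ^+ 2)) exprMn.
  have -> : (m%:R `^ 2^-1) ^+ 2 = m%:R :> R.
    by rewrite -powR_mulrn ?powR_ge0// powRV.
  rewrite -sum_const_ord; apply: ler_sum => i _.
  rewrite sum_const_ord expr_div_n mulrA ler_pdivrMr ?exprn_gt0//.
- apply: (@le_trans _ _ (rnorm (B Z) ^+ 2)); last first.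
    by rewrite ler_pXn2r ?nnegrE ?mulr_ge0 ?rnorm_ge0.
  apply: le_trans (@sum_coord_2_inj R k p p1 w _ (index_pairs m s) (fun x => idx x.1 x.2)
    (B Z) (index_pairs_uniq m s) _); last first.
    move=> [i j] [i' j']; rewrite !mem_index_pairs /= => /andP[? ?] /andP[? ?] /inj[] // -> -> //.
  rewrite big_seq [leRHS]big_seq; apply: ler_sum => x.
  by rewrite mem_index_pairs => /andP[_ xs]; rewrite exprMn wv.
Qed.

End signs_pairing.

Lemma sum_eventually_small (R : realFieldType) (F : nat -> nat -> R) :
  (forall i d, 0 < d -> exists n0, forall n, (n0 <= n)%N -> F i n < d) ->
  forall s d, 0 < d -> exists n0, forall n, (n0 <= n)%N -> \sum_(i < s) F i n < d.
Proof.
move=> F0; elim=> [|s IHs] d d0; first by exists 0 => n _; rewrite big_ord0.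
have d2 : 0 < d / 2 by rewrite divr_gt0.
have [n0 n0P] := IHs _ d2; have [n1 n1P] := F0 s _ d2.
exists (maxn n0 n1) => n; rewrite geq_max => /andP[/n0P h0 /n1P h1].
by rewrite big_ord_recr /=; lra.
Qed.

(** * Pairings through far summands *)

Section tail_pairing.
Variables (R : realType) (k : scalar_kind).
Local Notation K := (Defs.scalar R k).
Local Notation re := (@real_part R k).
Variables (p : R) (p1 : 1 <= p) (p2 : 2 < p) (w : nat -> R).
Variable X : nat -> normedModType K.
Local Notation E := (Xpw k p1 w).
Local Notation Y := (lp_sum p1 X).
Variables (A : E -> Y) (B : Y -> E) (C : R).
Hypotheses (AC : bounded_linear C A) (BC : bounded_linear C B) (C0 : 0 <= C).

Lemma real_part_coord_le (F : normedModType K) (f : F -> E) D y i :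
  bounded_linear D f -> re (coord (f y) i) <= D * rnorm y.
Proof.
move=> [_ fD]; apply: le_trans (ler_real_part _) _.
by apply: le_trans (rnorm_coord _ _) _.
Qed.

(* Otherwise a gliding hump gives [m] values of [t] with disjoint windows, and
   [m * e / 2 <= D * C^2 * m^(1/2 + 1/p)] for all [m]. *)
Lemma tail_pairing (T : Type) (label : T -> nat) (s : T -> nat) (idx : T -> nat -> nat)
    (a c v : T -> R) (D : R) (n1 : nat) : 0 <= D ->
  (forall t, 0 < v t) -> (forall t, 0 <= a t) -> (forall t, 0 <= c t) ->
  (forall t i, (i < s t)%N -> w (idx t i) = v t) ->
  (forall t, (s t)%:R * a t `^ p <= 1) ->
  (forall t, (s t)%:R * (v t ^+ 2 * a t ^+ 2) <= 1) ->
  (forall t, (s t)%:R * c t ^+ 2 <= D ^+ 2 * v t ^+ 2) ->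
  (forall t t' i i', (i < s t)%N -> (i' < s t')%N -> idx t i = idx t' i' ->
     label t = label t') ->
  (forall t i i', (i < s t)%N -> (i' < s t)%N -> idx t i = idx t i' -> i = i') ->
  forall e, 0 < e -> exists n0 l0, forall t, (l0 <= label t)%N ->
  \sum_(i < s t) a t * c t *
    re (coord (B (tail (n1 + n0) (A (unit_vector k p1 w (idx t i))))) (idx t i)) <= e.
Proof.
move=> D0 v0 a0 c0 wv sa sva sc inj inj' e e0.
have [AL _] := AC; have [BL _] := BC.
have p0 : 0 < p by exact: lt_trans p2.
pose F t n := \sum_(i < s t) a t * c t *
  re (coord (B (tail (n1 + n) (A (unit_vector k p1 w (idx t i))))) (idx t i)).
have F_small t d : 0 < d -> exists n0, forall n, (n0 <= n)%N -> F t n < d.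
  apply: (sum_eventually_small (F := fun i n => a t * c t *
    re (coord (B (tail (n1 + n) (A (unit_vector k p1 w (idx t i))))) (idx t i)))).
  move=> i {}d d0; pose M := a t * c t * C.
  have M0 : 0 <= M by rewrite !mulr_ge0.
  have dM : 0 < d / (M + 1) by rewrite divr_gt0// ltr_wpDl.
  have [n0 n0P] := restrict_tail (A (unit_vector k p1 w (idx t i))) dM.
  exists n0 => n nn0.
  have := n0P (n1 + n)%N (leq_trans nn0 (leq_addl _ _)).
  rewrite ltr_pdivlMr ?ltr_wpDl// -/(tail _ _) => h.
  apply: le_lt_trans h; rewrite mulrDr mulr1 [_ * M]mulrC.
  apply: (@le_trans _ _ (M * rnorm (tail (n1 + n) (A (unit_vector k p1 w (idx t i)))))).
    by rewrite /M -(mulrA (a t * c t)) ler_wpM2l ?mulr_ge0// (real_part_coord_le _ _ BC).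
  by rewrite lerDl rnorm_ge0.
apply: contrapT => H.
have F_big n l : exists2 t, (l <= label t)%N & e < F t n.
  apply: contrapT => H'; apply: H; exists n, l => t lt.
  by rewrite leNgt; apply/negP => et; apply: H'; exists t.
have [t [n [nm tm FtP]]] := gliding_hump e0 F_small F_big.
have e4 : 0 < e / 4 by rewrite divr_gt0.
have half : 2^-1 + p^-1 < 1.
  have : p^-1 < 2^-1 by rewrite ltf_pV2 ?posrE.
  lra.
have [m0 m0P] := powR_dominated (D * C * C) e4 half.
pose m := m0.+1.
pose Tn i := fun y : Y => tail (n1 + n i) y - tail (n1 + n i.+1) y.
have TL i : linear (Tn i) by apply: linear_sub; exact: tail_linear.
have [|||||eps [h]] := @signs_pairing R k p p1 w Y A B C AL BC C0 m (s \o t) (idx \o t)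
    (a \o t) (c \o t) (v \o t) D Tn D0 TL.
- by move=> i; exact: v0.
- by move=> i; exact: c0.
- by move=> i j; exact: wv.
- by move=> i; exact: sc.
(* Equal indices have equal labels, and labels increase strictly along the hump, so the chosen
   blocks are disjoint. *)
- move=> i i' j j' _ _ js js' ij.
  have ii' : i = i' by apply: (homo_ltn_inj tm); exact: inj ij.
  by rewrite -ii' in js' ij *; split=> //; exact: inj' ij.
have -> : \sum_(i < m) (-1) ^+ h i *:
      Tn i (A (block k p1 w (s (t i)) (idx (t i)) (a (t i)) (eps i)))
  = \sum_(i < m) (tail (n1 + n i) ((-1) ^+ h i *:
      A (block k p1 w (s (t i)) (idx (t i)) (a (t i)) (eps i)))
    - tail (n1 + n i.+1) ((-1) ^+ h i *: A (block k p1 w (s (t i)) (idx (t i)) (a (t i)) (eps i)))).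
  by apply: eq_bigr => i _; rewrite !(linZ (@tail_linear _ _ _ _ _ _)) -scalerBr.
apply/negP; rewrite -ltNge.
apply: (@le_lt_trans _ _ (e / 4 * m%:R)).
  have := m0P m (leqnSn _); rewrite powRr1//; apply: le_trans.
  rewrite powRD ?pnatr_eq0 ?implybT//.
  have -> : D * C * C * (m%:R `^ 2^-1 * m%:R `^ p^-1) =
    m%:R `^ 2^-1 * D * C * (m%:R `^ p^-1 * C) by ring.
  rewrite ler_wpM2l ?mulr_ge0 ?powR_ge0//.
  apply: (rnorm_sum_window (n := fun i => (n1 + n i)%N)
    (x := fun i => (-1) ^+ h i *: A (block k p1 w (s (t i)) (idx (t i)) (a (t i)) (eps i)))) => //.
    by move=> i j ij; rewrite leq_add2l nm.
  move=> i; rewrite rnorm_sign; apply: le_trans (AC.2 _) _; rewrite ler_piMr//.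
  apply: (@rnorm_block _ _ _ _ _ _ _ _ _ (v (t i))) => //; first exact: wv.
  - exact: inj'.
  - by rewrite powR1.
  - by rewrite expr1n.
apply: (@lt_le_trans _ _ (\sum_(i < m) e / 2)).
  rewrite sum_const_ord mulrC ltr_pM2l ?ltr0n//; lra.
apply: ler_sum => i _; apply: ltW; apply: lt_le_trans (FtP i) _.
rewrite /F -sumrB; apply: ler_sum => j _ /=.
by rewrite /Tn (linB BL) coordB real_partB mulrBr.
Qed.

End tail_pairing.

(** * Constant weights: Hilbert spaces up to renorming *)

Section hilbert.
Variables (R : realType) (k : scalar_kind).
Local Notation K := (Defs.scalar R k).
Local Notation absK z := (rnorm (z : K^o)).
Variables (p : R) (p1 : 1 <= p) (p2 : 2 < p).

Section unit_weight.
Variable w : nat -> R.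
Hypothesis w1 : forall l, w l = 1.
Local Notation H := (Xpw k p1 w).

Lemma rnorm_hilbertP (x : H) (C : R) : 0 <= C ->
  rnorm x <= C <-> forall n, \sum_(l < n) absK (coord x l) ^+ 2 <= C ^+ 2.
Proof.
move=> C0; split=> [xC n|xC].
  have [_ /(_ n)] := (rnorm_XpwP x C0).1 xC.
  by under eq_bigr => l _ do rewrite w1 expr1n mul1r.
apply/rnorm_XpwP => //; split=> n; last first.
  by under eq_bigr => l _ do rewrite w1 expr1n mul1r; exact: xC.
exact: (sum_powR_le_sqr p2 C0 (fun i => rnorm_ge0 (coord x i : K^o)) xC).
Qed.

Lemma hilbert_parallelogram (a b : H) :
  2 * rnorm a ^+ 2 + 2 * rnorm b ^+ 2 <= rnorm (a + b) ^+ 2 + rnorm (a - b) ^+ 2.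
Proof.
pose S (x : H) n := \sum_(l < n) absK (coord x l) ^+ 2.
have S_mono (x : H) m n : (m <= n)%N -> S x m <= S x n.
  move=> mn; apply: (ler_sum_widen (f := fun l => absK (coord x l) ^+ 2)) => // l.
  exact: sqr_ge0.
have S_le (x : H) n : S x n <= rnorm x ^+ 2.
  exact: ((rnorm_hilbertP x (rnorm_ge0 x)).1 (lexx _)).
have S_sup (x : H) D : (forall n, S x n <= D) -> rnorm x ^+ 2 <= D.
  move=> SD; have D0 : 0 <= D by have := SD 0; rewrite /S big_ord0.
  rewrite -(sqr_sqrtr D0) ler_pXn2r ?nnegrE ?rnorm_ge0 ?sqrtr_ge0//.
  by apply/rnorm_hilbertP; rewrite ?sqrtr_ge0// sqr_sqrtr.
(* The suprema over the partial sums of a and of b are taken one after the other, which is why [le2]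
   has independent truncations m and n. *)
set T := (X in _ <= X).
have le2 m n : 2 * S a m + 2 * S b n <= T.
  apply: (@le_trans _ _ (2 * S a (maxn m n) + 2 * S b (maxn m n))).
    by rewrite lerD// ler_wpM2l// S_mono ?leq_maxl ?leq_maxr.
  apply: (@le_trans _ _ (S (a + b) (maxn m n) + S (a - b) (maxn m n))); last first.
    by rewrite lerD ?S_le.
  rewrite /S !mulr_sumr -!big_split /=; apply: ler_sum => l _.
  by rewrite parallelogram.
have lea n : rnorm a ^+ 2 <= (T - 2 * S b n) / 2.
  by apply: S_sup => m; have := le2 m n; lra.
have : rnorm b ^+ 2 <= (T - 2 * rnorm a ^+ 2) / 2.
  by apply: S_sup => n; have := lea n; lra.
lra.
Qed.

End unit_weight.

Variables (w : nat -> R) (c : R).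
Hypotheses (c0 : 0 < c) (wc : forall l, w l = c).

(** The identity on sequences, from constant weight c to weight 1, where the norm is the l^2 norm
    and the parallelogram law holds. The norm bounds c^-1 for it and 1 + c for its inverse
    degenerate as c tends to 0. *)
Definition unit_weights (x : Xpw k p1 w) : Xpw k p1 (fun=> 1) := Xpw_mk p1 _ (coord x).

Let unit_weight_sum (x : Xpw k p1 w) n :
  \sum_(l < n) absK (coord x l) ^+ 2 <= (c^-1 * rnorm x) ^+ 2.
Proof.
rewrite exprMn exprVn ler_pdivlMl ?exprn_gt0// mulr_sumr.
apply: le_trans (sum_coord_2 x n).
by apply: ler_sum => l _; rewrite wc.
Qed.

Lemma coord_unit_weights x l : coord (unit_weights x) l = coord x l.
Proof.
have x0 : 0 <= (1 + c^-1) * rnorm x by rewrite mulr_ge0 ?rnorm_ge0// addr_ge0// invr_ge0 ltW.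
have cV : 0 <= c^-1 by rewrite invr_ge0 ltW.
apply: (@coord_Xpw_mk R k p p1 (fun=> 1) (coord x) _ l x0) => n.
  apply: le_trans (sum_coord_p x n) _; rewrite ler_powR2r ?rnorm_ge0 ?(lt_trans _ p2)//.
  by rewrite ler_peMl ?rnorm_ge0// lerDl.
under eq_bigr => i _ do rewrite expr1n mul1r.
apply: le_trans (unit_weight_sum x n) _.
rewrite ler_pXn2r ?nnegrE ?mulr_ge0 ?rnorm_ge0 ?addr_ge0//.
by rewrite ler_wpM2r ?rnorm_ge0// lerDr.
Qed.

Lemma unit_weights_linear : linear unit_weights.
Proof.
by move=> a x y; apply: Xpw_ext => l; rewrite coord_linear !coord_unit_weights.
Qed.

Lemma rnorm_unit_weights x : rnorm (unit_weights x) <= c^-1 * rnorm x.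
Proof.
apply/rnorm_hilbertP => [//||n]; first by rewrite mulr_ge0 ?rnorm_ge0// invr_ge0 ltW.
by under eq_bigr => l _ do rewrite coord_unit_weights.
Qed.

Lemma rnorm_le_unit_weights x : rnorm x <= (1 + c) * rnorm (unit_weights x).
Proof.
have u0 := rnorm_ge0 (unit_weights x).
have := (rnorm_XpwP _ u0).1 (lexx _) => -[up u2].
have c1 : 0 <= 1 + c by rewrite addr_ge0// ltW.
apply/rnorm_XpwP => [|]; first by rewrite mulr_ge0.
split=> n.
  have := up n; under eq_bigr => l _ do rewrite coord_unit_weights.
  move=> /le_trans; apply; rewrite ler_powR2r ?mulr_ge0 ?(lt_trans _ p2)//.
  by rewrite ler_peMl// lerDl ltW.
have h : \sum_(l < n) absK (coord x l) ^+ 2 <= rnorm (unit_weights x) ^+ 2.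
  by have := u2 n; under eq_bigr => l _ do rewrite coord_unit_weights expr1n mul1r.
under eq_bigr => l _ do rewrite wc.
rewrite -mulr_sumr; apply: le_trans (ler_wpM2l (sqr_ge0 c) h) _.
rewrite exprMn ler_wpM2r ?sqr_ge0// ler_pXn2r ?nnegrE ?(ltW c0)//.
by rewrite lerDr.
Qed.

End hilbert.

Section windows.
Variables (R : realType) (k : scalar_kind).
Local Notation K := (Defs.scalar R k).
Variables (p : R) (p1 : 1 <= p) (X : nat -> normedModType K).
Local Notation Y := (lp_sum p1 X).
Implicit Types x : Y.

Lemma windowE x n m : tail n x - tail (n + m) x = \sum_(i < m) single p1 (comp x (n + i)).
Proof.
apply: lp_ext => l; rewrite comp_window ?leq_addr// comp_sum.
have [/andP[nl lm]|nlm] := ifPn.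
  have lnm : (l - n < m)%N by rewrite ltn_subLR.
  rewrite (bigD1 (Ordinal lnm))//= [X in _ = _ + X]big1 ?addr0 => [|i].
    have := subnKC nl; move: (n + (l - n))%N => l' ->.
    by rewrite comp_single.
  move=> il; rewrite comp_single_neq//; apply: contra il => /eqP e.
  by apply/eqP/val_inj => /=; rewrite -e addKn.
rewrite big1// => i _; rewrite comp_single_neq//.
by apply: contra nlm => /eqP <-; rewrite leq_addr ltn_add2l/=.
Qed.

Lemma rnorm_window x n m :
  rnorm (tail n x - tail (n + m) x) `^ p <= \sum_(i < m) rnorm (comp x (n + i)) `^ p.
Proof.
have p0 : 0 < p by exact: lt_le_trans p1.
set S := \sum_(i < m) _; have S0 : 0 <= S by rewrite sumr_ge0// => *; rewrite powR_ge0.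
rewrite -(powRV p0 S0) ler_powR2r ?rnorm_ge0 ?powR_ge0//.
apply/rnorm_lpP => [|l]; first exact: powR_ge0.
rewrite powRV//.
pose F i := rnorm (comp (tail n x - tail (n + m) x) i) `^ p.
apply: (@le_trans _ _ (\sum_(i < n + m + l) F i)).
  by apply: (ler_sum_widen (f := F)); [exact: leq_addl|move=> i; exact: powR_ge0].
rewrite big_split_ord /= big_split_ord /=.
rewrite [X in X + _ + _]big1 ?add0r; last first.
  move=> i _; rewrite /F comp_window ?leq_addr//.
  by rewrite leqNgt ltn_ord /= rnorm0 powR0// gt_eqF.
rewrite [X in _ + X]big1 ?addr0; last first.
  move=> i _; rewrite /F comp_window ?leq_addr//.
  by rewrite [X in _ && X]ltnNge leq_addr andbF rnorm0 powR0// gt_eqF.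
apply: ler_sum => i _; rewrite /F comp_window ?leq_addr//.
by rewrite ltn_add2l ltn_ord.
Qed.

End windows.

Definition pair_index (i j : nat) : nat := pickle (i, j).

Lemma pair_index_inj i j i' j' : pair_index i j = pair_index i' j' -> i = i' /\ j = j'.
Proof. by move=> /(pcan_inj pickleK)[]. Qed.

(** * Average pairings over long blocks of small weight *)

Section block_pairing.
Variables (R : realType) (k : scalar_kind).
Local Notation K := (Defs.scalar R k).
Local Notation re := (@real_part R k).
Variables (p : R) (p1 : 1 <= p) (p2 : 2 < p) (w : nat -> R) (W : nat -> nat -> R).
Local Notation E := (Xpw k p1 w).
Local Notation Y := (lp_sum p1 (fun N => Xpw k p1 (W N))).
Variables (A : E -> Y) (B : Y -> E) (C : R).
Hypotheses (AC : bounded_linear C A) (BC : bounded_linear C B) (C0 : 0 <= C).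
Local Notation e_ i := (unit_vector k p1 w i).

(** Signs and the parallelogram law make the mean over a block of the norms of one component of the
    images O(v), with a constant depending on that component. Labelling the pairs (M, j0) by M alone
    makes the threshold M0 independent of j0, so that blocks can later be moved beyond any
    prescribed index. *)
Lemma block_pairing (v : nat -> R) (s : nat -> nat) (c : nat -> R) (n1 : nat) :
  (forall M, 0 < v M) -> (forall M j, w (pair_index M j) = v M) ->
  (forall M, (0 < s M)%N) ->
  (forall M, (s M)%:R `^ p^-1 <= v M * (s M)%:R `^ 2^-1) ->
  (forall d, 0 < d -> exists M0, forall M, (M0 <= M)%N -> v M <= d) ->
  (forall N, (n1 <= N)%N -> 0 < c N) ->
  (forall N l, (n1 <= N)%N -> W N l = c N) ->
  forall d, 0 < d -> exists M0, forall M j0, (M0 <= M)%N ->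
  \sum_(i < s M) re (coord (B (tail n1 (A (e_ (pair_index M (j0 + i))))))
    (pair_index M (j0 + i))) <= d * (s M)%:R.
Proof.
move=> v0 wv s0 sv v_small c0 Wc d d0.
have [AL AnC] := AC; have [BL BnC] := BC.
have p0 : 0 < p by exact: lt_trans p2.
pose h M := (s M)%:R `^ 2^-1 : R.
have h0 M : 0 < h M by rewrite powR_gt0 ?ltr0n.
have hh M : h M ^+ 2 = (s M)%:R by rewrite -powR_mulrn ?powR_ge0// powRV.
have one_p : 1 `^ p = 1 :> R by rewrite powR1.
have sp M : (s M)%:R = ((s M)%:R `^ p^-1) `^ p :> R by rewrite powRV.
have d2 : 0 < d / 2 by rewrite divr_gt0.
(* The factor (v h)^-1 normalizes the block and v / h the sum of its coordinates; their product is 1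
   / s, so the sums that get bounded are averages. *)
have [|||||||||| n0 [l0 tailP]] := @tail_pairing R k p p1 p2 w _ A B C AC BC C0 (nat * nat)%type
  fst (s \o fst) (fun t i => pair_index t.1 (t.2 + i)) (fun t => (v t.1 * h t.1)^-1)
  (fun t => v t.1 / h t.1) (v \o fst) 1 n1 _ _ _ _ _ _ _ _ _ _ _ d2; rewrite ?ler01//=.
- by move=> t; rewrite invr_ge0 mulr_ge0 ?(ltW (v0 _)) ?(ltW (h0 _)).
- by move=> t; rewrite divr_ge0 ?(ltW (v0 _)) ?(ltW (h0 _)).
- move=> t; rewrite sp -powRM ?powR_ge0 ?invr_ge0 ?mulr_ge0 ?(ltW (v0 _)) ?(ltW (h0 _))//.
  apply: (@le_trans _ _ (1 `^ p)); last by rewrite one_p.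
  rewrite ler_powR2r ?mulr_ge0 ?powR_ge0 ?invr_ge0 ?mulr_ge0 ?(ltW (v0 _)) ?(ltW (h0 _))//.
  by rewrite ler_pdivrMr ?mulr_gt0// mul1r.
- move=> t; rewrite -hh exprVn exprMn.
  have hn : h t.1 != 0 by rewrite gt_eqF.
  have vn : v t.1 != 0 by rewrite gt_eqF.
  by rewrite le_eqVlt; apply/orP; left; apply/eqP; field; rewrite hn vn.
- move=> t; rewrite -hh expr1n mul1r.
  have hn : h t.1 != 0 by rewrite gt_eqF.
  by rewrite le_eqVlt; apply/orP; left; apply/eqP; field.
- by move=> [M j] [M' j'] i i' _ _ /pair_index_inj[].
- by move=> [M j] i i' _ _ /pair_index_inj[_ /addnI].
(* Collects the comparison constants of the n0 summands kept; it is fixed before M, hence before v M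
   is made small. *)
pose K1 := C * \sum_(N < n0) (1 + c (n1 + N)%N) * (c (n1 + N)%N)^-1 * C.
have K1_ge0 : 0 <= K1.
  rewrite mulr_ge0// sumr_ge0// => N _; have cN := c0 _ (leq_addr N n1).
  by rewrite !mulr_ge0 ?invr_ge0 ?addr_ge0 ?(ltW cN).
have [|M0 M0P] := v_small (d / 2 / (K1 + 1)); first by rewrite divr_gt0// ltr_wpDl.
exists (maxn M0 l0) => M j0; rewrite geq_max => /andP[M0M l0M].
pose idx i := pair_index M (j0 + i).
pose u i := A (e_ (idx i)).
have tail_le : \sum_(i < s M) re (coord (B (tail (n1 + n0) (u i))) (idx i)) <= d / 2 * (s M)%:R.
  have := tailP (M, j0) l0M.
  have -> : (v M * h M)^-1 * (v M / h M) = (s M)%:R^-1.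
    have hn : h M != 0 by rewrite gt_eqF.
    have vn : v M != 0 by rewrite gt_eqF.
    by rewrite -hh; field; rewrite hn vn.
  by rewrite -mulr_sumr ler_pdivrMl ?ltr0n// mulrC.
have comp_le N : (n1 <= N)%N ->
    \sum_(i < s M) rnorm (comp (u i) N) <= (1 + c N) * (c N)^-1 * C * v M * (s M)%:R.
  move=> n1N; have cN := c0 _ n1N; have WcN l := Wc N l n1N.
  have -> : (1 + c N) * (c N)^-1 * C * v M * (s M)%:R =
      h M * ((1 + c N) * (c N)^-1 * C * (v M * h M)) by rewrite -hh; ring.
  under eq_bigr => i _ do rewrite -[rnorm _]mul1r.
  pose J := @unit_weights R k p p1 (W N).
  have JL : linear J := unit_weights_linear p2 cN WcN.
  pose Q (x : Y) := rnorm (J (comp x N)) ^+ 2.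
  (* Some signed sum has a squared component norm at least the sum of the squares, and it is the
     image of a block of norm at most v h. *)
  have [||eps epsP] := @signs_quadratic R K Y Q _ _ u (s M).
  - by rewrite /Q comp0 (lin0 JL) rnorm0 expr0n.
  - move=> a b; rewrite /Q compD compB (linD JL) (linB JL).
    exact: hilbert_parallelogram.
  apply: (cauchy_schwarz_sum (a := fun=> 1) (b := fun i => rnorm (comp (u i) N))) => //.
  - by move=> i; exact: rnorm_ge0.
  - exact: ltW.
  - by rewrite !mulr_ge0 ?invr_ge0 ?addr_ge0 ?(ltW cN) ?(ltW (v0 _)) ?(ltW (h0 _)).
  - by rewrite sum_const_ord expr1n mulr1 hh.
  apply: (@le_trans _ _ (\sum_(i < s M) (1 + c N) ^+ 2 * Q (u i))).
    apply: ler_sum => i _; rewrite /Q -exprMn.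
    rewrite ler_pXn2r ?nnegrE ?mulr_ge0 ?rnorm_ge0 ?addr_ge0 ?(ltW cN)//.
    exact: rnorm_le_unit_weights.
  have -> : (1 + c N) / c N * C * (v M * h M) =
    (1 + c N) * ((c N)^-1 * (C * (v M * h M))) by rewrite !mulrA.
  rewrite -mulr_sumr [leRHS]exprMn ler_wpM2l ?sqr_ge0//.
  apply: le_trans epsP _; rewrite /Q.
  rewrite ler_pXn2r ?nnegrE ?mulr_ge0 ?rnorm_ge0 ?invr_ge0 ?(ltW cN) ?(ltW (v0 _)) ?(ltW (h0 _))//.
  apply: le_trans (rnorm_unit_weights p2 cN WcN _) _.
  rewrite ler_wpM2l ?invr_ge0 ?(ltW cN)//.
  apply: le_trans (rnorm_comp _ _) _.
  have -> : \sum_(i < s M) (-1) ^+ eps i *: u i = A (block k p1 w (s M) idx 1 eps).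
    rewrite /block (lin_sum AL); apply: eq_bigr => i _.
    by rewrite (linZ AL) of_real1 mulr1.
  apply: le_trans (AnC _) _; rewrite ler_wpM2l//.
  apply: (@rnorm_block _ _ _ _ _ _ _ _ _ (v M)); rewrite ?mulr_ge0 ?(ltW (v0 _)) ?(ltW (h0 _))//.
  - by move=> i _; exact: wv.
  - by move=> i i' _ _ /pair_index_inj[_ /addnI].
  - by rewrite one_p mulr1 {1}sp ler_powR2r ?powR_ge0 ?mulr_ge0 ?(ltW (v0 _)) ?(ltW (h0 _))//;
    exact: sv.
  - by rewrite expr1n mulr1 exprMn hh mulrC.
have head_le : \sum_(i < s M) re (coord (B (tail n1 (u i) - tail (n1 + n0) (u i))) (idx i))
    <= d / 2 * (s M)%:R.
  apply: (@le_trans _ _ (\sum_(i < s M) C * \sum_(N < n0) rnorm (comp (u i) (n1 + N)))).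
    apply: ler_sum => i _; apply: le_trans (real_part_coord_le _ _ BC) _.
    rewrite ler_wpM2l// windowE; apply: le_trans (ler_rnorm_sum _ _) _.
    by apply: ler_sum => N _; rewrite rnorm_single.
  rewrite -mulr_sumr exchange_big /=.
  apply: (@le_trans _ _ (K1 * v M * (s M)%:R)).
    rewrite /K1 -!mulrA ler_wpM2l// mulr_suml; apply: ler_sum => N _.
    by rewrite !mulrA; apply: comp_le; exact: leq_addr.
  rewrite ler_wpM2r ?ler0n//; apply: le_trans (ler_wpM2l K1_ge0 (M0P _ M0M)) _.
  rewrite mulrCA ler_piMr ?(ltW d2)// ler_pdivrMr ?ltr_wpDl// mul1r lerDl//.
apply: (@le_trans _ _ (d / 2 * (s M)%:R + d / 2 * (s M)%:R)); last first.
  by rewrite -mulrDl -splitr.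
apply: le_trans (lerD head_le tail_le).
rewrite -big_split /=; apply: ler_sum => i _.
by rewrite -real_partD -coordD -(linD BL) subrK.
Qed.

End block_pairing.

(** * One fixed source weight against target summands of weight 1 *)

Section pigeonhole.
Variable R : realType.

(** Finitely many intervals of length d cover [0, D]. If f eventually avoided each of them along P,
    no value would be left beyond the largest threshold. The predicate P allows the argument to be
    iterated over several functions. *)
Lemma pigeonhole1 (P : nat -> Prop) (f : nat -> R) (D d : R) : 0 < d ->
  (forall l, exists2 j, (l <= j)%N & P j) -> (forall j, 0 <= f j <= D) ->
  exists2 c, 0 <= c & forall l, exists2 j, (l <= j)%N & P j /\ c <= f j <= c + d.
Proof.
move=> d0 Pinf fD; apply: contrapT => H.
have D0 : 0 <= D by have /andP[f0 /(le_trans f0)] := fD 0.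
have /choice[l lP] i : exists l, forall j, (l <= j)%N -> P j ->
    ~~ (i%:R * d <= f j <= i%:R * d + d).
  apply: contrapT => Hi; apply: H; exists (i%:R * d); first by rewrite mulr_ge0// ltW.
  move=> l; apply: contrapT => Hl; apply: Hi; exists l => j lj Pj.
  by apply/negP => fj; apply: Hl; exists j.
have [j lj Pj] := Pinf (\max_(i < (Num.truncn (D / d)).+1) l i).
have /andP[f0 fjD] := fD j.
have fd0 : 0 <= f j / d by rewrite divr_ge0// ltW.
have /andP[t1 t2] := truncn_itv fd0.
have tD : (Num.truncn (f j / d) < (Num.truncn (D / d)).+1)%N.
  by rewrite ltnS le_truncn// ler_wpM2r// invr_ge0 ltW.
have lt : (l (Num.truncn (f j / d)) <= j)%N.
  by apply: leq_trans lj; exact: (leq_bigmax (Ordinal tD)).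
have /negP := lP _ _ lt Pj; apply.
rewrite -ler_pdivlMr// t1 /=.
by move: (ltW t2); rewrite ler_pdivrMr// -natr1 mulrDl mul1r.
Qed.

Lemma pigeonhole (P : nat -> Prop) (f : nat -> nat -> R) (D d : R) n : 0 < d ->
  (forall l, exists2 j, (l <= j)%N & P j) -> (forall N j, 0 <= f N j <= D) ->
  exists c : nat -> R, (forall N, 0 <= c N) /\
  forall l, exists2 j, (l <= j)%N & P j /\ forall N, (N < n)%N -> c N <= f N j <= c N + d.
Proof.
move=> d0 Pinf fD; elim: n => [|n [c [c0 cP]]].
  by exists (fun=> 0); split=> // l; have [j] := Pinf l; exists j.
have [x x0 xP] := pigeonhole1 d0 cP (fD n).
exists (fun N => if N == n then x else c N); split=> [N|l]; first by case: ifP.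
have [j lj [[Pj jc] jx]] := xP l; exists j => //; split=> // N.
by rewrite ltnS leq_eqVlt; case: eqVneq => [->//|_ /=]; exact: jc.
Qed.

End pigeonhole.

Section hilbert_sum_pairing.
Variables (R : realType) (k : scalar_kind).
Local Notation K := (Defs.scalar R k).
Local Notation re := (@real_part R k).
Variables (p : R) (p1 : 1 <= p) (p2 : 2 < p) (w : nat -> R) (W : nat -> nat -> R).
Local Notation E := (Xpw k p1 w).
Local Notation Y := (lp_sum p1 (fun N => Xpw k p1 (W N))).
Variables (A : E -> Y) (B : Y -> E) (C : R).
Hypotheses (AC : bounded_linear C A) (BC : bounded_linear C B) (C0 : 0 < C).
Local Notation e_ i := (unit_vector k p1 w i).

Lemma rnorm_unit_vector i : `|w i| <= 1 -> rnorm (e_ i) <= 1.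
Proof.
move=> wi; have := @rnorm_sum_unit_vector R k p p1 w nat [:: i] id (fun=> 1) 1 ler01 isT.
rewrite !big_seq1 scale1r; apply.
- by move=> a b; rewrite !inE => /eqP-> /eqP->.
- by rewrite -(of_real1 R k) rnorm_of_real normr1 powR1.
- rewrite -(of_real1 R k) rnorm_of_real normr1 !expr1n mulr1 -real_normK ?num_real//.
  by rewrite expr_le1.
Qed.

(* By pigeonhole the norms [|A e_j (N)|], [N < n0], are nearly independent of [j],
   with values [c_N]; the quadratic form [sum_N c_N^(p-2) |x(N)|^2] applied to a
   signed sum of [A e_j] shows [sum_N c_N^p <= (C v)^p]. *)
Lemma hilbert_sum_pairing (v : R) n1 : 0 < v -> v <= 1 -> (forall i, w i = v) ->
  (forall N l, (n1 <= N)%N -> W N l = 1) ->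
  forall d l, 0 < d -> exists2 j, (l <= j)%N &
    re (coord (B (tail n1 (A (e_ j)))) j) <= 4 * C ^+ 2 * v + d.
Proof.
move=> v0 v1 wv W1 d l d0.
have [AL AnC] := AC; have [BL BnC] := BC.
have p0 : 0 < p by exact: lt_trans p2.
have one_p : 1 `^ p = 1 :> R by rewrite powR1.
have e1 i : rnorm (e_ i) <= 1 by rewrite rnorm_unit_vector// wv gtr0_norm.
have [|||||||||| n0 [l0 tailP]] := @tail_pairing R k p p1 p2 w _ A B C AC BC (ltW C0) nat
  id (fun=> 1%N) (fun t _ => t) (fun=> 1) (fun=> 1) (fun=> v) v^-1 n1 _ _ _ _ _ _ _ _ _ _ _ d0;
  rewrite ?invr_ge0 ?(ltW v0)//=.
- by move=> _; rewrite one_p mulr1.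
- by move=> _; rewrite expr1n mulr1 mul1r expr_le1// ltW.
- by move=> _; rewrite expr1n mulr1 exprVn mulVf// expf_neq0// gt_eqF.
- by move=> t [|?] [|?].
pose r N j := rnorm (comp (A (e_ j)) (n1 + N)).
have rC N j : 0 <= r N j <= C.
  rewrite rnorm_ge0 /=; apply: le_trans (rnorm_comp _ _) _.
  by apply: le_trans (AnC _) _; rewrite ler_piMr// ltW.
have Cv0 : 0 < C * v by rewrite mulr_gt0.
(* The tolerance of the pigeonhole argument, small enough that n0 dd^p <= (C v)^p. *)
pose dd := C * v / n0.+1%:R.
have dd0 : 0 < dd by rewrite divr_gt0.
have [c [c0 cP]] := @pigeonhole R (fun j => (maxn l l0 <= j)%N) r C dd n0 dd0
  (fun m => ex_intro2 _ _ (maxn m (maxn l l0)) (leq_maxl _ _) (leq_maxr _ _)) rC.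
have [f [fm fP]] := increasing_subsequence cP.
set S := \sum_(N < n0) c N `^ p.
have S0 : 0 <= S by rewrite sumr_ge0// => *; rewrite powR_ge0.
have S_le : S <= (C * v) `^ p.
  have [->|Sn0] := eqVneq S 0; first by rewrite powR_ge0.
  (* Gives n with n^(1/p) <= v n^(1/2), so that a signed sum of n basis vectors has norm at most v
     n^(1/2). *)
  have [m0 m0P] := @powR_dominated R 1 v p^-1 2^-1 v0 ltac:(by rewrite ltf_pV2 ?posrE).
  pose n := m0.+1; have := m0P n (leqnSn _); rewrite mul1r => nv.
  pose h : R := n%:R `^ 2^-1.
  have h0 : 0 < h by rewrite powR_gt0.
  have hh : h ^+ 2 = n%:R by rewrite -powR_mulrn ?powR_ge0// powRV.
  pose Q (x : Y) := \sum_(N < n0) c N `^ (p - 2) * rnorm (comp x (n1 + N)) ^+ 2.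
  pose u i := A (e_ (f i)).
  have [||eps epsP] := @signs_quadratic R K Y Q _ _ u n.
  - by rewrite /Q big1// => N _; rewrite comp0 rnorm0 expr0n mulr0.
  - move=> a b; rewrite /Q.
    under [X in _ <= X + _]eq_bigr => N _ do rewrite compD.
    under [X in _ <= _ + X]eq_bigr => N _ do rewrite compB.
    rewrite !mulr_sumr -!big_split /=; apply: ler_sum => N _.
    rewrite !(mulrCA 2 (c N `^ (p - 2))) -!(mulrDr (c N `^ (p - 2))) ler_wpM2l ?powR_ge0//.
    by apply: hilbert_parallelogram => // i; rewrite W1// leq_addr.
  set x := \sum_(i < n) _ *: _ in epsP.
  have xE : x = A (block k p1 w n f 1 eps).
    rewrite /block (lin_sum AL); apply: eq_bigr => i _.
    by rewrite (linZ AL) of_real1 mulr1.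
  have x_le : rnorm x <= C * (v * h).
    rewrite xE; apply: le_trans (AnC _) _; rewrite ler_wpM2l ?(ltW C0)//.
    apply: (@rnorm_block _ _ _ _ _ _ _ _ _ v); rewrite ?mulr_ge0 ?(ltW v0) ?(ltW h0)//.
    + by move=> i j _ _; exact: homo_ltn_inj.
    + rewrite one_p mulr1 -{1}[n%:R](powRV p0)//.
      by rewrite ler_powR2r ?powR_ge0 ?mulr_ge0 ?(ltW v0) ?(ltW h0).
    + by rewrite expr1n mulr1 exprMn hh mulrC.
  have nS : n%:R * S <= Q x.
    apply: le_trans epsP; rewrite -sum_const_ord; apply: ler_sum => i _.
    apply: ler_sum => N _; rewrite powR_split_sqr//.
    rewrite ler_wpM2l ?powR_ge0// ler_pXn2r ?nnegrE ?rnorm_ge0//.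
    by have [_ /(_ N (ltn_ord N))/andP[]] := fP i.
  (* Hoelder with exponents p / (p - 2) and p / 2. Combined with n S <= Q x it gives S <= S^((p - 2)
     / p) (C v)^2, that is S^(2 / p) <= (C v)^2. *)
  have Qx : Q x <= S `^ ((p - 2) / p) * rnorm x ^+ 2.
    have pm2 : 0 < p - 2 by rewrite subr_gt0.
    apply: (@hoelder_sum _ (p / (p - 2)) (p / 2) _ (fun N => c N `^ (p - 2))
      (fun N => rnorm (comp x (n1 + N)) ^+ 2)).
    + by rewrite divr_gt0.
    + by rewrite divr_gt0.
    + by field; rewrite !gt_eqF.
    + by move=> N; exact: powR_ge0.
    + by move=> N; exact: sqr_ge0.
    + exact: powR_ge0.
    + exact: sqr_ge0.
    + rewrite -powRrM (_ : _ / _ * _ = 1) ?powRr1//; last by field; rewrite !gt_eqF.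
      apply: ler_sum => N _; rewrite -powRrM (_ : _ * _ = p)//; by field; rewrite gt_eqF.
    + rewrite -powR_mulrn ?rnorm_ge0// -powRrM (_ : 2 * (p / 2) = p); last by field.
      apply: le_trans (sum_rnorm_comp x (n1 + n0)).
      rewrite big_split_ord /= ler_wpDl ?sumr_ge0//; first by move=> *; rewrite powR_ge0.
      apply: ler_sum => N _.
      by rewrite -powR_mulrn ?rnorm_ge0// -powRrM (_ : 2 * (p / 2) = p)//; field.
  have S_gt0 : 0 < S by rewrite lt_neqAle eq_sym Sn0.
  have : S `^ (2 / p) <= (C * v) ^+ 2.
    have SE : S = S `^ ((p - 2) / p) * S `^ (2 / p).
      rewrite -powRD ?Sn0 ?implybT// (_ : _ + _ = 1) ?powRr1//.
      by field; rewrite gt_eqF.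
    rewrite -(@ler_pM2l _ (S `^ ((p - 2) / p))) ?powR_gt0// -SE.
    rewrite -(@ler_pM2l _ n%:R) ?ltr0n//.
    apply: le_trans nS _; apply: le_trans Qx _.
    rewrite [leRHS]mulrCA ler_wpM2l ?powR_ge0//.
    rewrite -hh -exprMn ler_pXn2r ?nnegrE ?rnorm_ge0 ?mulr_ge0 ?(ltW C0) ?(ltW v0) ?(ltW h0)//.
    by rewrite mulrC -mulrA.
  have p20 : 0 < p / 2 by rewrite divr_gt0.
  rewrite -(ler_powR2r p20) ?powR_ge0 ?sqr_ge0// -powRrM.
  rewrite (_ : 2 / p * (p / 2) = 1); last by field; rewrite gt_eqF.
  rewrite powRr1// -powR_mulrn ?(ltW Cv0)// -powRrM.
  by rewrite (_ : 2 * (p / 2) = p)//; field.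
have [lf cf] := fP 0.
exists (f 0); first by rewrite (leq_trans (leq_maxl _ _) lf).
have := tailP (f 0) (leq_trans (leq_maxr _ _) lf).
rewrite big_ord1 !mul1r => tail_le.
pose head := tail n1 (A (e_ (f 0))) - tail (n1 + n0) (A (e_ (f 0))).
rewrite -[tail n1 _](subrK (tail (n1 + n0) (A (e_ (f 0))))) (linD BL) coordD real_partD.
rewrite lerD//; apply: le_trans (real_part_coord_le _ _ BC) _.
(* The 4 arises from (c N + dd)^p <= 2^p (c N^p + dd^p): the two resulting sums are at most (C v)^p
   each, and twice 2^p is at most 4^p. *)
rewrite -/head; suff : rnorm head <= 4 * (C * v).
  move=> h; apply: le_trans (ler_wpM2l (ltW C0) h) _.
  by rewrite le_eqVlt; apply/orP; left; apply/eqP; ring.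
rewrite -(ler_powR2r p0) ?rnorm_ge0 ?(mulr_ge0 _ (ltW Cv0))//.
apply: le_trans (rnorm_window _ _ _) _.
have two_p : 2 <= 2 `^ p :> R.
  by rewrite -[leLHS]powRr1// ler_powR ?ler1n// ltW// (lt_trans _ p2)// ltr1n.
apply: (@le_trans _ _ (\sum_(N < n0) 2 `^ p * (c N `^ p + dd `^ p))).
  apply: ler_sum => N _; have /andP[cr rcd] := cf N (ltn_ord N).
  rewrite -/(r N (f 0)) mulrDr -!powRM ?(ltW dd0) ?c0//.
  have [dc|cd] := leP dd (c N).
    apply: le_trans (_ : (2 * c N) `^ p <= _); last by rewrite lerDl powR_ge0.
    by rewrite ler_powR2r ?rnorm_ge0 ?mulr_ge0//; lra.
  apply: le_trans (_ : (2 * dd) `^ p <= _); last by rewrite lerDr powR_ge0.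
  rewrite ler_powR2r ?rnorm_ge0 ?(mulr_ge0 _ (ltW dd0))//.
  by apply: le_trans rcd _; rewrite mulr_natl mulr2n lerD2r ltW.
rewrite -mulr_sumr big_split /= sum_const_ord.
have dd_le : n0%:R * dd `^ p <= (C * v) `^ p.
  rewrite /dd powRM ?(ltW Cv0) ?invr_ge0 ?ler0n// mulrCA ler_piMr ?powR_ge0//.
  rewrite -powR_inv1 ?ler0n// powRAC powR_inv1 ?powR_ge0// ler_pdivrMr ?powR_gt0// mul1r.
  apply: (@le_trans _ _ (n0.+1%:R)); first by rewrite ler_nat.
  by rewrite -[leLHS]powRr1// ler_powR ?ler1n.
apply: (@le_trans _ _ (2 `^ p * (2 `^ p * (C * v) `^ p))); last first.
  rewrite -!powRM ?mulr_ge0 ?(ltW C0) ?(ltW v0)//.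
  by rewrite (_ : 2 * (2 * (C * v)) = 4 * (C * v))//; ring.
rewrite ler_wpM2l ?powR_ge0//; apply: (@le_trans _ _ (2 * (C * v) `^ p)).
  by rewrite (_ : 2 = 1 + 1)// mulrDl mul1r lerD.
by rewrite ler_wpM2r ?powR_ge0.
Qed.

End hilbert_sum_pairing.

(** * The zeroth target summand, with arbitrary weights *)

Section zeroth_pairing.
Variables (R : realType) (k : scalar_kind).
Local Notation K := (Defs.scalar R k).
Local Notation absK z := (rnorm (z : K^o)).
Local Notation re := (@real_part R k).
Local Notation r2K := (@of_real R k).
Variables (p : R) (p1 : 1 <= p) (p2 : 2 < p) (V W : nat -> nat -> R).
Local Notation Z := (lp_sum p1 (fun N => Xpw k p1 (V N))).
Local Notation Y := (lp_sum p1 (fun N => Xpw k p1 (W N))).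
Variables (A : Z -> Y) (B : Y -> Z) (C : R).
Hypotheses (AC : bounded_linear C A) (BC : bounded_linear C B) (C0 : 0 < C).
Variables (v : nat -> R) (idx : nat -> nat -> nat).
Hypotheses (v0 : forall L, 0 < v L) (v1 : forall L, v L <= 1).
Hypotheses (Vv : forall L j, V L (idx L j) = v L) (idx_inj : forall L, injective (idx L)).

Let p0 : 0 < p. Proof. exact: lt_trans p2. Qed.
Let one_p : 1 `^ p = 1 :> R. Proof. by rewrite powR1. Qed.
Let AL : linear A := AC.1.
Let BL : linear B := BC.1.

Let sgl L : Xpw k p1 (V L) -> Z := single p1 (X := fun N => Xpw k p1 (V N)) (n := L).
Let u L j : Y := A (sgl (unit_vector k p1 (V L) (idx L j))).

Let sglL L : linear (@sgl L). Proof. exact: single_linear. Qed.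

Let rnorm_e L j : rnorm (unit_vector k p1 (V L) (idx L j)) <= 1.
Proof. by rewrite rnorm_unit_vector// Vv gtr0_norm. Qed.

Let rnorm_u L j : rnorm (u L j) <= C.
Proof.
apply: le_trans (AC.2 _) _; rewrite rnorm_single ler_piMr ?(ltW C0)//.
Qed.

(** The square of the weighted l^2 seminorm of the zeroth component, truncated to a finite sum; it
    satisfies the parallelogram law, as [signs_quadratic] requires. *)
Definition weight2 n (y : Y) : R :=
  \sum_(l < n) W 0%N l ^+ 2 * absK (coord (comp y 0) l) ^+ 2.

Lemma weight2_le n y : weight2 n y <= rnorm y ^+ 2.
Proof.
apply: le_trans (sum_coord_2 (comp y 0) n) _.
by rewrite ler_pXn2r ?nnegrE ?rnorm_ge0// rnorm_comp.
Qed.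

Lemma weight2_mono m n y : (m <= n)%N -> weight2 m y <= weight2 n y.
Proof.
move=> mn.
apply: (ler_sum_widen (f := fun l => W 0%N l ^+ 2 * absK (coord (comp y 0) l) ^+ 2)) => // l.
by rewrite mulr_ge0// sqr_ge0.
Qed.

Lemma weight2_0 n : weight2 n 0 = 0.
Proof. by rewrite /weight2 big1// => l _; rewrite comp0 coord0 rnorm0 expr0n mulr0. Qed.

Lemma weight2_parallelogram n a b :
  2 * weight2 n a + 2 * weight2 n b <= weight2 n (a + b) + weight2 n (a - b).
Proof.
rewrite /weight2.
under [X in _ <= X + _]eq_bigr => l _ do rewrite compD coordD.
under [X in _ <= _ + X]eq_bigr => l _ do rewrite compB coordB.
rewrite !mulr_sumr -!big_split /=; apply: ler_sum => l _.
by rewrite !(mulrCA 2 (W 0%N l ^+ 2)) -!(mulrDr (W 0%N l ^+ 2)) parallelogram.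
Qed.

Lemma weight2Z n (a : R) y : weight2 n (r2K a *: y) = a ^+ 2 * weight2 n y.
Proof.
rewrite /weight2 mulr_sumr; apply: eq_bigr => l _.
by rewrite compZ coordZ rnormM rnorm_of_real exprMn real_normK ?num_real// mulrCA.
Qed.

Lemma block_size (x : R) : 0 < x -> exists s : nat,
  (0 < s)%N /\ s%:R `^ p^-1 <= x * s%:R `^ 2^-1.
Proof.
move=> x0; have h : p^-1 < 2^-1 by rewrite ltf_pV2 ?posrE.
have [s0 sP] := powR_dominated 1 x0 h.
by exists s0.+1; split=> //; have := sP _ (leqnSn s0); rewrite mul1r.
Qed.

(** A signed sum of s basis vectors, scaled by a = (v s^(1/2))^-1, has norm at most 1, and with
    suitable signs its image has [weight2] at least s a^2 d v^2 = d. The weight v cancels, so one d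
    serves all L. *)
Lemma heavy_block L d : 0 < d ->
  (forall j0, exists2 j, (j0 <= j)%N & exists n, d * v L ^+ 2 < weight2 n (u L j)) ->
  exists z : Z, [/\ rnorm z <= 1, (forall l, l <> L -> comp z l = 0) &
    exists n, d <= weight2 n (A z)].
Proof.
move=> d0 /increasing_subsequence[f [fm fP]].
have /choice[n nP] := fP.
have [s [s0 sv]] := block_size (v0 L).
pose h : R := s%:R `^ 2^-1.
have h0 : 0 < h by rewrite powR_gt0 ?ltr0n.
have hh : h ^+ 2 = s%:R by rewrite -powR_mulrn ?powR_ge0// powRV.
pose a := (v L * h)^-1.
have a0 : 0 <= a by rewrite invr_ge0 mulr_ge0 ?(ltW (v0 _)) ?(ltW h0).
have hn : h != 0 by rewrite gt_eqF.
have vn : v L != 0 by rewrite gt_eqF.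
have sva : s%:R * (v L ^+ 2 * a ^+ 2) = 1 by rewrite -hh /a; field; rewrite hn vn.
pose N := \max_(i < s) n i.
have [eps epsP] := signs_quadratic (weight2_0 N) (weight2_parallelogram N)
  (fun i => r2K a *: u L (f i)) s.
exists (sgl (block k p1 (V L) s (idx L \o f) a eps)); split.
- rewrite rnorm_single; apply: (@rnorm_block _ _ _ _ _ _ _ _ _ (v L)) => //.
  + by move=> i _; exact: Vv.
  + by move=> i j _ _ /idx_inj; exact: homo_ltn_inj.
  + rewrite one_p -[s%:R](powRV p0) ?ler0n// -powRM ?powR_ge0//.
    rewrite -[leRHS]one_p; rewrite ler_powR2r ?mulr_ge0 ?powR_ge0//.
    by rewrite ler_pdivrMr ?mulr_gt0// mul1r.
  + by rewrite sva expr1n.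
- by move=> l /eqP lL; rewrite comp_single_neq// eq_sym.
exists N; have -> : A (sgl (block k p1 (V L) s (idx L \o f) a eps)) =
    \sum_(i < s) (-1) ^+ eps i *: (r2K a *: u L (f i)).
  rewrite /block (lin_sum (@sglL L)) (lin_sum AL); apply: eq_bigr => i _.
  by rewrite (linZ (@sglL L)) (linZ AL) scalerA.
apply: le_trans epsP; rewrite -[leLHS]mul1r -sva.
have -> : s%:R * (v L ^+ 2 * a ^+ 2) * d = s%:R * (a ^+ 2 * (d * v L ^+ 2)) by ring.
rewrite -sum_const_ord; apply: ler_sum => i _; rewrite weight2Z ler_wpM2l ?sqr_ge0//.
apply: le_trans (ltW (nP i)) _; apply: weight2_mono.
exact: (leq_bigmax i).
Qed.

(* Vectors [z_1, ..., z_m] given by [heavy_block] for distinct [L] have signed sums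
   of norm at most [m^(1/p)], while [weight2] of a suitable image is at least
   [m * d]. *)
Lemma weight2_small d : 0 < d -> exists L0, forall L, (L0 <= L)%N ->
  exists j0, forall j n, (j0 <= j)%N -> weight2 n (u L j) <= d * v L ^+ 2.
Proof.
move=> d0; apply: contrapT => H.
have Hinf L0 : exists2 L, (L0 <= L)%N & exists z : Z, [/\ rnorm z <= 1,
    (forall l, l <> L -> comp z l = 0) & exists n, d <= weight2 n (A z)].
  apply: contrapT => H'; apply: H; exists L0 => L L0L.
  apply: contrapT => H''; apply: H'; exists L => //; apply: heavy_block => // j0.
  apply: contrapT => H'''; apply: H''; exists j0 => j n j0j; rewrite leNgt.
  by apply/negP => ?; apply: H'''; exists j => //; exists n.
have [L [Lm /choice[z zP]]] := increasing_subsequence Hinf.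
have /choice[n nP] i : exists n, d <= weight2 n (A (z i)) by have [] := zP i.
have d2 : 0 < d / 2 by rewrite divr_gt0.
have [|m0 m0P] := @powR_dominated R (C ^+ 2) _ (p^-1 * 2) 1 d2.
  by rewrite mulrC ltr_pdivrMr// mul1r.
pose m := m0.+1; pose N := \max_(i < m) n i.
have [eps epsP] := signs_quadratic (weight2_0 N) (weight2_parallelogram N) (A \o z) m.
have : m%:R * d <= d / 2 * m%:R.
  have := m0P m (leqnSn _); rewrite powRr1//; apply: le_trans.
  apply: (@le_trans _ _ (\sum_(i < m) weight2 N (A (z i)))).
    rewrite -sum_const_ord; apply: ler_sum => i _; apply: le_trans (nP i) _.
    by apply: weight2_mono; exact: (leq_bigmax i).
  apply: le_trans epsP _; apply: le_trans (weight2_le _ _) _.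
  have -> : \sum_(i < m) (-1) ^+ eps i *: (A \o z) i = A (\sum_(i < m) (-1) ^+ eps i *: z i).
    by rewrite (lin_sum AL); apply: eq_bigr => i _; rewrite (linZ AL).
  rewrite powRrM powR_mulrn ?powR_ge0// -exprMn.
  rewrite ler_pXn2r ?nnegrE ?rnorm_ge0 ?mulr_ge0 ?powR_ge0 ?(ltW C0)//.
  apply: le_trans (AC.2 _) _; rewrite ler_wpM2l ?(ltW C0)//.
  rewrite -(big_mkord xpredT (fun i => (-1) ^+ eps i *: z i)) -[leRHS]mulr1.
  have -> : m%:R = (size (index_iota 0 m))%:R :> R by rewrite size_iota subn0.
  apply: rnorm_sum_lp => //; first exact: iota_uniq.
    by move=> i; rewrite rnorm_sign; have [] := zP i.
  move=> l i j _ _; rewrite !compZ => zi zj.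
  apply: (homo_ltn_inj Lm).
  have zL i' : comp (z i') l <> 0 -> l = L i'.
    by have [_ h _] := zP i'; move=> zil; apply: contrapT => /h.
  by rewrite -(zL i) -?(zL j)// => z0; [apply: zj|apply: zi]; rewrite z0 scaler0.
apply/negP; rewrite -ltNge mulrC ltr_pM2l ?ltr0n//; lra.
Qed.

(** The basis vectors of one source summand are weakly null: as v <= 1 and p > 2, a sum of m of them
    with coefficients of modulus at most 1 has norm at most m^(1/2). If the claim failed, phases
    making the l-th coordinates nonnegative would produce a coordinate of size at least m e. *)
Lemma coord_null L l e : 0 < e ->
  exists j0, forall j, (j0 <= j)%N -> absK (coord (comp (u L j) 0) l) < e.
Proof.
move=> e0; apply: contrapT => H.
have Hinf j0 : exists2 j, (j0 <= j)%N & e <= absK (coord (comp (u L j) 0) l).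
  apply: contrapT => H'; apply: H; exists j0 => j j0j.
  by rewrite ltNge; apply/negP => ?; apply: H'; exists j.
have [f [fm fP]] := increasing_subsequence Hinf.
have /choice[c cP] i := rnorm_phase (coord (comp (u L (f i)) 0) l).
have e2 : 0 < e / 2 by rewrite divr_gt0.
have [|m0 m0P] := @powR_dominated R C _ (2^-1) 1 e2; first by lra.
pose m := m0.+1.
pose x := \sum_(i <- index_iota 0 m) c i *: unit_vector k p1 (V L) (idx L (f i)).
have x_le : rnorm x <= m%:R `^ 2^-1.
  have m1 : 1 <= m%:R `^ 2^-1 :> R.
    apply: (@le_trans _ _ (m%:R `^ 0)); first by rewrite powRr0.
    by rewrite ler_powR// ler1n.
  apply: rnorm_sum_unit_vector; first exact: powR_ge0.
  - exact: iota_uniq.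
  - by move=> i j _ _ /idx_inj; exact: homo_ltn_inj.
  - rewrite big_mkord; apply: (@le_trans _ _ m%:R).
      rewrite -[leRHS]mulr1 -sum_const_ord; apply: ler_sum => i _.
      by rewrite -[leRHS]one_p ler_powR2r ?rnorm_ge0//; have [] := cP i.
    rewrite -powRrM -[leLHS]powRr1// ler_powR ?ler1n//.
    by rewrite mulrC ler_pdivlMr// mul1r ltW.
  - rewrite big_mkord -powR_mulrn ?powR_ge0// powRV//.
    rewrite -[leRHS]mulr1 -sum_const_ord; apply: ler_sum => i _.
    rewrite Vv mulr_ile1 ?sqr_ge0 ?expr_le1 ?rnorm_ge0 ?(ltW (v0 _))//.
    by have [] := cP i.
have : m%:R * e <= e / 2 * m%:R.
  have := m0P m (leqnSn _); rewrite powRr1//; apply: le_trans.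
  apply: (@le_trans _ _ (absK (coord (comp (A (sgl x)) 0) l))); last first.
    apply: le_trans (rnorm_coord _ _) _; apply: le_trans (rnorm_comp _ _) _.
    by apply: le_trans (AC.2 _) _; rewrite rnorm_single ler_wpM2l ?(ltW C0).
  have -> : coord (comp (A (sgl x)) 0) l =
      r2K (\sum_(i < m) absK (coord (comp (u L (f i)) 0) l)).
    rewrite /x big_mkord (lin_sum (@sglL L)) (lin_sum AL) comp_sum coord_sum of_real_sum.
    apply: eq_bigr => i _; rewrite (linZ (@sglL L)) (linZ AL) compZ coordZ.
    by have [_ <-] := cP i.
  rewrite rnorm_of_real; apply: le_trans (ler_norm _).
  by rewrite -sum_const_ord; apply: ler_sum => i _; exact: fP.
apply/negP; rewrite -ltNge mulrC ltr_pM2l ?ltr0n//; lra.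
Qed.

(** For n = 0 this is the projection onto the zeroth summand. *)
Definition zeroth_tail n (y : Y) : Y :=
  single p1 (X := fun N => Xpw k p1 (W N)) (n := 0%N) (Xtail n (comp y 0)).

Lemma zeroth_tail_linear n : linear (zeroth_tail n).
Proof.
by move=> a x y; rewrite /zeroth_tail comp_linear Xtail_linear single_linear.
Qed.

Lemma zeroth_tail_small y e : 0 < e ->
  exists n0, forall n, (n0 <= n)%N -> rnorm (zeroth_tail n y) < e.
Proof.
move=> /(Xrestrict_tail (comp y 0))[n0 n0P]; exists n0 => n /n0P.
by rewrite rnorm_single.
Qed.

Lemma zeroth_head_null L n e : 0 < e -> exists j0, forall j, (j0 <= j)%N ->
  rnorm (zeroth_tail 0 (u L j) - zeroth_tail n (u L j)) < e.
Proof.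
move=> e0; pose F l j := absK (coord (comp (u L j) 0) l) * rnorm (unit_vector k p1 (W 0%N) l).
have [||j0 j0P] := @sum_eventually_small R F _ n e _ => // [l d d0|].
  have N0 : 0 < 1 + rnorm (unit_vector k p1 (W 0%N) l) by rewrite ltr_pwDl// rnorm_ge0.
  have [j0 j0P] := coord_null L l (divr_gt0 d0 N0).
  exists j0 => j /j0P; rewrite ltr_pdivlMr//; apply: le_lt_trans.
  by rewrite ler_wpM2l ?rnorm_ge0// lerDr.
exists j0 => j /j0P; apply: le_lt_trans.
rewrite /zeroth_tail -(linB (@single_linear _ _ _ _ _ _)) rnorm_single.
have -> : Xtail 0 (comp (u L j) 0) - Xtail n (comp (u L j) 0) =
    Xrestrict (fun i => (i < n)%N) (comp (u L j) 0).
  by apply: Xpw_ext => l; rewrite coord_window// coord_Xrestrict.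
rewrite Xrestrict_ltnE; apply: le_trans (ler_rnorm_sum _ _) _.
by apply: ler_sum => l _; rewrite rnormZ.
Qed.

(** A gliding hump inside the zeroth summand. By [weight2_small] the weighted l^2 part of each image
    is at most d v, so m windows add up to norm at most m^(1/p) C + m^(1/2) d v. The functionals
    contribute C m^(1/2) / v; hence v cancels from the term linear in m, which becomes C d m. *)
Lemma zeroth_pairing e : 0 < e -> exists L0, forall L, (L0 <= L)%N ->
  exists j0, forall j, (j0 <= j)%N ->
  re (coord (comp (B (zeroth_tail 0 (u L j))) L) (idx L j)) < e.
Proof.
(* Makes the linear term C d m equal to e m / 16, against the lower bound e m / 4 given by the
   hump. *)
move=> e0; pose d := e / (16 * C).
have d0 : 0 < d by rewrite divr_gt0// mulr_gt0.
have d2 : 0 < d ^+ 2 by rewrite exprn_gt0.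
have [L0 L0P] := weight2_small d2; exists L0 => L /L0P[j0 j0P].
apply: contrapT => H.
have bad l : exists2 j, (l <= j)%N &
    e <= re (coord (comp (B (zeroth_tail 0 (u L j))) L) (idx L j)).
  apply: contrapT => H'; apply: H; exists l => j lj; rewrite ltNge.
  by apply/negP => ?; apply: H'; exists j.
pose E := Xpw k p1 (V L).
pose B' (y : Y) : E := comp (B y) L.
have B'C : bounded_linear C B'.
  split=> [a x y|y]; first by rewrite /B' BL comp_linear.
  by apply: le_trans (rnorm_comp _ _) (BC.2 y).
pose A' (x : E) : Y := A (sgl x).
have A'L : linear A' by move=> a x y; rewrite /A' sglL AL.
pose F t n := re (coord (B' (zeroth_tail n (u L (j0 + t)))) (idx L (j0 + t))).
have F_small t x : 0 < x -> exists n0, forall n, (n0 <= n)%N -> F t n < x.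
  move=> x0; have [n0 n0P] := zeroth_tail_small (u L (j0 + t)) (divr_gt0 x0 C0).
  exists n0 => n /n0P; rewrite ltr_pdivlMr// mulrC; apply: le_lt_trans.
  exact: (real_part_coord_le _ _ B'C).
have e2 : 0 < e / 2 by rewrite divr_gt0.
(* The coordinates before n of the zeroth component tend to 0 in norm as j grows, so cutting them
   off costs less than e / 2. *)
have F_big n l : exists2 t, (l <= t)%N & e / 2 < F t n.
  have [j1 j1P] := zeroth_head_null L n (divr_gt0 e2 C0).
  have [j lj ej] := bad (maxn (j0 + l) j1).
  have j0j : (j0 + l <= j)%N by exact: leq_trans (leq_maxl _ _) lj.
  have j1j : (j1 <= j)%N by exact: leq_trans (leq_maxr _ _) lj.
  exists (j - j0)%N; first by rewrite leq_subRL// (leq_trans (leq_addr _ _) j0j).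
  rewrite /F subnKC ?(leq_trans (leq_addr _ _) j0j)//.
  have := j1P j j1j; rewrite ltr_pdivlMr// mulrC => hC.
  have := le_lt_trans (real_part_coord_le (zeroth_tail 0 (u L j) - zeroth_tail n (u L j))
    (idx L j) B'C) hC.
  rewrite (linB B'C.1) coordB real_partB; move: ej; rewrite -/(B' _); lra.
have [t [n [nm tm FtP]]] := gliding_hump e2 F_small F_big.
have e16 : 0 < e / 16 by rewrite divr_gt0.
have half : 2^-1 + p^-1 < 1.
  have : p^-1 < 2^-1 by rewrite ltf_pV2 ?posrE.
  lra.
have [m0 m0P] := powR_dominated ((v L)^-1 * C * C) e16 half.
pose m := m0.+1.
pose T i (y : Y) := zeroth_tail (n i) y - zeroth_tail (n i.+1) y.
have TL i : linear (T i) by apply: linear_sub; exact: zeroth_tail_linear.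
have vV : 0 <= (v L)^-1 by rewrite invr_ge0 ltW.
have [||||| eps [h]] := @signs_pairing R k p p1 (V L) Y A' B' C A'L B'C (ltW C0) m
  (fun=> 1%N) (fun i _ => idx L (j0 + t i)) (fun=> 1) (fun=> 1) (fun=> v L) (v L)^-1 T vV TL.
- by move=> _; exact: v0.
- by [].
- by move=> *; exact: Vv.
- by move=> _; rewrite expr1n mulr1 exprVn mulVf// expf_neq0// gt_eqF.
- move=> i i' [|?] [|?]// _ _ _ _ /idx_inj/addnI; split=> //.
  exact: (homo_ltn_inj tm).
pose z i := (-1) ^+ h i *: ((-1) ^+ eps i 0%N *: comp (u L (j0 + t i)) 0).
have -> : \sum_(i < m) (-1) ^+ h i *: T i (A' (block k p1 (V L) 1
      (fun=> idx L (j0 + t i)) 1 (eps i))) =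
    single p1 (X := fun N => Xpw k p1 (W N)) (n := 0%N)
      (\sum_(i < m) (Xtail (n i) (z i) - Xtail (n i.+1) (z i))).
  rewrite (lin_sum (@single_linear _ _ _ _ _ _)); apply: eq_bigr => i _.
  rewrite /block big_ord1 of_real1 mulr1 (linZ A'L) (linZ (TL i)).
  rewrite (linB (@single_linear _ _ _ _ _ _)) /z !(linZ (@Xtail_linear _ _ _ _ _ _)).
  by rewrite !(linZ (@single_linear _ _ _ _ _ _)) -!scalerBr.
apply/negP; rewrite -ltNge rnorm_single.
pose D := m%:R `^ p^-1 * C + m%:R `^ 2^-1 * (d * v L).
have dv0 : 0 <= d * v L by rewrite mulr_ge0 ?(ltW d0) ?(ltW (v0 L)).
have D1 : 0 <= m%:R `^ p^-1 * C by rewrite mulr_ge0 ?powR_ge0 ?(ltW C0).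
have D2 : 0 <= m%:R `^ 2^-1 * (d * v L) by rewrite mulr_ge0 ?powR_ge0.
have D0 : 0 <= D by rewrite addr_ge0.
have z_le : rnorm (\sum_(i < m) (Xtail (n i) (z i) - Xtail (n i.+1) (z i))) <= D.
  apply: (rnorm_sum_Xwindow (ltW C0) D0 (S := d ^+ 2 * v L ^+ 2) nm).
  - move=> i; rewrite /z !rnorm_sign; apply: le_trans (rnorm_comp _ _) _.
    exact: rnorm_u.
  - move=> i l; apply: le_trans (j0P (j0 + t i)%N l (leq_addr _ _)).
    by apply: ler_sum => j _; rewrite /z !coordZ !rnorm_signr.
  - rewrite -{1}[m%:R](powRV p0)// -powRM ?powR_ge0 ?(ltW C0)//.
    by rewrite ler_powR2r// lerDl.
  - apply: (@le_trans _ _ ((m%:R `^ 2^-1 * (d * v L)) ^+ 2)).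
      by rewrite !exprMn (_ : (m%:R `^ 2^-1) ^+ 2 = m%:R)// -powR_mulrn ?powR_ge0// powRV.
    by rewrite ler_pXn2r ?nnegrE// lerDr.
apply: (@le_lt_trans _ _ (e / 8 * m%:R)).
  have mE : m%:R `^ 2^-1 * m%:R `^ 2^-1 = m%:R :> R.
    by rewrite -powRD ?pnatr_eq0 ?implybT// (_ : 2^-1 + 2^-1 = 1) ?powRr1//; lra.
  apply: (@le_trans _ _ (m%:R `^ 2^-1 * (v L)^-1 * C * D)).
    by rewrite ler_wpM2l ?mulr_ge0 ?powR_ge0 ?(ltW C0).
  have vn : v L != 0 by rewrite gt_eqF.
  have Cn : C != 0 by rewrite gt_eqF.
  have -> : m%:R `^ 2^-1 * (v L)^-1 * C * D =
    (v L)^-1 * C * C * (m%:R `^ 2^-1 * m%:R `^ p^-1) +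
    e / 16 * (m%:R `^ 2^-1 * m%:R `^ 2^-1).
    by rewrite /D /d; field; rewrite vn Cn.
  rewrite mE -powRD ?pnatr_eq0 ?implybT//.
  have := m0P m (leqnSn _); rewrite powRr1//; lra.
apply: (@lt_le_trans _ _ (\sum_(i < m) e / 2 / 2)).
  by rewrite sum_const_ord mulrC ltr_pM2l ?ltr0n//; lra.
apply: ler_sum => i _; apply: ltW; apply: lt_le_trans (FtP i) _.
by rewrite big_ord1 !mul1r /F /T (linB B'C.1) coordB real_partB.
Qed.

End zeroth_pairing.

Lemma sum_at_most_one (R : numDomainType) (b : nat -> bool) (F : R) m : 0 <= F ->
  (forall i j, b i -> b j -> i = j) -> \sum_(j < m) (if b j then F else 0) <= F.
Proof.
move=> F0 bP; have [[i bi]|nb] := pselect (exists i, b i); last first.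
  by rewrite big1// => i _; case: ifP => // bi; case: nb; exists i.
have [im|mi] := ltnP i m.
  rewrite (bigD1 (Ordinal im))//= bi big1 ?addr0// => j /eqP ji.
  by case: ifP => // bj; case: ji; apply/val_inj; exact: bP.
rewrite big1// => j _; case: ifP => // bj.
by have := leq_trans (ltn_ord j) mi; rewrite (bP _ _ bi bj) ltnn.
Qed.

(** * Complemented copies of X_{p,w'} in X_{p,w} *)

Section blocks.
Variables (R : realType) (p : R) (p2 : 2 < p).
Variables (w : nat -> R) (w0 : forall n, 0 < w n) (wstar : condition_star p w).

Local Notation mass x := (x `^ (2 * p / (p - 2))).

Let p0 : 0 < p. Proof. exact: lt_trans p2. Qed.
Let pm2 : 0 < p - 2. Proof. by rewrite subr_gt0. Qed.

Lemma mass_unbounded e D : 0 < e ->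
  exists n, D < \sum_(i < n) (if w i < e then mass (w i) else 0).
Proof.
move=> e0; apply: contrapT => H.
have : (\sum_(n <oo | (w n < e)%R) (mass (w n))%:E <= D%:E)%E.
  apply: lime_le; first by apply: is_cvg_nneseries => n _ _; rewrite lee_fin powR_ge0.
  apply: nearW => n; rewrite sumEFin lee_fin big_mkord big_mkcond /= leNgt.
  by apply/negP => Dn; apply: H; exists n.
by rewrite wstar// leye_eq.
Qed.

(** The sum stops as soon as it reaches t / 2. Every term counted is at most t / 2, so the last one
    cannot carry it beyond t. *)
Lemma next_block (t : R) N : 0 < t -> exists M, (N < M)%N /\
  t / 2 <= \sum_(i < M) (if (N <= i)%N && (mass (w i) <= t / 2) then mass (w i) else 0) <= t.
Proof.
move=> t0; pose F i := if (N <= i)%N && (mass (w i) <= t / 2) then mass (w i) else 0.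
have F0 i : 0 <= F i by rewrite /F; case: ifP => // _; exact: powR_ge0.
have t2 : 0 < t / 2 by rewrite divr_gt0.
(* The weight whose mass is t / 2. *)
pose e := (t / 2) `^ ((p - 2) / (2 * p)).
have e0 : 0 < e by rewrite powR_gt0.
have expp : 0 < 2 * p / (p - 2) by rewrite divr_gt0// mulr_gt0.
have massE i : w i < e -> mass (w i) <= t / 2.
  have -> : t / 2 = e `^ (2 * p / (p - 2)).
    rewrite /e -powRrM (_ : (p - 2) / (2 * p) * (2 * p / (p - 2)) = 1) ?powRr1 ?(ltW t2)//.
    by field; rewrite !gt_eqF.
  by move=> /ltW we; rewrite ler_powR2r ?powR_ge0 ?(ltW (w0 i)).
(* The mass of the first N indices is added in advance, so that t / 2 remains after these indices
   are discarded. *)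
have [n nP] := mass_unbounded (t / 2 + \sum_(i < N) mass (w i)) e0.
have ex : exists M, t / 2 <= \sum_(i < M) F i.
  exists (N + n)%N.
  rewrite -(@lerD2r _ (\sum_(i < N) mass (w i))).
  apply: le_trans (ltW nP) _.
  apply: (@le_trans _ _ (\sum_(i < N + n) (if w i < e then mass (w i) else 0))).
    apply: (ler_sum_widen (f := fun i => if w i < e then mass (w i) else 0)).
      exact: leq_addl.
    by move=> i; case: ifP => // _; exact: powR_ge0.
  rewrite !big_split_ord /= addrC lerD//.
    rewrite ler_wpDl ?sumr_ge0//; apply: ler_sum => i _.
    rewrite /F leq_addr /=; case: ifP => [/massE ->//|_].
    by case: ifP => // _; exact: powR_ge0.
  by apply: ler_sum => i _; case: ifP => // _; exact: powR_ge0.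
pose M := ex_minn ex.
exists M; rewrite /M; case: ex_minnP => -[|m] mP mmin.
  by move: mP; rewrite big_ord0 leNgt t2.
have lt : \sum_(i < m) F i < t / 2.
  by rewrite ltNge; apply/negP => /mmin; rewrite ltnn.
have Nm : (N <= m)%N.
  rewrite leqNgt; apply/negP => mN; move: mP; rewrite leNgt; apply/negP; rewrite negbK.
  by rewrite big1// => i _; rewrite /F leqNgt (leq_trans (ltn_ord i) mN).
rewrite ltnS Nm mP /=; split=> //.
rewrite big_ord_recr /= [leRHS]splitr lerD ?(ltW lt)//.
by rewrite /F; case: ifP => [/andP[_ ->]//|_]; exact: ltW.
Qed.

(** The bound j <= n on the members n of block j places the block containing n among the first n +
    1, so that a sequence is spread over the blocks by finite sums. *)
Lemma exists_blocks (t : nat -> R) : (forall j, 0 < t j) ->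
  exists (N : nat -> nat) (b : nat -> nat -> bool),
  [/\ {homo N : i j / (i <= j)%N},
      forall j n, b j n -> (j <= n < N j.+1)%N,
      forall i j n, b i n -> b j n -> i = j &
      forall j, t j / 2 <= \sum_(n < N j.+1) (if b j n then mass (w n) else 0) <= t j].
Proof.
move=> t0; have /choice[M MP] (jn : nat * nat) : exists M, (jn.2 < M)%N /\
  t jn.1 / 2 <=
  \sum_(i < M) (if (jn.2 <= i)%N && (mass (w i) <= t jn.1 / 2) then mass (w i) else 0) <=
  t jn.1.
  exact: next_block.
pose N := fix N j := if j is i.+1 then M (i, N i) else 0%N.
have NS j : (N j < N j.+1)%N by exact: (MP (j, N j)).1.
have Nm : {homo N : i j / (i <= j)%N}.
  by apply: homo_leq => // [i j l|i]; [exact: leq_trans|exact: ltnW].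
have Nj j : (j <= N j)%N by elim: j => // j IH; exact: leq_ltn_trans (NS j).
exists N, (fun j n => [&& (N j <= n)%N, (n < N j.+1)%N & mass (w n) <= t j / 2]); split=> //.
- by move=> j n /and3P[jn nj _]; rewrite nj (leq_trans (Nj j)).
- move=> i j n /and3P[in1 in2 _] /and3P[jn1 jn2 _]; apply/eqP; case: ltngtP => // ij.
    by have := leq_trans (leq_ltn_trans jn1 in2) (Nm _ _ ij); rewrite ltnn.
  by have := leq_trans (leq_ltn_trans in1 jn2) (Nm _ _ ij); rewrite ltnn.
- move=> j; have := (MP (j, N j)).2 => /=.
  have -> : \sum_(i < N j.+1) (if [&& (N j <= i)%N, (i < N j.+1)%N & mass (w i) <= t j / 2]
      then mass (w i) else 0) =
    \sum_(i < M (j, N j)) (if (N j <= i)%N && (mass (w i) <= t j / 2) then mass (w i) else 0).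
    by apply: eq_bigr => i _; rewrite (ltn_ord i).
  by [].
Qed.

End blocks.

Section factors_blocks.
Variables (R : realType) (k : scalar_kind).
Local Notation K := (Defs.scalar R k).
Local Notation absK z := (rnorm (z : K^o)).
Local Notation r2K := (@of_real R k).
Variables (p : R) (p1 : 1 <= p) (p2 : 2 < p).
Variables (w w' : nat -> R) (w0 : forall n, 0 < w n) (w'0 : forall n, 0 < w' n).
Variables (N : nat -> nat) (b : nat -> nat -> bool).
Let th n := w n `^ (2 * p / (p - 2)).
Let tau j := w' j `^ (2 * p / (p - 2)).
Let Th j := \sum_(n < N j.+1) (if b j n then th n else 0).
Hypotheses (Nm : {homo N : i j / (i <= j)%N})
  (bN : forall j n, b j n -> (j <= n < N j.+1)%N)
  (bdis : forall i j n, b i n -> b j n -> i = j)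
  (bt : forall j, tau j / 2 <= Th j <= tau j).

Let p0 : 0 < p. Proof. exact: lt_trans p2. Qed.
Let pm2 : 0 < p - 2. Proof. by rewrite subr_gt0. Qed.
Let th0 n : 0 < th n. Proof. exact: powR_gt0. Qed.
Let tau0 j : 0 < tau j. Proof. exact: powR_gt0. Qed.
Let Th0 j : 0 < Th j.
Proof. by have /andP[h _] := bt j; apply: lt_le_trans h; rewrite divr_gt0. Qed.

(* The block vector [sum_n c j n e_n] has norm 1 in l^p and weighted l^2 norm
   [Th j ^ ((p-2)/(2p))], comparable with [w' j] by [bt]; [d j n] are the
   coefficients of the biorthogonal functional. *)
Let c j n := (th n / Th j) `^ p^-1.
Let d j n := (th n / Th j) `^ (1 - p^-1).
Let c0 j n : 0 <= c j n. Proof. exact: powR_ge0. Qed.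
Let d0 j n : 0 <= d j n. Proof. exact: powR_ge0. Qed.
Let q0 j n : 0 < th n / Th j. Proof. exact: divr_gt0. Qed.

Let w2E n : w n ^+ 2 = th n `^ ((p - 2) / p).
Proof.
rewrite -powRrM (_ : _ * _ = 2) ?powR_mulrn ?(ltW (w0 n))//.
by field; rewrite !gt_eqF.
Qed.

Let w'2E j : w' j ^+ 2 = tau j `^ ((p - 2) / p).
Proof.
rewrite -powRrM (_ : _ * _ = 2) ?powR_mulrn ?(ltW (w'0 j))//.
by field; rewrite !gt_eqF.
Qed.

Let cpE j n : c j n `^ p = th n / Th j.
Proof. by rewrite /c powRV// ltW. Qed.

Let cdE j n : c j n * d j n = th n / Th j.
Proof.
rewrite /c /d -powRD; last by rewrite (gt_eqF (q0 _ _)) implybT.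
by rewrite addrC subrK powRr1// ltW.
Qed.

(** The exponent 2p / (p - 2) of the mass is what gives th n the power (p - 2) / p + 2 / p = 1, so
    that summation over a block yields Th j. In [dwE] likewise 2 (1 - 1/p) - (p - 2) / p = 1. *)
Let wcE j n : w n ^+ 2 * c j n ^+ 2 = th n * Th j `^ (- (2 / p)).
Proof.
rewrite w2E /c -[_ ^+ 2]powR_mulrn ?powR_ge0// -powRrM.
rewrite powRM ?(ltW (th0 n)) ?invr_ge0 ?(ltW (Th0 j))// mulrA -powRD; last first.
  by rewrite (gt_eqF (th0 _)) implybT.
rewrite (_ : _ + _ = 1) ?powRr1 ?(ltW (th0 n))//; last by field; rewrite gt_eqF.
by rewrite -powR_inv1 ?(ltW (Th0 j))// -powRrM; congr (_ * _ `^ _); field; rewrite gt_eqF.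
Qed.

Let dwE j n : (d j n / w n) ^+ 2 = th n * Th j `^ (- (2 - 2 / p)).
Proof.
rewrite expr_div_n w2E /d -[_ ^+ 2]powR_mulrn ?powR_ge0// -powRrM.
rewrite powRM ?(ltW (th0 n)) ?invr_ge0 ?(ltW (Th0 j))// mulrAC -powRB; last first.
  by rewrite (gt_eqF (th0 _)) implybT.
rewrite (_ : _ - _ = 1) ?powRr1 ?(ltW (th0 n))//; last by field; rewrite gt_eqF.
by rewrite -powR_inv1 ?(ltW (Th0 j))// -powRrM; congr (_ * _ `^ _); field; rewrite gt_eqF.
Qed.

Let sum_blocks (F : nat -> R) m : (forall n, 0 <= F n) ->
  \sum_(j < m) \sum_(n < N j.+1) (if b j n then F n else 0) <= \sum_(n < N m) F n.
Proof.
move=> F0; apply: (@le_trans _ _ (\sum_(j < m) \sum_(n < N m) (if b j n then F n else 0))).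
  apply: ler_sum => j _; apply: (ler_sum_widen (f := fun n => if b j n then F n else 0)).
    by apply: Nm; exact: ltn_ord.
  by move=> n; case: ifP.
rewrite exchange_big /=; apply: ler_sum => n _.
by apply: (sum_at_most_one (b := fun j => b j n)) => // i j; exact: bdis.
Qed.

Let sum_ThE j (F : R) : \sum_(n < N j.+1) (if b j n then th n * F else 0) = Th j * F.
Proof.
rewrite /Th mulr_suml; apply: eq_bigr => n _.
by case: ifP => //; rewrite mul0r.
Qed.

Let sum_th m j (F : R) : 0 <= F ->
  \sum_(n < m) (if b j n then th n * F else 0) <= Th j * F.
Proof.
move=> F0; rewrite -sum_ThE.
have G0 n : 0 <= (if b j n then th n * F else 0) by case: ifP => // _; rewrite mulr_ge0// ltW.
apply: (@le_trans _ _ (\sum_(n < N j.+1 + m) (if b j n then th n * F else 0))).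
  by apply: (ler_sum_widen (f := fun n => if b j n then th n * F else 0)); rewrite ?leq_addl.
rewrite big_split_ord /= [X in _ + X]big1 ?addr0// => n _.
by case: ifP => // /bN/andP[_]; rewrite ltnNge leq_addr.
Qed.

(** The embedding: x j times block vector j, summed over j; by [bN] only j <= n matters at index n.
    Its left inverse [average] applies the biorthogonal functionals. *)
Let spread (x : nat -> K) n : K := \sum_(j < n.+1) (if b j n then r2K (c j n) * x j else 0).

Let average (z : nat -> K) j : K :=
  \sum_(n < N j.+1) (if b j n then r2K (d j n) * z n else 0).

Let spread_sum (f : K -> R) (x : nat -> K) m (wt : nat -> R) (F : nat -> nat -> R) :
  f 0 = 0 -> (forall z, 0 <= f z) -> (forall n, 0 <= wt n) -> (forall j n, 0 <= F j n) ->
  (forall j n, wt n * f (r2K (c j n) * x j) = F j n) ->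
  \sum_(n < m) wt n * f (spread x n) <=
  \sum_(j < m) \sum_(n < m) (if b j n then F j n else 0).
Proof.
move=> f0 f_ge0 wt0 F0 FE; rewrite exchange_big /=; apply: ler_sum => n _.
apply: (@le_trans _ _ (\sum_(j < n.+1) (if b j n then F j n else 0))); last first.
  by apply: (ler_sum_widen (f := fun j => if b j n then F j n else 0)) => // j; case: ifP.
apply: le_trans (ler_wpM2l (wt0 n) (@sum_ord_disjoint _ _ f _
  (fun j => if b j n then r2K (c j n) * x j else 0) f0 f_ge0 _)) _.
  by move=> i j _ _; case: ifP => // bi _; case: ifP => // bj _; exact: bdis bi bj.
rewrite mulr_sumr; apply: ler_sum => j _.
by case: ifP => _; rewrite ?FE// f0 mulr0.
Qed.

Let spread_p (x : nat -> K) m :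
  \sum_(n < m) absK (spread x n) `^ p <= \sum_(j < m) absK (x j) `^ p.
Proof.
have := @spread_sum (fun z => absK z `^ p) x m (fun=> 1)
  (fun j n => th n * ((Th j)^-1 * absK (x j) `^ p)).
under eq_bigr => n _ do rewrite mul1r.
move=> h; apply: le_trans (h _ _ _ _ _) _ => //.
- by rewrite rnorm0 powR0// gt_eqF.
- by move=> z; exact: powR_ge0.
- by move=> j n; rewrite !mulr_ge0 ?invr_ge0 ?powR_ge0 ?(ltW (th0 _)) ?(ltW (Th0 _)).
- move=> j n; rewrite mul1r rnormM rnorm_of_real (ger0_norm (c0 _ _)).
  by rewrite powRM ?rnorm_ge0// cpE mulrA.
apply: ler_sum => j _; apply: le_trans (sum_th _ _ _) _.
  by rewrite mulr_ge0 ?powR_ge0// invr_ge0 ltW.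
by rewrite mulrA mulfV ?mul1r// gt_eqF.
Qed.

Let spread_2 (x : nat -> K) m :
  \sum_(n < m) w n ^+ 2 * absK (spread x n) ^+ 2 <=
  \sum_(j < m) w' j ^+ 2 * absK (x j) ^+ 2.
Proof.
have := @spread_sum (fun z => absK z ^+ 2) x m (fun n => w n ^+ 2)
  (fun j n => th n * (Th j `^ (- (2 / p)) * absK (x j) ^+ 2)).
move=> h; apply: le_trans (h _ _ _ _ _) _ => //.
- by rewrite rnorm0 expr0n.
- by move=> z; exact: sqr_ge0.
- by move=> n; exact: sqr_ge0.
- by move=> j n; rewrite mulr_ge0 ?(ltW (th0 _))// mulr_ge0 ?powR_ge0 ?sqr_ge0.
- move=> j n; rewrite rnormM rnorm_of_real (ger0_norm (c0 _ _)).
  by rewrite exprMn [LHS]mulrA wcE -[LHS]mulrA.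
apply: ler_sum => j _; apply: le_trans (sum_th _ _ _) _.
  by rewrite mulr_ge0 ?powR_ge0 ?sqr_ge0.
rewrite mulrA ler_wpM2r ?sqr_ge0// w'2E -{1}[Th j]powRr1 ?(ltW (Th0 _))//.
rewrite -powRD; last by rewrite (gt_eqF (Th0 _)) implybT.
rewrite (_ : 1 - 2 / p = (p - 2) / p); last by field; rewrite gt_eqF.
rewrite ler_powR2r ?divr_gt0 ?(ltW (Th0 _)) ?(ltW (tau0 _))//.
by have /andP[] := bt j.
Qed.

Let average_le (z : nat -> K) j : absK (average z j) <=
  \sum_(n < N j.+1) (if b j n then d j n * absK (z n) else 0).
Proof.
apply: le_trans (ler_rnorm_sum _ _) _; apply: ler_sum => n _.
by case: ifP => _; rewrite ?rnorm0// rnormM rnorm_of_real ger0_norm.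
Qed.

(** Hoelder on each block with exponents p / (p - 1) and p: the powers d j n ^ (p / (p - 1)) equal
    th n / Th j and sum to 1. *)
Let average_p (z : nat -> K) m :
  \sum_(j < m) absK (average z j) `^ p <= \sum_(n < N m) absK (z n) `^ p.
Proof.
have zp0 n : 0 <= absK (z n) `^ p by exact: powR_ge0.
apply: le_trans (sum_blocks m zp0); apply: ler_sum => j _.
set S := \sum_(n < N j.+1) _.
have S0 : 0 <= S by rewrite sumr_ge0// => n _; case: ifP.
have pm1 : 0 < p - 1 by rewrite subr_gt0 (lt_trans _ p2)// ltr1n.
rewrite -(powRV p0 S0) ler_powR2r ?rnorm_ge0 ?powR_ge0//.
apply: le_trans (average_le z j) _; rewrite -[leRHS]mul1r.
rewrite (eq_bigr (fun n : 'I_(N j.+1) => (if b j n then d j n else 0) *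
  (if b j n then absK (z n) else 0))); last first.
  by move=> n _; case: ifP; rewrite ?mul0r.
apply: (@hoelder_sum _ (p / (p - 1)) p _ (fun n => if b j n then d j n else 0)
  (fun n => if b j n then absK (z n) else 0)) => //.
- by rewrite divr_gt0.
- by field; rewrite !gt_eqF.
- by move=> n; case: ifP.
- by move=> n; case: ifP => // _; exact: rnorm_ge0.
- exact: powR_ge0.
- rewrite powR1; apply: (@le_trans _ _ (\sum_(n < N j.+1) (if b j n then th n * (Th j)^-1 else 0))).
    apply: ler_sum => n _; case: ifP => _; last by rewrite powR0// gt_eqF// divr_gt0.
    rewrite /d -powRrM (_ : (1 - p^-1) * (p / (p - 1)) = 1) ?powRr1 ?(ltW (q0 _ _))//.
    by field; rewrite !gt_eqF.
  by rewrite sum_ThE mulfV// gt_eqF.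
- rewrite powRV//; apply: ler_sum => n _.
  by case: ifP => // _; rewrite powR0// gt_eqF.
Qed.

(** Cauchy-Schwarz on each block. The factor 2 comes from tau j <= 2 Th j, raised to the power (p -
    2) / p < 1. *)
Let average_2 (z : nat -> K) m :
  \sum_(j < m) w' j ^+ 2 * absK (average z j) ^+ 2 <=
  2 * \sum_(n < N m) w n ^+ 2 * absK (z n) ^+ 2.
Proof.
have zp0 n : 0 <= w n ^+ 2 * absK (z n) ^+ 2 by rewrite mulr_ge0// sqr_ge0.
apply: le_trans (ler_wpM2l _ (sum_blocks m zp0)) => //; rewrite mulr_sumr.
apply: ler_sum => j _; set S := \sum_(n < N j.+1) _.
have S0 : 0 <= S by rewrite sumr_ge0// => n _; case: ifP.
pose e := (p - 2) / p.
have e0 : 0 < e by rewrite divr_gt0.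
have le_avg : absK (average z j) <= Th j `^ (- e / 2) * Num.sqrt S.
  apply: le_trans (average_le z j) _.
  rewrite (eq_bigr (fun n : 'I_(N j.+1) => (if b j n then d j n / w n else 0) *
    (if b j n then w n * absK (z n) else 0))); last first.
    move=> n _; case: ifP; rewrite ?mul0r// => _.
    by rewrite mulrA divfK// gt_eqF.
  apply: (cauchy_schwarz_sum (a := fun n => if b j n then d j n / w n else 0)
    (b := fun n => if b j n then w n * absK (z n) else 0)).
  - by move=> n; case: ifP => // _; rewrite divr_ge0// ltW.
  - by move=> n; case: ifP => // _; rewrite mulr_ge0 ?rnorm_ge0// ltW.
  - exact: powR_ge0.
  - exact: sqrtr_ge0.
  - apply: (@le_trans _ _ (\sum_(n < N j.+1)
      (if b j n then th n * Th j `^ (- (2 - 2 / p)) else 0))).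
      by apply: ler_sum => n _; case: ifP => _; rewrite ?dwE// expr0n.
    rewrite sum_ThE -{1}[Th j]powRr1 ?(ltW (Th0 _))//.
    rewrite -powRD; last by rewrite (gt_eqF (Th0 _)) implybT.
    rewrite -powR_mulrn ?powR_ge0// -powRrM.
    by rewrite (_ : 1 - (2 - 2 / p) = - e / 2 * 2)// /e; field; rewrite gt_eqF.
  - rewrite sqr_sqrtr//; apply: ler_sum => n _.
    by case: ifP => _; rewrite ?exprMn// expr0n.
apply: (@le_trans _ _ (w' j ^+ 2 * (Th j `^ (- e / 2) * Num.sqrt S) ^+ 2)).
  rewrite ler_wpM2l ?sqr_ge0// ler_pXn2r ?nnegrE ?rnorm_ge0 ?mulr_ge0 ?powR_ge0 ?sqrtr_ge0//.
rewrite exprMn sqr_sqrtr// mulrA ler_wpM2r// w'2E -/e.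
rewrite -[(_ `^ (- e / 2)) ^+ 2]powR_mulrn ?powR_ge0// -powRrM divfK// powRN.
rewrite ler_pdivrMr ?powR_gt0//.
apply: (@le_trans _ _ ((2 * Th j) `^ e)).
  rewrite ler_powR2r ?mulr_ge0 ?(ltW (Th0 _)) ?(ltW (tau0 _))//.
  by have /andP[h _] := bt j; rewrite -ler_pdivrMl// mulrC.
rewrite powRM ?(ltW (Th0 _))// ler_wpM2r ?powR_ge0//.
rewrite -[leRHS]powRr1// ler_powR ?ler1n//.
by rewrite /e ler_pdivrMr// mul1r gerBl.
Qed.

Let coord_spread (x : Xpw k p1 w') n :
  coord (Xpw_mk p1 w (spread (coord x))) n = spread (coord x) n.
Proof.
apply: (@coord_Xpw_mk R k p p1 w _ (rnorm x) n (rnorm_ge0 x)) => m.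
  by apply: le_trans (spread_p _ _) _; exact: sum_coord_p.
by apply: le_trans (spread_2 _ _) _; exact: sum_coord_2.
Qed.

Let average_bounds (z : Xpw k p1 w) :
  (forall n, \sum_(i < n) absK (average (coord z) i) `^ p <= (2 * rnorm z) `^ p) /\
  (forall n, \sum_(i < n) w' i ^+ 2 * absK (average (coord z) i) ^+ 2 <= (2 * rnorm z) ^+ 2).
Proof.
split=> m.
  apply: le_trans (average_p _ _) _; apply: le_trans (sum_coord_p _ _) _.
  by rewrite ler_powR2r ?mulr_ge0 ?rnorm_ge0// ler_peMl ?rnorm_ge0// ler1n.
apply: le_trans (average_2 _ _) _.
apply: le_trans (ler_wpM2l _ (sum_coord_2 _ _)) _ => //.
by rewrite exprMn ler_wpM2r ?sqr_ge0// expr2 ler_peMl// ler1n.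
Qed.

Let coord_average (z : Xpw k p1 w) j :
  coord (Xpw_mk p1 w' (average (coord z))) j = average (coord z) j.
Proof.
have [hp h2] := average_bounds z.
by apply: (@coord_Xpw_mk R k p p1 w' _ (2 * rnorm z) j) => //; rewrite mulr_ge0 ?rnorm_ge0.
Qed.

Lemma factors_blocks : factors (Xpw k p1 w') (Xpw k p1 w).
Proof.
apply: (@factorsI R k _ _ 1 2 (fun x => Xpw_mk p1 w (spread (coord x)))
  (fun z => Xpw_mk p1 w' (average (coord z)))) => //.
- split=> [a x y|x].
    apply: Xpw_ext => n; rewrite coord_linear !coord_spread /spread mulr_sumr -big_split /=.
    apply: eq_bigr => j _; case: ifP => _; last by rewrite mulr0 addr0.
    by rewrite -[LHS]/(r2K (c j n) * (a * coord x j + coord y j)) mulrDr mulrCA.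
  rewrite mul1r; apply/rnorm_XpwP; first exact: rnorm_ge0.
  split=> m; under eq_bigr => i _ do rewrite coord_spread.
    by apply: le_trans (spread_p _ _) _; exact: sum_coord_p.
  by apply: le_trans (spread_2 _ _) _; exact: sum_coord_2.
- split=> [a x y|z].
    apply: Xpw_ext => j; rewrite coord_linear !coord_average /average mulr_sumr -big_split /=.
    apply: eq_bigr => n _; case: ifP => _; last by rewrite mulr0 addr0.
    by rewrite -[LHS]/(r2K (d j n) * (a * coord x n + coord y n)) mulrDr mulrCA.
  have [hp h2] := average_bounds z.
  apply/rnorm_XpwP; first by rewrite mulr_ge0 ?rnorm_ge0.
  by split=> m; under eq_bigr => i _ do rewrite coord_average; [exact: hp|exact: h2].
move=> x; apply: Xpw_ext => j; rewrite coord_average /average.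
rewrite (eq_bigr (fun n : 'I_(N j.+1) => r2K (if b j n then th n * (Th j)^-1 else 0) * coord x j)).
  by rewrite -mulr_suml -of_real_sum sum_ThE mulfV ?of_real1 ?mul1r// gt_eqF.
move=> n _; case: ifP => bn; last by rewrite of_real0 mul0r.
rewrite coord_spread /spread -[_ * (_)^-1]/(th n / Th j) -cdE of_realM.
have jn : (j < n.+1)%N by have /andP[] := bN bn.
rewrite (bigD1 (Ordinal jn))//= bn big1 ?addr0; first by rewrite mulrA [r2K _ * r2K _]mulrC.
move=> i /eqP ij; case: ifP => // bi; case: ij; apply/val_inj => /=; exact: bdis bi bn.
Qed.

End factors_blocks.

Lemma factors_Xpw (R : realType) (k : scalar_kind) (p : R) (p1 : 1 <= p)
    (w w' : nat -> R) : 2 < p -> (forall n, 0 < w n) -> condition_star p w ->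
  (forall n, 0 < w' n) -> factors (Xpw k p1 w') (Xpw k p1 w).
Proof.
move=> p2 w0 wstar w'0.
have [N [b [Nm bN bdis bt]]] := exists_blocks p2 w0 wstar
  (fun j => powR_gt0 (2 * p / (p - 2)) (w'0 j)).
exact: (@factors_blocks R k p p1 p2 w w' w0 w'0 N b).
Qed.

(** * Maps between l^p-sums *)

Section lp_map.
Variables (R : realType) (k : scalar_kind).
Local Notation K := (Defs.scalar R k).
Variables (p : R) (p1 : 1 <= p) (X Y : nat -> normedModType K).
Let p0 : 0 < p. Proof. exact: lt_le_trans p1. Qed.

Definition lp_map (f : forall n, X n -> Y n) (x : lp_sum p1 X) : lp_sum p1 Y :=
  lp_mk p1 (fun n => f n (comp x n)).

Variables (f : forall n, X n -> Y n) (C : R).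
Hypotheses (C0 : 0 <= C) (fC : forall n, bounded_linear C (@f n)).

Let lp_map_le (x : lp_sum p1 X) m :
  \sum_(i < m) rnorm (f (comp x i)) `^ p <= (C * rnorm x) `^ p.
Proof.
rewrite powRM ?rnorm_ge0//.
apply: le_trans (ler_wpM2l (powR_ge0 C p) (sum_rnorm_comp x m)).
rewrite mulr_sumr; apply: ler_sum => i _; rewrite -powRM ?rnorm_ge0//.
by rewrite ler_powR2r ?mulr_ge0 ?rnorm_ge0//; exact: (fC i).2.
Qed.

Lemma comp_lp_map (x : lp_sum p1 X) n : comp (lp_map f x) n = f (comp x n).
Proof.
apply: (@comp_lp_mk R k p p1 Y _ (C * rnorm x) n (mulr_ge0 C0 (rnorm_ge0 x))) => m.
exact: lp_map_le.
Qed.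

Lemma bounded_linear_lp_map : bounded_linear C (lp_map f).
Proof.
split=> [a x y|x].
  by apply: lp_ext => n; rewrite comp_linear !comp_lp_map comp_linear (fC n).1.
apply/rnorm_lpP => [|m]; first by rewrite mulr_ge0 ?rnorm_ge0.
by under eq_bigr => i _ do rewrite comp_lp_map.
Qed.

End lp_map.

Section lp_sum_factors.
Variables (R : realType) (k : scalar_kind).
Local Notation K := (Defs.scalar R k).
Variables (p : R) (p1 : 1 <= p).

Lemma factors_lp_sum (E F : normedModType K) : factors E F ->
  factors (lp_sum p1 (fun=> E)) (lp_sum p1 (fun=> F)).
Proof.
move=> [C [A [B [C0 AC BC AB]]]].
have [fA fB] := (bounded_linear_lp_map p1 C0 (fun=> AC), bounded_linear_lp_map p1 C0 (fun=> BC)).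
apply: (factorsI C0 C0 fA fB) => x; apply: lp_ext => n.
by rewrite (comp_lp_map C0 (fun=> BC)) (comp_lp_map C0 (fun=> AC)) AB.
Qed.

Lemma bounded_linear_single (X : nat -> normedModType K) n :
  bounded_linear 1 (single p1 (X := X) (n := n)).
Proof. by split=> [|x]; [exact: single_linear|rewrite rnorm_single mul1r]. Qed.

Lemma bounded_linear_compn (X : nat -> normedModType K) n :
  bounded_linear 1 (fun x : lp_sum p1 X => comp x n).
Proof. by split=> [//|x]; rewrite mul1r rnorm_comp. Qed.

End lp_sum_factors.

(** * Obstructions to factorizations for p > 2 *)

Section obstructions.
Variables (R : realType) (k : scalar_kind).
Local Notation K := (Defs.scalar R k).
Local Notation re := (@real_part R k).
Variables (p : R) (p1 : 1 <= p) (p2 : 2 < p).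
Variables (w : nat -> R) (w0 : forall n, 0 < w n) (wstar : condition_star p w).
Local Notation Ysum W := (lp_sum p1 (fun N => Xpw k p1 (W N))).

Let p0 : 0 < p. Proof. exact: lt_trans p2. Qed.

(* The weight sequence [wgt_pair] takes each value [1/(M+1)] infinitely often, on
   the indices [pair_index M j]; the default [(0, 0)] only affects codes of no pair. *)
Let wgt (M : nat) : R := M.+1%:R^-1.
Let wgt_pair (i : nat) : R := wgt (odflt (0, 0)%N (unpickle i : option (nat * nat))).1.

Let wgt_pairE M j : wgt_pair (pair_index M j) = wgt M.
Proof. by rewrite /wgt_pair /pair_index pickleK. Qed.

Let wgt0 M : 0 < wgt M. Proof. by rewrite invr_gt0. Qed.

Let wgt1 M : wgt M <= 1. Proof. by rewrite invf_le1// ler1n. Qed.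

Let wgt_small d : 0 < d -> exists M0, forall M, (M0 <= M)%N -> wgt M <= d.
Proof.
move=> d0; exists (Num.truncn d^-1) => M dM.
rewrite invf_ple ?posrE//; apply: le_trans (ltW (truncnS_gt _)) _.
by rewrite ler_nat ltnS.
Qed.

Let factors_wgt_pair : factors (Xpw k p1 wgt_pair) (Xpw k p1 w).
Proof. by apply: factors_Xpw => // n; exact: wgt0. Qed.

Let block_sizes : exists s : nat -> nat, forall M, (0 < s M)%N /\
  (s M)%:R `^ p^-1 <= wgt M * (s M)%:R `^ 2^-1.
Proof. by have /choice[s sP] := fun M => block_size p2 (wgt0 M); exists s. Qed.

Let re1 : re 1 = 1. Proof. by rewrite -(of_real1 R k) of_realK. Qed.

Let coord_cancel w' (F : normedModType K) (A : Xpw k p1 w' -> F) B i :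
  cancel A B -> re (coord (B (A (unit_vector k p1 w' i))) i) = 1.
Proof. by move=> AB; rewrite AB coord_unit_vector eqxx re1. Qed.

Lemma tail0 W (y : Ysum W) : tail 0 y = y.
Proof. by apply: lp_ext => n; rewrite comp_restrict. Qed.

(** All target weights are constant, so [block_pairing] with n1 = 0 covers the whole target: a mean
    pairing equal to 1 would be at most 1/2. *)
Lemma not_factors_Xpw (W : nat -> nat -> R) (c : nat -> R) :
  (forall N, 0 < c N) -> (forall N l, W N l = c N) -> ~ factors (Xpw k p1 w) (Ysum W).
Proof.
move=> c0 Wc /(factors_trans factors_wgt_pair)[C [A [B [C0 AC BC AB]]]].
have [s sP] := block_sizes.
have [|M0 /(_ M0 0%N (leqnn _))] := block_pairing p2 AC BC C0 wgt0 wgt_pairE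
  (fun M => (sP M).1) (fun M => (sP M).2) wgt_small (n1 := 0) (fun N _ => c0 N)
  (fun N l _ => Wc N l) (d := 2^-1); first by rewrite invr_gt0.
under eq_bigr => i _ do rewrite tail0 (coord_cancel _ AB).
have s0 : 0 < (s M0)%:R :> R by rewrite ltr0n (sP M0).1.
by rewrite sum_const_ord mulr1; lra.
Qed.

Let zeroth_split W (y : Ysum W) : y = zeroth_tail 0 y + tail 1 y.
Proof.
apply: lp_ext => -[|n]; rewrite compD comp_restrict /=.
  rewrite /zeroth_tail comp_single addr0.
  by apply: Xpw_ext => l; rewrite coord_Xrestrict.
by rewrite /zeroth_tail comp_single_neq// add0r.
Qed.

Lemma v_weight_gt0 N : 0 < v_weight p N.+1.
Proof. by rewrite powR_gt0// divr_gt0. Qed.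

Lemma v_weight_le1 N : v_weight p N.+1 <= 1.
Proof.
apply: (@le_trans _ _ (1 `^ ((p - 2) / (2 * p)))); last by rewrite powR1.
rewrite ler_powR2r ?divr_ge0 ?ler0n// ?divr_gt0 ?subr_gt0 ?mulr_gt0//.
by rewrite ler_pdivrMr// mul1r ler1n.
Qed.

Lemma v_weight_small d : 0 < d -> exists N0, forall N, (N0 <= N)%N -> v_weight p N.+1 <= d.
Proof.
move=> d0; have e0 : 0 < (p - 2) / (2 * p) by rewrite divr_gt0 ?subr_gt0 ?mulr_gt0.
have [n0 n0P] := powR_dominated 1 d0 e0; exists n0 => N nN.
have := n0P N.+1 (leq_trans nN (leqnSn _)).
rewrite powRr0 mulr1 => h.
have NV : (1 / N.+1%:R) `^ ((p - 2) / (2 * p)) = (N.+1%:R `^ ((p - 2) / (2 * p)))^-1 :> R.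
  by rewrite -[RHS]powR_inv1 ?powR_ge0// powRAC powR_inv1 ?ler0n// div1r.
by rewrite /v_weight NV -div1r ler_pdivrMr ?powR_gt0.
Qed.

(** The zeroth summand contributes less than 1/4 for all large j, the others at most 4 C^2 v + 1/4
    for infinitely many j. A common j and an L with 4 C^2 v <= 1/4 leave the total below 1. *)
Lemma not_factors_Bp (W : nat -> nat -> R) :
  (forall N l, (1 <= N)%N -> W N l = 1) -> ~ factors (Bp k p1) (Ysum W).
Proof.
move=> W1 [C' [A [B [C'0 AC' BC' AB]]]].
pose C := C' + 1.
have CC' : C' <= C by rewrite lerDl.
have C0 : 0 < C by rewrite ltr_wpDl.
have AC := bounded_linear_le CC' AC'; have BC := bounded_linear_le CC' BC'.
pose v L := v_weight p L.+1.
have e4 : 0 < 4^-1 :> R by rewrite invr_gt0.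
have [L0 L0P] := @zeroth_pairing R k p p1 p2 (fun L => fun=> v L) W A B C AC BC C0 v (fun L j => j)
  v_weight_gt0 v_weight_le1 (fun L j => erefl) (fun L => @inj_id nat) _ e4.
have d0 : 0 < 4^-1 / (4 * C ^+ 2) by rewrite divr_gt0// mulr_gt0// exprn_gt0.
have [L1 L1P] := v_weight_small d0.
pose L := maxn L0 L1.
have [j0 j0P] := L0P L (leq_maxl _ _).
have vL : 4 * C ^+ 2 * v L <= 4^-1.
  by rewrite mulrC -ler_pdivlMr ?mulr_gt0 ?exprn_gt0//; apply: L1P; exact: leq_maxr.
pose A' := A \o single p1 (X := fun N => Xpw k p1 (fun=> v N)) (n := L).
pose B' := (fun y => comp (y : Ysum (fun N => fun=> v N)) L) \o B.
have A'C : bounded_linear C A'.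
  rewrite -[C]mulr1; rewrite /A'; apply: (bounded_linear_comp (ltW C0) AC).
  exact: bounded_linear_single.
have B'C : bounded_linear C B'.
  rewrite -[C]mul1r; rewrite /B'; apply: (bounded_linear_comp ler01 _ BC).
  exact: bounded_linear_compn.
have AB' : cancel A' B' by move=> x; rewrite /A' /B' /= AB comp_single.
have [j j0j] := @hilbert_sum_pairing R k p p1 p2 _ W A' B' C A'C B'C C0 (v L) 1
  (v_weight_gt0 L) (v_weight_le1 L) (fun i => erefl) W1 _ j0 e4.
have := j0P j j0j; have := coord_cancel j AB'.
rewrite {1}[A' _]zeroth_split (linD B'C.1) coordD real_partD /B' /A'; lra.
Qed.

(** For each copy L a weight index M L is selected at which the summands N >= 1 contribute at most
    1/4 on average. [zeroth_pairing] accepts these weights, however fast they decrease, and provides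
    an L whose zeroth contribution is below 1/4 beyond some j0; the block is then placed beyond
    j0. *)
Lemma not_factors_lp_Xpw (W : nat -> nat -> R) (c : nat -> R) :
  (forall N, (1 <= N)%N -> 0 < c N) -> (forall N l, (1 <= N)%N -> W N l = c N) ->
  ~ factors (lp_sum p1 (fun=> Xpw k p1 w)) (Ysum W).
Proof.
move=> c0 Wc /(factors_trans (factors_lp_sum p1 factors_wgt_pair)).
move=> [C' [A [B [C'0 AC' BC' AB]]]].
pose C := C' + 1.
have CC' : C' <= C by rewrite lerDl.
have C0 : 0 < C by rewrite ltr_wpDl.
have AC := bounded_linear_le CC' AC'; have BC := bounded_linear_le CC' BC'.
have [s sP] := block_sizes.
have e4 : 0 < 4^-1 :> R by rewrite invr_gt0.
pose A' L := A \o single p1 (X := fun=> Xpw k p1 wgt_pair) (n := L).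
pose B' L := (fun y => comp (y : lp_sum p1 (fun=> Xpw k p1 wgt_pair)) L) \o B.
have A'C L : bounded_linear C (A' L).
  rewrite -[C]mulr1; rewrite /A'; apply: (bounded_linear_comp (ltW C0) AC).
  exact: bounded_linear_single.
have B'C L : bounded_linear C (B' L).
  rewrite -[C]mul1r; rewrite /B'; apply: (bounded_linear_comp ler01 _ BC).
  exact: bounded_linear_compn.
have AB' L : cancel (A' L) (B' L) by move=> x; rewrite /A' /B' /= AB comp_single.
have /choice[M MP] L := block_pairing p2 (A'C L) (B'C L) (ltW C0) wgt0 wgt_pairE
  (fun M => (sP M).1) (fun M => (sP M).2) wgt_small (n1 := 1) c0 Wc e4.
have idx_inj L : injective (pair_index (M L)) by move=> i j /pair_index_inj[].
have [L /(_ L (leqnn L))[j0 j0P]] := @zeroth_pairing R k p p1 p2 (fun=> wgt_pair) W A B C AC BC C0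
  (wgt \o M) (fun L => pair_index (M L)) (fun L => wgt0 (M L)) (fun L => wgt1 (M L))
  (fun L j => wgt_pairE (M L) j) idx_inj _ e4.
have s0 : 0 < (s (M L))%:R :> R by rewrite ltr0n (sP _).1.
have := MP L (M L) j0 (leqnn _).
have : \sum_(i < s (M L)) re (coord (B' L (zeroth_tail 0 (A' L (unit_vector k p1 wgt_pair
    (pair_index (M L) (j0 + i)))))) (pair_index (M L) (j0 + i))) <= (s (M L))%:R * 4^-1.
  rewrite -sum_const_ord; apply: ler_sum => i _; apply: ltW.
  exact: (j0P (j0 + i)%N (leq_addr _ _)).
have : \sum_(i < s (M L)) re (coord (B' L (A' L (unit_vector k p1 wgt_pair
    (pair_index (M L) (j0 + i))))) (pair_index (M L) (j0 + i))) = (s (M L))%:R.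
  by rewrite -[RHS]mulr1 -sum_const_ord; apply: eq_bigr => i _; rewrite coord_cancel.
under eq_bigr => i _ do rewrite {1}[A' L _]zeroth_split (linD (B'C L).1) coordD real_partD.
rewrite big_split /=; lra.
Qed.

End obstructions.

(** * Identifying the spaces as l^p-sums of spaces X_{p,w} *)

Section identifications.
Variables (R : realType) (k : scalar_kind).
Local Notation K := (Defs.scalar R k).
Local Notation absK z := (rnorm (z : K^o)).
Variables (p : R) (p1 : 1 <= p).

Section cons.
Variable X : nat -> normedModType K.
Let p0 : 0 < p. Proof. exact: lt_le_trans p1. Qed.
Local Notation Y := (lp_sum p1 X).
Local Notation Y' := (lp_sum p1 (fun n => X n.+1)).

Let cons_seq (x : direct_sum Y' (X 0%N)) n : X n :=
  match n return X n with 0%N => x.2 | m.+1 => comp x.1 m end.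

Let lp_cons (x : direct_sum Y' (X 0%N)) : Y :=
  lp_mk p1 (cons_seq x).

Let lp_uncons (y : Y) : direct_sum Y' (X 0%N) :=
  (lp_mk p1 (fun n => comp y n.+1) : Y', comp y 0).

Let two_p : 2 <= 2 `^ p :> R.
Proof. by rewrite -[leLHS]powRr1// ler_powR// ler1n. Qed.

Let lp_cons_le (x : direct_sum Y' (X 0%N)) m :
  \sum_(i < m) rnorm (cons_seq x i) `^ p
  <= (2 * rnorm x) `^ p.
Proof.
case: x => a b /=; case: m => [|m]; first by rewrite big_ord0 powR_ge0.
rewrite big_ord_recl /= powRM ?rnorm_ge0//.
apply: (@le_trans _ _ (2 * rnorm ((a, b) : direct_sum Y' (X 0%N)) `^ p)); last first.
  by rewrite ler_wpM2r ?powR_ge0.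
rewrite (_ : 2 = 1 + 1)// mulrDl mul1r lerD//.
  by rewrite ler_powR2r ?rnorm_ge0// rnorm_pair le_max lexx orbT.
apply: le_trans (sum_rnorm_comp a m) _.
by rewrite ler_powR2r ?rnorm_ge0// rnorm_pair le_max lexx.
Qed.

Let comp_lp_cons x n : comp (lp_cons x) n = cons_seq x n.
Proof.
apply: (@comp_lp_mk R k p p1 X _ (2 * rnorm x) n) => [|m].
  by rewrite mulr_ge0 ?rnorm_ge0.
exact: lp_cons_le.
Qed.

Let lp_uncons_le (y : Y) m : \sum_(i < m) rnorm (comp y i.+1) `^ p <= rnorm y `^ p.
Proof.
by apply: le_trans (sum_rnorm_comp y m.+1); rewrite big_ord_recl /= lerDr powR_ge0.
Qed.

Let comp_lp_uncons (y : Y) n : comp (lp_uncons y).1 n = comp y n.+1.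
Proof.
apply: (@comp_lp_mk R k p p1 (fun n => X n.+1) _ (rnorm y) n (rnorm_ge0 y)).
exact: lp_uncons_le.
Qed.

(** Absorbs an extra direct summand as the zeroth term. The norm of the direct sum is a maximum, and
    1 + 1 <= 2^p gives the constant 2. *)
Lemma factors_lp_cons : factors (direct_sum Y' (X 0%N)) Y.
Proof.
apply: (@factorsI R k _ _ 2 1 lp_cons lp_uncons) => //.
- split=> [a x y|x].
    by apply: lp_ext => -[|n]; rewrite comp_linear !comp_lp_cons.
  apply/rnorm_lpP => [|m]; first by rewrite mulr_ge0 ?rnorm_ge0.
  by under eq_bigr => i _ do rewrite comp_lp_cons; exact: lp_cons_le.
- split=> [a x y|y].
    congr pair; apply: lp_ext => n.
    rewrite -[LHS]/(comp (lp_uncons (a *: x + y)).1 n).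
    rewrite -[RHS]/(a *: comp (lp_uncons x).1 n + comp (lp_uncons y).1 n).
    by rewrite !comp_lp_uncons comp_linear.
  rewrite mul1r rnorm_pair ge_max rnorm_comp andbT.
  apply/rnorm_lpP => [|m]; first exact: rnorm_ge0.
  under eq_bigr => i _ do rewrite -[lp_mk _ _]/((lp_uncons y).1) comp_lp_uncons.
  exact: lp_uncons_le.
move=> [a b]; rewrite /lp_uncons comp_lp_cons; congr pair.
apply: lp_ext => n; rewrite -[LHS]/(comp (lp_uncons (lp_cons (a, b))).1 n).
by rewrite comp_lp_uncons comp_lp_cons.
Qed.

End cons.

Hypothesis p2 : 2 < p.

Let w1 : nat -> R := fun=> 1.

Let ell2_sum (x : ell2 R k) m : \sum_(i < m) absK (comp x i) ^+ 2 <= rnorm x ^+ 2.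
Proof.
have := sum_rnorm_comp x m; rewrite powR_mulrn ?rnorm_ge0//.
by under eq_bigr => i _ do rewrite powR_mulrn ?rnorm_ge0//.
Qed.

Let Xpw_sum (x : Xpw k p1 w1) m :
  \sum_(i < m) rnorm (coord x i : K^o) `^ 2 <= rnorm x `^ 2.
Proof.
rewrite powR_mulrn ?rnorm_ge0//; under eq_bigr => i _ do rewrite powR_mulrn ?rnorm_ge0//.
exact: ((rnorm_hilbertP p2 (fun=> erefl) x (rnorm_ge0 x)).1 (lexx _)).
Qed.

Let to_Xpw (x : ell2 R k) : Xpw k p1 w1 := Xpw_mk p1 w1 (fun n => comp x n).
Let of_Xpw (x : Xpw k p1 w1) : ell2 R k := lp_mk (ler1n R 2) (fun n => coord x n : K^o).

Let to_bounds (x : ell2 R k) :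
  (forall m, \sum_(i < m) absK (comp x i) `^ p <= rnorm x `^ p) /\
  (forall m, \sum_(i < m) w1 i ^+ 2 * absK (comp x i) ^+ 2 <= rnorm x ^+ 2).
Proof.
split=> m.
  exact: (sum_powR_le_sqr p2 (rnorm_ge0 x) (fun i => rnorm_ge0 (comp x i)) (ell2_sum x)).
by under eq_bigr => i _ do rewrite expr1n mul1r; exact: ell2_sum.
Qed.

Let coord_to_Xpw (x : ell2 R k) n : coord (to_Xpw x) n = comp x n.
Proof.
have [hp h2] := to_bounds x.
exact: (@coord_Xpw_mk R k p p1 w1 _ (rnorm x) n (rnorm_ge0 x)).
Qed.

Let comp_of_Xpw (x : Xpw k p1 w1) n : comp (of_Xpw x) n = coord x n.
Proof.
apply: (@comp_lp_mk R k 2 (ler1n R 2) (fun=> K^o) _ (rnorm x) n (rnorm_ge0 x)).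
exact: Xpw_sum.
Qed.

(** At weight 1 the l^2 part dominates the l^p part of the norm, so both constants are 1. *)
Lemma factors_ell2_Xpw : factors (ell2 R k) (Xpw k p1 (fun=> 1)).
Proof.
apply: (@factorsI R k _ _ 1 1 to_Xpw of_Xpw) => //.
- split=> [a x y|x].
    by apply: Xpw_ext => n; rewrite coord_linear !coord_to_Xpw comp_linear.
  rewrite mul1r; apply/rnorm_XpwP; first exact: rnorm_ge0.
  have [hp h2] := to_bounds x.
  by split=> m; under eq_bigr => i _ do rewrite coord_to_Xpw.
- split=> [a x y|x].
    by apply: lp_ext => n; rewrite comp_linear !comp_of_Xpw coord_linear.
  rewrite mul1r; apply/rnorm_lpP => [|m]; first exact: rnorm_ge0.
  by under eq_bigr => i _ do rewrite comp_of_Xpw; exact: Xpw_sum.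
by move=> x; apply: lp_ext => n; rewrite comp_of_Xpw coord_to_Xpw.
Qed.

Lemma factors_lp_power_ell2 : factors (lp_sum p1 (fun=> ell2 R k))
  (lp_sum p1 (fun=> Xpw k p1 (fun=> 1))).
Proof. exact: factors_lp_sum factors_ell2_Xpw. Qed.

End identifications.

(** * Duality and reflexivity *)

Section dual_basics.
Variables (R : realType) (k : scalar_kind).
Local Notation K := (Defs.scalar R k).
Local Notation absK z := (rnorm (z : K^o)).
Local Notation r2K := (@of_real R k).
Local Notation re := (@real_part R k).
Implicit Types E F : normedModType K.

Lemma rnorm_dualE E (f : dual E) : rnorm f = opnorm f.
Proof. by rewrite /rnorm -[`|f|]/(dual_norm f) /dual_norm of_realK. Qed.

Lemma dual_linearP E (f : dual E) : linear (f : E -> K^o).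
Proof. exact: dual_linear. Qed.

Lemma rnorm_normalize E (x : E) : x != 0 -> rnorm (r2K (rnorm x)^-1 *: x) = 1.
Proof.
move=> x0; have nx : 0 < rnorm x.
  by rewrite lt_neqAle rnorm_ge0 andbT eq_sym; apply: contra x0 => /eqP/rnorm0_eq0 ->.
by rewrite rnormZ rnorm_of_real gtr0_norm ?invr_gt0// mulVf// gt_eqF.
Qed.

Lemma rnorm_dual_apply E (f : dual E) (x : E) : absK (f x) <= rnorm f * rnorm x.
Proof.
have [->|x0] := eqVneq x 0; first by rewrite (lin0 (dual_linearP f)) !rnorm0 mulr0.
have nx : 0 < rnorm x.
  by rewrite lt_neqAle rnorm_ge0 andbT eq_sym; apply: contra x0 => /eqP/rnorm0_eq0 ->.
have /(opnorm_ub f) : rnorm (r2K (rnorm x)^-1 *: x) <= 1 by rewrite rnorm_normalize.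
rewrite (linZ (dual_linearP f)) rnormZ rnorm_of_real gtr0_norm ?invr_gt0//.
by rewrite rnorm_dualE mulrC ler_pdivrMr.
Qed.

Lemma rnorm_dual_le E (f : dual E) C : 0 <= C ->
  (forall x, absK (f x) <= C * rnorm x) -> rnorm f <= C.
Proof.
move=> C0 fC; rewrite rnorm_dualE; apply: opnorm_le => x x1.
by apply: le_trans (fC x) _; rewrite ler_piMr.
Qed.

(* Junk value: 0 if [f] is not linear and bounded. *)
Definition dual_mk E (f : E -> K^o) : dual E := insubd (0 : dual_type E) f.

Lemma bounded_linear_dual E C (f : E -> K^o) : bounded_linear C f -> f \in dual_pred (X := E).
Proof.
move=> [fL fC]; apply/asboolP; split=> //.
pose g := GRing.isLinear.Build _ _ _ _ f fL.
pose G : {linear E -> K^o} := HB.pack f g.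
apply: (@bounded_linear_continuous _ _ _ G); apply/linear_boundedP.
exists (r2K `|C|); split; first by rewrite ger0_real// -(of_real0 R k) ler_of_real.
move=> r Cr x; apply: le_trans (_ : r2K `|C| * `|x| <= _); last first.
  by rewrite ler_wpM2r// ltW.
rewrite -!of_real_rnorm -of_realM ler_of_real; apply: le_trans (fC x) _.
by rewrite ler_wpM2r ?rnorm_ge0// ler_norm.
Qed.

Lemma dual_mkE E C (f : E -> K^o) : bounded_linear C f -> forall x, dual_mk f x = f x.
Proof.
by move=> /bounded_linear_dual fd x; rewrite -[dual_val _]/(val _) val_insubd fd.
Qed.

Lemma rnorm_dual_mk E C (f : E -> K^o) : 0 <= C -> bounded_linear C f -> rnorm (dual_mk f) <= C.
Proof.
move=> C0 fC; apply: rnorm_dual_le => // x; rewrite (dual_mkE fC); exact: fC.2.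
Qed.

Lemma dual_ext E (f g : dual E) : (forall x, f x = g x) -> f = g.
Proof. by move=> fg; apply/val_inj/functional_extensionality_dep. Qed.

Lemma dual_combE E a (f g : dual E) x : (a *: f + g) x = a * f x + g x.
Proof. by []. Qed.

Lemma dualDE E (f g : dual E) x : (f + g) x = f x + g x.
Proof. by []. Qed.

Lemma dualZE E a (f : dual E) x : (a *: f) x = a * f x.
Proof. by []. Qed.

Lemma dual_sumE E (I : Type) (s : seq I) (f : I -> dual E) x :
  (\sum_(i <- s) f i) x = \sum_(i <- s) f i x.
Proof.
elim: s => [|i s IHs]; first by rewrite !big_nil.
by rewrite !big_cons -IHs.
Qed.

Lemma dual_bounded_linear E (f : dual E) : bounded_linear (rnorm f) (f : E -> K^o).
Proof. by split=> [|x]; [exact: dual_linearP|exact: rnorm_dual_apply]. Qed.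

(** The supremum may not be attained, hence the factor 2, which recurs in the constants for duals
    and biduals of l^p-sums. A phase makes the value real. *)
Lemma dual_near_norming E (f : dual E) : exists x, rnorm x <= 1 /\
  exists r : R, f x = r2K r /\ rnorm f <= 2 * r.
Proof.
have [f0|fn0] := eqVneq f 0.
  exists 0; rewrite rnorm0; split=> //; exists 0.
  by rewrite f0 rnorm0 mulr0 of_real0; split.
have nf : 0 < rnorm f.
  by rewrite lt_neqAle rnorm_ge0 andbT eq_sym; apply: contra fn0 => /eqP/rnorm0_eq0 ->.
have [x [x1 fx]] : exists x, rnorm x <= 1 /\ rnorm f / 2 <= absK (f x).
  apply: contrapT => H; have : rnorm f <= rnorm f / 2.
    rewrite {1}rnorm_dualE; apply: opnorm_le => x x1.
    rewrite leNgt; apply/negP => lt; apply: H; exists x; split=> //; exact: ltW.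
  lra.
have [c [c1 cE]] := rnorm_phase (f x : K).
exists (c *: x); split.
  rewrite rnormZ mulr_ile1 ?rnorm_ge0//.
exists (absK (f x)); split; last by lra.
by rewrite (linZ (dual_linearP f)).
Qed.

Definition transpose E F (A : E -> F) (f : dual F) : dual E := dual_mk (fun x => f (A x)).

Lemma bounded_linear_apply E F C (A : E -> F) (f : dual F) : bounded_linear C A ->
  bounded_linear (rnorm f * C) (fun x => f (A x)).
Proof.
move=> hA; exact: bounded_linear_comp (rnorm_ge0 f) (dual_bounded_linear f) hA.
Qed.

Lemma transposeE E F C (A : E -> F) f x : bounded_linear C A -> transpose A f x = f (A x).
Proof. by move=> hA; rewrite /transpose (dual_mkE (bounded_linear_apply f hA)). Qed.

Lemma bounded_linear_transpose E F C (A : E -> F) : 0 <= C -> bounded_linear C A ->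
  bounded_linear C (transpose A).
Proof.
move=> C0 hA; split=> [a f g|f].
  by apply: dual_ext => x; rewrite dual_combE !(transposeE _ _ hA).
apply: rnorm_dual_le => [|x]; first by rewrite mulr_ge0 ?rnorm_ge0.
by rewrite (transposeE _ _ hA) (mulrC C); exact: (bounded_linear_apply f hA).2.
Qed.

Lemma factors_dual E F : factors E F -> factors (dual E) (dual F).
Proof.
move=> [C [A [B [C0 hA hB AB]]]].
apply: (factorsI C0 C0 (bounded_linear_transpose C0 hB) (bounded_linear_transpose C0 hA)).
by move=> f; apply: dual_ext => x; rewrite (transposeE _ _ hA) (transposeE _ _ hB) AB.
Qed.

Definition evaluation E (x : E) : dual (dual E) := dual_mk (fun f : dual E => f x : K^o).

Lemma bounded_linear_eval E (x : E) : bounded_linear (rnorm x) (fun f : dual E => f x : K^o).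
Proof. by split=> // f; rewrite mulrC rnorm_dual_apply. Qed.

Lemma evaluationE E (x : E) f : evaluation x f = f x.
Proof. by rewrite /evaluation (dual_mkE (bounded_linear_eval x)). Qed.

Lemma bounded_linear_evaluation E : bounded_linear 1 (@evaluation E).
Proof.
split=> [a x y|x].
  by apply: dual_ext => f; rewrite dual_combE !evaluationE (dual_linearP f).
apply: rnorm_dual_le => [|f]; first by rewrite mul1r rnorm_ge0.
by rewrite evaluationE mul1r mulrC rnorm_dual_apply.
Qed.

(** [rho] is a two-sided inverse of [evaluation]; the last clause states evaluation (rho psi) = psi
    pointwise. *)
Definition reflexive_with (C : R) E (rho : dual (dual E) -> E) :=
  [/\ 0 <= C, bounded_linear C rho, cancel (@evaluation E) rho &
      forall (psi : dual (dual E)) (f : dual E), f (rho psi) = psi f].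

Lemma factors_bidual C E rho : reflexive_with C (E := E) rho -> factors E (dual (dual E)).
Proof.
by move=> [C0 rC evK _]; exact: factorsI ler01 C0 (bounded_linear_evaluation E) rC evK.
Qed.

Lemma factors_of_bidual C E rho : reflexive_with C (E := E) rho -> factors (dual (dual E)) E.
Proof.
move=> [C0 rC _ revK]; apply: (factorsI C0 ler01 rC (bounded_linear_evaluation E)) => psi.
by apply: dual_ext => f; rewrite evaluationE revK.
Qed.

(* The gliding hump of [tail_pairing] for one functional: it tends to 0 in norm on
   the tails. *)
Lemma shrinking E (T : nat -> E -> E) (a : R) : a < 1 -> (forall n, linear (T n)) ->
  (forall x e, 0 < e -> exists n0, forall n, (n0 <= n)%N -> rnorm (T n x) < e) ->
  (forall (n : nat -> nat) (x : nat -> E) m, {homo n : i j / (i <= j)%N} ->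
     (forall i, rnorm (x i) <= 1) ->
     rnorm (\sum_(i < m) (T (n i) (x i) - T (n i.+1) (x i))) <= m%:R `^ a) ->
  forall (f : dual E) e, 0 < e -> exists n, forall x, absK (f (T n x)) <= e * rnorm x.
Proof.
move=> a1 TL T0 Tsum f e e0; apply: contrapT => H.
have fL := dual_linearP f.
pose F (t : nat * {x : E | rnorm x <= 1}) n := re (f (T n (val t.2))).
have F_small t d : 0 < d -> exists n0, forall n, (n0 <= n)%N -> F t n < d.
  move=> d0; have f1 : 0 < 1 + rnorm f by rewrite ltr_pwDl// rnorm_ge0.
  have [n0 n0P] := T0 (val t.2) _ (divr_gt0 d0 f1).
  exists n0 => n /n0P; rewrite ltr_pdivlMr//; apply: le_lt_trans.
  apply: le_trans (ler_real_part _) _; apply: le_trans (rnorm_dual_apply _ _) _.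
  by rewrite mulrC ler_wpM2l ?rnorm_ge0// lerDr.
have F_big n l : exists2 t, (l <= t.1)%N & e < F t n.
  have [x ex] : exists x, e * rnorm x < absK (f (T n x)).
    apply: contrapT => Hn; apply: H; exists n => x; rewrite leNgt.
    by apply/negP => ?; apply: Hn; exists x.
  have xn0 : x != 0.
    apply: contraTneq ex => ->.
    by rewrite (lin0 (TL n)) (lin0 fL) !rnorm0 mulr0 ltxx.
  have nx : 0 < rnorm x.
    by rewrite lt_neqAle rnorm_ge0 andbT eq_sym; apply: contra xn0 => /eqP/rnorm0_eq0 ->.
  have [c [c1 cE]] := rnorm_phase (f (T n x) : K).
  pose y := c *: (r2K (rnorm x)^-1 *: x).
  have y1 : rnorm y <= 1 by rewrite rnormZ rnorm_normalize ?mulr1.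
  exists (l, exist _ y y1) => //; rewrite /F /= /y !(linZ (TL n)) !(linZ fL).
  rewrite -[c *: _]/(c * (_ * _)) mulrCA cE real_partMl of_realK.
  by rewrite mulrC ltr_pdivlMr.
have [t [n [nm _ FtP]]] := gliding_hump e0 F_small F_big.
have e4 : 0 < e / 4 by rewrite divr_gt0.
have [m0 m0P] := powR_dominated (rnorm f) e4 a1.
pose m := m0.+1; have := m0P m (leqnSn _); rewrite powRr1//.
apply/negP; rewrite -ltNge.
apply: (@lt_le_trans _ _ (\sum_(i < m) e / 2)).
  by rewrite sum_const_ord mulrC ltr_pM2l ?ltr0n//; lra.
apply: le_trans (ler_wpM2l (rnorm_ge0 f) (Tsum n (fun i => val (t i).2) m nm
  (fun i => valP (t i).2))).
apply: le_trans (rnorm_dual_apply _ _); apply: le_trans (ler_real_part _).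
rewrite (lin_sum fL) real_part_sum; apply: ler_sum => i _.
by apply: ltW; apply: lt_le_trans (FtP i) _; rewrite /F (linB fL) real_partB.
Qed.

(** By the last hypothesis f is a norm limit of functionals that see only the components N < n. For
    these, reflexivity of the X N gives equality of f (rho psi) and psi f; what remains is a
    functional g of small norm. *)
Lemma reflexive_decomposition E (X : nat -> normedModType K)
    (rhoX : forall N, dual (dual (X N)) -> X N) (CX : R)
    (iota : forall N, X N -> E) (pi : forall N, E -> X N) (C : R)
    (rho : dual (dual E) -> E) (D : R) :
  (forall N, reflexive_with CX (rhoX N)) -> 0 <= C ->
  (forall N, exists C', bounded_linear C' (iota N)) -> (forall N, bounded_linear C (pi N)) ->
  (forall x y, (forall N, pi N x = pi N y) -> x = y) ->
  0 <= D -> bounded_linear D rho ->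
  (forall psi N, pi N (rho psi) = rhoX N (transpose (transpose (pi N)) psi)) ->
  (forall (f : dual E) e, 0 < e ->
     exists n, forall x, absK (f (x - \sum_(N < n) iota N (pi N x))) <= e * rnorm x) ->
  reflexive_with D rho.
Proof.
move=> rX C0 iC piC pi_inj D0 rD pirho shr; split=> //.
  move=> x; apply: pi_inj => N; rewrite pirho.
  have [_ _ evK _] := rX N; rewrite -[RHS]evK; congr (rhoX N _); apply: dual_ext => f.
  rewrite (transposeE _ _ (bounded_linear_transpose C0 (piC N))) !evaluationE.
  by rewrite (transposeE _ _ (piC N)).
move=> psi f; apply/eqP; rewrite -subr_eq0; apply/eqP/rnorm0_eq0/eqP.
rewrite eq_le rnorm_ge0 andbT; apply/ler_addgt0Pr => e e0; rewrite add0r.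
have M0 : 0 < rnorm (rho psi) + rnorm psi + 1.
  by rewrite ltr_wpDl// addr_ge0// rnorm_ge0.
have [n nP] := shr f _ (divr_gt0 e0 M0).
pose g : dual E := f - \sum_(N < n) transpose (pi N) (transpose (iota N) f).
have gE x : g x = f (x - \sum_(N < n) iota N (pi N x)).
  rewrite (linB (dual_linearP f)) (lin_sum (dual_linearP f)).
  rewrite -[LHS]/(f x - (\sum_(N < n) transpose (pi N) (transpose (iota N) f)) x).
  rewrite dual_sumE; congr (_ - _); apply: eq_bigr => N _.
  by have [C' iCN] := iC N; rewrite (transposeE _ _ (piC N)) (transposeE _ _ iCN).
have psiL := dual_linearP psi.
have -> : f (rho psi) - psi f = g (rho psi) - psi g.
  rewrite gE (linB (dual_linearP f)) (linB psiL) (lin_sum (dual_linearP f)) (lin_sum psiL).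
  have -> : \sum_(N < n) f (iota N (pi N (rho psi))) =
      \sum_(N < n) psi (transpose (pi N) (transpose (iota N) f)).
    apply: eq_bigr => N _; rewrite pirho.
    have [_ _ _ /(_ (transpose (transpose (pi N)) psi) (transpose (iota N) f))] := rX N.
    have [C' iCN] := iC N; rewrite (transposeE _ _ iCN) => ->.
    by rewrite (transposeE _ _ (bounded_linear_transpose C0 (piC N))).
  by rewrite opprB addrA subrK.
apply: le_trans (ler_rnormB _ _) _.
have g_le : rnorm g <= e / (rnorm (rho psi) + rnorm psi + 1).
  apply: rnorm_dual_le => [|x]; first by rewrite divr_ge0// ltW.
  by rewrite gE.
have e1 : 0 <= e / (rnorm (rho psi) + rnorm psi + 1) by rewrite divr_ge0 ?ltW.
apply: (@le_trans _ _ (e / (rnorm (rho psi) + rnorm psi + 1) * (rnorm (rho psi) + rnorm psi))).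
  rewrite mulrDr lerD//.
    by apply: le_trans (rnorm_dual_apply _ _) _; rewrite ler_wpM2r ?rnorm_ge0.
  by apply: le_trans (rnorm_dual_apply _ _) _; rewrite mulrC ler_wpM2r ?rnorm_ge0.
by rewrite mulrAC ler_pdivrMr// ler_wpM2l ?(ltW e0)// lerDl.
Qed.

End dual_basics.

(** * Reflexivity of the scalars, of X_{p,w} and of l^p-sums *)

Section reflexive_scalars.
Variables (R : realType) (k : scalar_kind).
Local Notation K := (Defs.scalar R k).

Definition dual_id : dual (K^o : normedModType K) := dual_mk (@id K^o).

Lemma dual_idE z : dual_id z = z.
Proof. by rewrite /dual_id (dual_mkE (bounded_linear_id _)). Qed.

Lemma reflexive_scalars : reflexive_with 1 (E := (K^o : normedModType K))
  (fun psi => psi dual_id : K^o).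
Proof.
split=> //.
- split=> // psi; rewrite mul1r; apply: le_trans (rnorm_dual_apply _ _) _.
  by rewrite ler_piMr ?rnorm_ge0// (rnorm_dual_mk ler01 (bounded_linear_id _)).
- by move=> z; rewrite evaluationE dual_idE.
move=> psi f; have -> : f = f 1 *: dual_id.
  apply: dual_ext => z; rewrite dualZE dual_idE -{1}[z]mulr1.
  by rewrite -[z * 1]/(z *: (1 : K^o)) (linZ (dual_linearP f)) mulrC.
by rewrite (linZ (dual_linearP psi)) dualZE dual_idE.
Qed.

End reflexive_scalars.

Section reflexive_Xpw.
Variables (R : realType) (k : scalar_kind).
Local Notation K := (Defs.scalar R k).
Local Notation absK z := (rnorm (z : K^o)).
Local Notation r2K := (@of_real R k).
Variables (p : R) (p1 : 1 <= p) (p2 : 2 < p) (w : nat -> R).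
Local Notation E := (Xpw k p1 w).
Let p0 : 0 < p. Proof. exact: lt_trans p2. Qed.
Let pm1 : 0 < p - 1. Proof. by rewrite subr_gt0 (lt_trans _ p2)// ltr1n. Qed.

Let pi N (x : E) : (K^o : normedModType K) := coord x N.

Let pi_bounded N : bounded_linear 1 (pi N).
Proof. by split=> // x; rewrite mul1r rnorm_coord. Qed.

Let delta N : dual E := transpose (pi N) (@dual_id R k).

Let deltaE N x : delta N x = coord x N.
Proof. by rewrite /delta (transposeE _ _ (pi_bounded N)) dual_idE. Qed.

(** [dual_sum_le], tested by evaluating psi at combinations of coordinate functionals whose phases
    make all terms nonnegative. It serves both parts of the norm, with (g, r) equal to (1, p) and to
    (|w|, 2). *)
Let bidual_sum (r s : R) (g : nat -> R) (psi : dual (dual E)) n :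
  0 < r -> 0 < s -> r^-1 + s^-1 = 1 -> (forall i, 0 <= g i) ->
  (forall (x : E) n, \sum_(i < n) (g i * absK (coord x i)) `^ r <= rnorm x `^ r) ->
  \sum_(i < n) (g i * absK (psi (delta i))) `^ r <= rnorm psi `^ r.
Proof.
move=> r0 s0 rs g0 gx; have psiL := dual_linearP psi.
apply: (@dual_sum_le _ r s n (fun i => g i * absK (psi (delta i)))) => //.
- exact: rnorm_ge0.
- by move=> i; rewrite mulr_ge0 ?rnorm_ge0.
move=> t T T0 t0 tT.
have /choice[c cP] i := rnorm_phase (psi (delta i) : K).
pose f : dual E := \sum_(i < n) (r2K (t i * g i) * c i) *: delta i.
have f_le : rnorm f <= T.
  apply: rnorm_dual_le => // x; rewrite dual_sumE; apply: le_trans (ler_rnorm_sum _ _) _.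
  apply: (@le_trans _ _ (\sum_(i < n) t i * (g i * absK (coord x i)))).
    apply: ler_sum => i _; rewrite dualZE deltaE !rnormM rnorm_of_real.
    rewrite ger0_norm ?mulr_ge0// -!mulrA !ler_wpM2l//.
    by rewrite ler_piMl ?rnorm_ge0//; have [] := cP i.
  apply: (@hoelder_sum _ s r _ t (fun i => g i * absK (coord x i))) => //.
  - by rewrite addrC.
  - by move=> i; rewrite mulr_ge0 ?rnorm_ge0.
  - exact: rnorm_ge0.
have : absK (psi f) <= rnorm psi * T.
  by apply: le_trans (rnorm_dual_apply _ _) _; rewrite ler_wpM2l ?rnorm_ge0.
apply: le_trans; rewrite /f (lin_sum psiL).
have -> : \sum_(i < n) psi ((r2K (t i * g i) * c i) *: delta i) =
   r2K (\sum_(i < n) t i * (g i * absK (psi (delta i)))).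
  rewrite of_real_sum; apply: eq_bigr => i _; rewrite (linZ psiL).
  have [_ cE] := cP i.
  by rewrite -[LHS]/(r2K (t i * g i) * c i * psi (delta i)) -mulrA cE -of_realM mulrA.
by rewrite rnorm_of_real ler_norm.
Qed.

Let rho (psi : dual (dual E)) : E := Xpw_mk p1 w (fun i => psi (delta i)).

Let rho_bounds (psi : dual (dual E)) :
  (forall n, \sum_(i < n) absK (psi (delta i)) `^ p <= rnorm psi `^ p) /\
  (forall n, \sum_(i < n) w i ^+ 2 * absK (psi (delta i)) ^+ 2 <= rnorm psi ^+ 2).
Proof.
split=> n.
  have := @bidual_sum p (p / (p - 1)) (fun=> 1) psi n.
  under eq_bigr => i _ do rewrite mul1r.
  apply => //; first by rewrite divr_gt0.
    by field; rewrite !gt_eqF.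
  by move=> x m; under eq_bigr => i _ do rewrite mul1r; exact: sum_coord_p.
have wE (z : R) i : 0 <= z -> (`|w i| * z) `^ 2 = w i ^+ 2 * z ^+ 2.
  by move=> z0; rewrite powR_mulrn ?mulr_ge0// exprMn real_normK ?num_real.
have := @bidual_sum 2 2 (fun i => `|w i|) psi n.
under eq_bigr => i _ do rewrite wE ?rnorm_ge0//.
rewrite powR_mulrn ?rnorm_ge0//; apply => //; first by lra.
move=> x m; rewrite powR_mulrn ?rnorm_ge0//.
by under eq_bigr => i _ do rewrite wE ?rnorm_ge0//; exact: sum_coord_2.
Qed.

Let coord_rho (psi : dual (dual E)) i : coord (rho psi) i = psi (delta i).
Proof.
have [hp h2] := rho_bounds psi.
exact: (@coord_Xpw_mk R k p p1 w _ (rnorm psi) i (rnorm_ge0 psi)).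
Qed.

Lemma reflexive_Xpw : exists rho : dual (dual E) -> E, reflexive_with 1 rho.
Proof.
exists rho.
pose iota N (z : (K^o : normedModType K)) : E := (z : K) *: unit_vector k p1 w N.
have iota_linear N : linear (iota N) by move=> a x y; rewrite /iota scalerDl scalerA.
have e_le (f : dual E) e : 0 < e ->
    exists n, forall x, absK (f (x - \sum_(N < n) iota N (pi N x))) <= e * rnorm x.
  (* Windows of m vectors of norm at most 1 add up to norm at most m^(1/2), which for m > 0 is the
     larger of m^(1/p) and m^(1/2). *)
  have half : 2^-1 < 1 :> R by lra.
  have sumT (n : nat -> nat) (x : nat -> E) m : {homo n : i j / (i <= j)%N} ->
      (forall i, rnorm (x i) <= 1) ->
      rnorm (\sum_(i < m) (Xtail (n i) (x i) - Xtail (n i.+1) (x i))) <= m%:R `^ 2^-1.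
    move=> nm x1.
    apply: (@rnorm_sum_Xwindow R k p p1 w n x 1 1 (m%:R `^ 2^-1) m ler01 (powR_ge0 _ _) nm x1).
    - move=> i l; apply: le_trans (sum_coord_2 _ _) _.
      by rewrite expr_le1 ?rnorm_ge0.
    - rewrite powR1 mulr1; case: m => [|m]; first exact: powR_ge0.
      rewrite -powRrM -[leLHS]powRr1// ler_powR ?ler1n//.
      by rewrite mulrC ler_pdivlMr// mul1r ltW.
    - by rewrite mulr1 -powR_mulrn ?powR_ge0// powRV.
  move=> /(shrinking half (@Xtail_linear R k p p1 w) (@Xrestrict_tail R k p p1 w) sumT f)[n nP].
  exists n => x; rewrite -Xrestrict_ltnE (_ : x - _ = Xtail n x)//.
  apply: Xpw_ext => l; rewrite coordB !coord_Xrestrict.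
  by case: ltnP => _; rewrite ?subrr ?subr0.
apply: (@reflexive_decomposition R k E (fun=> K^o) (fun _ psi => psi (@dual_id R k) : K^o) 1
  iota pi 1 rho 1) => //.
- by move=> _; exact: reflexive_scalars.
- move=> N; exists (rnorm (unit_vector k p1 w N)); split=> // z.
  by rewrite /iota rnormZ mulrC.
- by move=> x y xy; apply: Xpw_ext => l; exact: xy.
- split=> [a f g|psi].
    by apply: Xpw_ext => l; rewrite coord_linear !coord_rho.
  have [hp h2] := rho_bounds psi; rewrite mul1r.
  apply/rnorm_XpwP; first exact: rnorm_ge0.
  by split=> n; under eq_bigr => i _ do rewrite coord_rho; [exact: hp|exact: h2].
- move=> psi N; rewrite /pi coord_rho.
  by rewrite (transposeE _ _ (bounded_linear_transpose ler01 (pi_bounded N))).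
Qed.

End reflexive_Xpw.

Section reflexive_lp_sum.
Variables (R : realType) (k : scalar_kind).
Local Notation K := (Defs.scalar R k).
Local Notation absK z := (rnorm (z : K^o)).
Local Notation r2K := (@of_real R k).
Variables (p : R) (p1 : 1 <= p) (pgt1 : 1 < p) (X : nat -> normedModType K).
Local Notation E := (lp_sum p1 X).
Let p0 : 0 < p. Proof. exact: lt_trans pgt1. Qed.
Let pm1 : 0 < p - 1. Proof. by rewrite subr_gt0. Qed.

Let pi N (x : E) : X N := comp x N.

Let pi_bounded N : bounded_linear 1 (pi N).
Proof. by split=> // x; rewrite mul1r rnorm_comp. Qed.

Variables (C : R) (rhoX : forall N, dual (dual (X N)) -> X N).
Hypothesis rX : forall N, reflexive_with C (@rhoX N).

Let C0 : 0 <= C. Proof. by have [] := rX 0. Qed.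

Let bicomp (psi : dual (dual E)) N : dual (dual (X N)) := transpose (transpose (pi N)) psi.

Let bicompE (psi : dual (dual E)) N f : bicomp psi N f = psi (transpose (pi N) f).
Proof. by rewrite /bicomp (transposeE _ _ (bounded_linear_transpose ler01 (pi_bounded N))). Qed.

(** The duality argument of [bidual_sum], with functionals nearly norming the components of psi in
    place of the coordinate functionals; they cause the factor 2. *)
Let bicomp_sum (psi : dual (dual E)) n :
  \sum_(i < n) rnorm (bicomp psi i) `^ p <= (2 * rnorm psi) `^ p.
Proof.
have psiL := dual_linearP psi.
have /choice[r rP] i : exists r : R, exists f : dual (X i),
    [/\ rnorm f <= 1, bicomp psi i f = r2K r & rnorm (bicomp psi i) <= 2 * r].
  by have [f [f1 [r [fr le]]]] := dual_near_norming (bicomp psi i); exists r, f.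
have r0 i : 0 <= r i.
  have [f [_ _ le]] := rP i; have := le_trans (rnorm_ge0 _) le.
  by rewrite pmulr_rge0.
apply: (@le_trans _ _ (\sum_(i < n) 2 `^ p * r i `^ p)).
  apply: ler_sum => i _; rewrite -powRM// ler_powR2r ?rnorm_ge0 ?mulr_ge0//.
  by have [f []] := rP i.
rewrite -mulr_sumr powRM ?rnorm_ge0// ler_wpM2l ?powR_ge0//.
apply: (@dual_sum_le _ p (p / (p - 1)) n r) => //.
- by rewrite divr_gt0.
- by field; rewrite !gt_eqF.
- exact: rnorm_ge0.
move=> t T T0 t0 tT.
pose fs i := proj1_sig (cid (rP i)).
have fsP i := proj2_sig (cid (rP i)).
pose F : dual E := \sum_(i < n) r2K (t i) *: transpose (pi i) (fs i).
have F_le : rnorm F <= T.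
  apply: rnorm_dual_le => // x; rewrite dual_sumE; apply: le_trans (ler_rnorm_sum _ _) _.
  apply: (@le_trans _ _ (\sum_(i < n) t i * rnorm (comp x i))).
    apply: ler_sum => i _; rewrite dualZE (transposeE _ _ (pi_bounded i)).
    rewrite rnormM rnorm_of_real ger0_norm// ler_wpM2l//.
    apply: le_trans (rnorm_dual_apply _ _) _; rewrite ler_piMl ?rnorm_ge0//.
    by have [] := fsP i.
  apply: (@hoelder_sum _ (p / (p - 1)) p _ t (fun i => rnorm (comp x i))) => //.
  - by rewrite divr_gt0.
  - by field; rewrite !gt_eqF.
  - by move=> i; exact: rnorm_ge0.
  - exact: rnorm_ge0.
  - exact: sum_rnorm_comp.
have : absK (psi F) <= rnorm psi * T.
  by apply: le_trans (rnorm_dual_apply _ _) _; rewrite ler_wpM2l ?rnorm_ge0.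
apply: le_trans; rewrite /F (lin_sum psiL).
have -> : \sum_(i < n) psi (r2K (t i) *: transpose (pi i) (fs i)) =
   r2K (\sum_(i < n) t i * r i).
  rewrite of_real_sum; apply: eq_bigr => i _; rewrite (linZ psiL) -bicompE.
  have [_ -> _] := fsP i.
  by rewrite of_realM.
by rewrite rnorm_of_real ler_norm.
Qed.

Let rho (psi : dual (dual E)) : E := lp_mk p1 (fun N => rhoX (bicomp psi N)).

Let rho_bound (psi : dual (dual E)) n :
  \sum_(i < n) rnorm (rhoX (bicomp psi i)) `^ p <= (C * (2 * rnorm psi)) `^ p.
Proof.
rewrite powRM ?mulr_ge0 ?rnorm_ge0//.
apply: le_trans (ler_wpM2l (powR_ge0 C p) (bicomp_sum psi n)).
rewrite mulr_sumr; apply: ler_sum => i _; rewrite -powRM ?rnorm_ge0//.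
rewrite ler_powR2r ?mulr_ge0 ?rnorm_ge0//.
by have [_ [_ rC] _ _] := rX i; exact: rC.
Qed.

Let comp_rho (psi : dual (dual E)) N : comp (rho psi) N = rhoX (bicomp psi N).
Proof.
apply: (@comp_lp_mk R k p p1 X _ (C * (2 * rnorm psi)) N).
  by rewrite !mulr_ge0 ?rnorm_ge0.
exact: rho_bound.
Qed.

Lemma reflexive_lp_sum : exists rho : dual (dual E) -> E, reflexive_with (C * 2) rho.
Proof.
exists rho; have C20 : 0 <= C * 2 by rewrite mulr_ge0.
have e_le (f : dual E) e : 0 < e ->
    exists n, forall x, absK (f (x - \sum_(N < n) single p1 (comp x N))) <= e * rnorm x.
  have pV1 : p^-1 < 1 by rewrite invf_lt1.
  have sumT (n : nat -> nat) (x : nat -> E) m : {homo n : i j / (i <= j)%N} ->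
      (forall i, rnorm (x i) <= 1) ->
      rnorm (\sum_(i < m) (tail (n i) (x i) - tail (n i.+1) (x i))) <= m%:R `^ p^-1.
    move=> nm x1; rewrite -[leRHS]mulr1.
    exact: (rnorm_sum_window m ler01 nm x1).
  move=> /(shrinking pV1 (@tail_linear R k p p1 X) (@restrict_tail R k p p1 X) sumT f)[n nP].
  exists n => x; rewrite -restrict_ltnE (_ : x - _ = tail n x)//.
  apply: lp_ext => l; rewrite compB !comp_restrict.
  by case: ltnP => _; rewrite ?subrr ?subr0.
apply: (@reflexive_decomposition R k E X rhoX C (fun N => single p1 (n := N)) pi 1 rho
  (C * 2)) => //.
- move=> N; exists 1; split=> [|x]; first exact: single_linear.
  by rewrite rnorm_single mul1r.
- by move=> x y xy; apply: lp_ext => l; exact: xy.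
- split=> [a f g|psi].
    apply: lp_ext => l; rewrite comp_linear !comp_rho.
    have [_ [rL _] _ _] := rX l; rewrite -rL; congr (rhoX _).
    by apply: dual_ext => h; rewrite dual_combE !bicompE.
  rewrite -mulrA; apply/rnorm_lpP => [|n]; first by rewrite !mulr_ge0 ?rnorm_ge0.
  by under eq_bigr => i _ do rewrite comp_rho; exact: rho_bound.
Qed.

End reflexive_lp_sum.

Lemma reflexive_lp_sum_Xpw (R : realType) (k : scalar_kind) (p : R) (p1 : 1 <= p)
    (W : nat -> nat -> R) : 2 < p ->
  exists C (rho : dual (dual (lp_sum p1 (fun N => Xpw k p1 (W N)))) -> _), reflexive_with C rho.
Proof.
move=> p2; have pgt1 : 1 < p by rewrite (lt_trans _ p2)// ltr1n.
pose rhoX N := proj1_sig (cid (reflexive_Xpw k p1 p2 (W N))).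
have rX N : reflexive_with 1 (rhoX N) := proj2_sig (cid (reflexive_Xpw k p1 p2 (W N))).
by have [rho rP] := reflexive_lp_sum p1 pgt1 rX; exists (1 * 2), rho.
Qed.

(** * Absolutely convergent scalar series *)

Section absolute_sums.
Variables (R : realType) (k : scalar_kind).
Local Notation K := (Defs.scalar R k).
Local Notation absK z := (rnorm (z : K^o)).

Definition is_sum (a : nat -> K) (s : K) := forall e : R, 0 < e ->
  exists n0, forall n, (n0 <= n)%N -> absK (s - \sum_(i < n) a i) <= e.

Lemma absolute_sum_real (a : nat -> R) D : (forall n, \sum_(i < n) `|a i| <= D) ->
  exists s, forall e, 0 < e ->
  exists n0, forall n, (n0 <= n)%N -> `|s - \sum_(i < n) a i| <= e.
Proof.
move=> aD; have : cvgn [normed series a].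
  apply: nondecreasing_is_cvgn.
    by apply: nondecreasing_series => n _ _; exact: normr_ge0.
  by exists D => _ [n _ <-]; rewrite /normed_series_of seriesEord; exact: aD.
move=> /normed_cvg/cvg_ex[s /cvgrPdist_le sP]; exists s => e e0.
have [n0 _ n0P] := sP _ e0; exists n0 => n n0n.
by have := n0P n n0n; rewrite seriesEord.
Qed.

Lemma absolute_sum (a : nat -> K) D : (forall n, \sum_(i < n) absK (a i) <= D) ->
  exists s, is_sum a s.
Proof.
rewrite /is_sum; case: k a => [a aD|a aD]; first exact: absolute_sum_real aD.
have abs_re (z : R[i]) : `|complex.Re z| <= rnorm (z : (Defs.scalar R complex_scalars)^o).
  case: z => x y; rewrite rnorm_complex -sqrtr_sqr.
  by rewrite ler_wsqrtr// lerDl sqr_ge0.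
have abs_im (z : R[i]) : `|complex.Im z| <= rnorm (z : (Defs.scalar R complex_scalars)^o).
  case: z => x y; rewrite rnorm_complex -sqrtr_sqr.
  by rewrite ler_wsqrtr// lerDr sqr_ge0.
have abs_le (x y : R) : rnorm ((x +i* y)%C : (Defs.scalar R complex_scalars)^o) <= `|x| + `|y|.
  rewrite rnorm_complex -[leRHS]ger0_norm ?addr_ge0// -sqrtr_sqr ler_wsqrtr//.
  by rewrite sqrrD !real_normK ?num_real// lerD2r lerDl mulrn_wge0 ?mulr_ge0.
have [|x xP] := @absolute_sum_real (fun i => complex.Re (a i)) D.
  by move=> n; apply: le_trans (aD n); apply: ler_sum => i _; exact: abs_re.
have [|y yP] := @absolute_sum_real (fun i => complex.Im (a i)) D.
  by move=> n; apply: le_trans (aD n); apply: ler_sum => i _; exact: abs_im.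
exists (x +i* y)%C => e e0.
have e2 : 0 < e / 2 by rewrite divr_gt0.
have [n0 n0P] := xP _ e2; have [n1 n1P] := yP _ e2.
exists (maxn n0 n1) => n; rewrite geq_max => /andP[/n0P h0 /n1P h1].
have -> : (x +i* y)%C - \sum_(i < n) a i =
    ((x - \sum_(i < n) complex.Re (a i)) +i* (y - \sum_(i < n) complex.Im (a i)))%C :> R[i].
  rewrite -[RHS]/((x +i* y)%C -
    ((\sum_(i < n) complex.Re (a i)) +i* (\sum_(i < n) complex.Im (a i)))%C).
  congr (_ - _); elim/big_rec3 : _ => // i u v z _ ->.
  by case: (a i).
by apply: le_trans (abs_le _ _) _; lra.
Qed.

Lemma is_sum_unique (a : nat -> K) s t : is_sum a s -> is_sum a t -> s = t.
Proof.
move=> sP tP; apply/eqP; rewrite -subr_eq0; apply/eqP/(@rnorm0_eq0 R k K^o)/eqP.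
rewrite eq_le rnorm_ge0 andbT; apply/ler_addgt0Pr => e e0; rewrite add0r.
have e2 : 0 < e / 2 by rewrite divr_gt0.
have [n0 n0P] := sP _ e2; have [n1 n1P] := tP _ e2.
have := n0P _ (leq_maxl n0 n1); have := n1P _ (leq_maxr n0 n1).
set S := \sum_(i < _) _ => h1 h0.
have -> : s - t = (s - S) - (t - S) :> K^o by rewrite opprB addrA subrK.
by apply: le_trans (ler_rnormB _ _) _; lra.
Qed.

Lemma is_sum_linear (a b : nat -> K) (c s t : K) : is_sum a s -> is_sum b t ->
  is_sum (fun i => c * a i + b i) (c * s + t).
Proof.
move=> sP tP e e0.
have c1 : 0 < 1 + absK c by rewrite ltr_pwDl// rnorm_ge0.
have e2 : 0 < e / 2 by rewrite divr_gt0.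
have [n0 n0P] := sP _ (divr_gt0 e2 c1); have [n1 n1P] := tP _ e2.
exists (maxn n0 n1) => n; rewrite geq_max => /andP[/n0P h0 /n1P h1].
rewrite big_split /= -mulr_sumr opprD addrACA -mulrBr.
apply: le_trans (ler_rnormD (_ : K^o) _) _; rewrite rnormM.
move: h0; rewrite ler_pdivlMr// => h0.
have : absK c * absK (s - \sum_(i < n) a i) <= absK (s - \sum_(i < n) a i) * (1 + absK c).
  by rewrite mulrC ler_wpM2l ?rnorm_ge0// lerDr.
lra.
Qed.

Lemma is_sum_le (a : nat -> K) s D : is_sum a s -> (forall n, \sum_(i < n) absK (a i) <= D) ->
  absK s <= D.
Proof.
move=> sP aD; apply/ler_addgt0Pr => e e0; have [n nP] := sP _ e0.
rewrite -[s](subrK (\sum_(i < n) a i)) addrC.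
apply: le_trans (ler_rnormD (_ : K^o) _) _; rewrite lerD ?nP//.
by apply: le_trans (aD n); exact: ler_rnorm_sum.
Qed.

Lemma is_sum_single (a : nat -> K) n : (forall i, i != n -> a i = 0) -> is_sum a (a n).
Proof.
move=> an e e0; exists n.+1 => m nm.
rewrite (bigD1 (Ordinal nm))//= big1 ?addr0 ?subrr ?rnorm0 ?ltW// => i ni.
by apply: an; apply: contra ni => /eqP e'; apply/eqP/val_inj.
Qed.

(* Junk value: 0 if the series diverges. *)
Definition abs_sum (a : nat -> K) : K :=
  if pselect (exists s, is_sum a s) is left e then proj1_sig (cid e) else 0.

Lemma abs_sumP (a : nat -> K) D : (forall n, \sum_(i < n) absK (a i) <= D) ->
  is_sum a (abs_sum a).
Proof.
move=> /absolute_sum aS; rewrite /abs_sum; case: pselect => // e.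
exact: proj2_sig (cid e).
Qed.

End absolute_sums.

(** * The dual of an l^p-sum as the l^q-sum of the duals *)

Section dual_lp_sum.
Variables (R : realType) (k : scalar_kind).
Local Notation K := (Defs.scalar R k).
Local Notation absK z := (rnorm (z : K^o)).
Local Notation r2K := (@of_real R k).
Variables (p q : R) (p1 : 1 <= p) (q1 : 1 <= q) (pq : p^-1 + q^-1 = 1).
Variable X : nat -> normedModType K.
Local Notation E := (lp_sum p1 X).
Local Notation G := (lp_sum q1 (fun N => dual (X N))).
Let p0 : 0 < p. Proof. exact: lt_le_trans p1. Qed.
Let q0 : 0 < q. Proof. exact: lt_le_trans q1. Qed.

Let pairing (y : G) (x : E) : K^o := abs_sum (fun N => comp y N (comp x N) : K).

Let pairing_sum (y : G) (x : E) n :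
  \sum_(i < n) absK (comp y i (comp x i)) <= rnorm y * rnorm x.
Proof.
apply: (@le_trans _ _ (\sum_(i < n) rnorm (comp y i) * rnorm (comp x i))).
  by apply: ler_sum => i _; exact: rnorm_dual_apply.
apply: (@hoelder_sum _ q p _ (fun i => rnorm (comp y i)) (fun i => rnorm (comp x i))) => //.
- by rewrite addrC.
- by move=> i; exact: rnorm_ge0.
- by move=> i; exact: rnorm_ge0.
- exact: rnorm_ge0.
- exact: rnorm_ge0.
- exact: sum_rnorm_comp.
- exact: sum_rnorm_comp.
Qed.

Let pairingP (y : G) (x : E) : is_sum (fun N => comp y N (comp x N) : K) (pairing y x).
Proof. exact: abs_sumP (pairing_sum y x). Qed.

Let pairing_bounded (y : G) : bounded_linear (rnorm y) (pairing y).
Proof.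
split=> [a x x'|x]; last exact: is_sum_le (pairingP y x) (pairing_sum y x).
apply: is_sum_unique (pairingP _ _) _.
have := is_sum_linear (a : K) (pairingP y x) (pairingP y x'); congr is_sum.
by apply: funext => N; rewrite comp_linear (dual_linearP (comp y N)).
Qed.

Let to_dual (y : G) : dual E := dual_mk (pairing y).

Let to_dualE (y : G) (x : E) : to_dual y x = pairing y x.
Proof. exact: dual_mkE (pairing_bounded y) x. Qed.

Let to_dual_bounded : bounded_linear 1 to_dual.
Proof.
split=> [a y y'|y].
  apply: dual_ext => x; rewrite dual_combE !to_dualE.
  apply: is_sum_unique (pairingP _ _) _.
  have := is_sum_linear (a : K) (pairingP y x) (pairingP y' x); congr is_sum.
by rewrite mul1r; apply: rnorm_dual_mk (rnorm_ge0 y) (pairing_bounded y).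
Qed.

Let restr (f : dual E) N : dual (X N) := transpose (single p1 (n := N)) f.

Let restrE (f : dual E) N z : restr f N z = f (single p1 z).
Proof. by rewrite /restr (transposeE _ _ (bounded_linear_single p1 X N)). Qed.

(** [dual_sum_le], tested by evaluating f at the vector with components t i z i, where z i nearly
    norms the restriction of f to X i; by disjointness its norm is at most T. *)
Let restr_sum (f : dual E) n : \sum_(i < n) rnorm (restr f i) `^ q <= (2 * rnorm f) `^ q.
Proof.
have fL := dual_linearP f.
have /choice[r rP] i : exists r : R, exists z : X i,
    [/\ rnorm z <= 1, restr f i z = r2K r & rnorm (restr f i) <= 2 * r].
  by have [z [z1 [r [zr le]]]] := dual_near_norming (restr f i); exists r, z.
have r0 i : 0 <= r i.
  have [z [_ _ le]] := rP i; have := le_trans (rnorm_ge0 _) le.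
  by rewrite pmulr_rge0.
apply: (@le_trans _ _ (\sum_(i < n) 2 `^ q * r i `^ q)).
  apply: ler_sum => i _; rewrite -powRM// ler_powR2r ?rnorm_ge0 ?mulr_ge0//.
  by have [z []] := rP i.
rewrite -mulr_sumr powRM ?rnorm_ge0// ler_wpM2l ?powR_ge0//.
apply: (@dual_sum_le _ q p n r) => //.
- by rewrite addrC.
- exact: rnorm_ge0.
move=> t T T0 t0 tT.
pose z i := proj1_sig (cid (rP i)).
have zP i := proj2_sig (cid (rP i)).
pose x : E := \sum_(i < n) r2K (t i) *: single p1 (z i).
have x_le : rnorm x <= T.
  apply/rnorm_lpP => // m; apply: le_trans tT.
  apply: (@le_trans _ _ (\sum_(j < m) \sum_(i < n) (if i == j :> nat then t i `^ p else 0))).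
    apply: ler_sum => j _; rewrite /x comp_sum.
    apply: le_trans (@sum_ord_disjoint _ _ (fun u : X j => rnorm u `^ p) n
      (fun i => comp (r2K (t i) *: single p1 (z i)) j) _ _ _) _.
    - by rewrite rnorm0 powR0// gt_eqF.
    - by move=> u; exact: powR_ge0.
    - move=> i i' _ _; rewrite !compZ.
      have [->|ij] := eqVneq i j; last by rewrite comp_single_neq// scaler0.
      by have [->//|i'j] := eqVneq i' j; rewrite (comp_single_neq _ _ i'j) scaler0.
    apply: ler_sum => i _; rewrite compZ.
    have [ij|ij] := eqVneq (i : nat) j; last first.
      by rewrite comp_single_neq// scaler0 rnorm0 powR0// gt_eqF.
    rewrite rnormZ rnorm_of_real ger0_norm// ler_powR2r ?mulr_ge0 ?rnorm_ge0//.
    rewrite ler_piMr//; apply: le_trans (rnorm_comp _ _) _; rewrite rnorm_single.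
    by have [] := zP i.
  rewrite exchange_big /=; apply: ler_sum => i _.
  by apply: sum_at_most_one => [|j j' /eqP<- /eqP<-//]; exact: powR_ge0.
have : absK (f x) <= rnorm f * T.
  by apply: le_trans (rnorm_dual_apply _ _) _; rewrite ler_wpM2l ?rnorm_ge0.
apply: le_trans; rewrite /x (lin_sum fL).
have -> : \sum_(i < n) f (r2K (t i) *: single p1 (z i)) = r2K (\sum_(i < n) t i * r i).
  rewrite of_real_sum; apply: eq_bigr => i _; rewrite (linZ fL) -restrE.
  have [_ -> _] := zP i.
  by rewrite of_realM.
by rewrite rnorm_of_real ler_norm.
Qed.

Let of_dual (f : dual E) : G := lp_mk q1 (restr f).

Let comp_of_dual (f : dual E) N : comp (of_dual f) N = restr f N.
Proof.
apply: (@comp_lp_mk R k q q1 (fun N => dual (X N)) _ (2 * rnorm f) N).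
  by rewrite mulr_ge0 ?rnorm_ge0.
exact: restr_sum.
Qed.

Let of_dual_bounded : bounded_linear 2 of_dual.
Proof.
split=> [a f g|f].
  apply: lp_ext => N; transitivity (restr (a *: f + g) N); first exact: comp_of_dual.
  transitivity (a *: restr f N + restr g N); last first.
    by rewrite comp_linear; congr (_ *: _ + _); symmetry; exact: comp_of_dual.
  by apply: dual_ext => z; rewrite dual_combE !restrE.
apply/rnorm_lpP => [|n]; first by rewrite mulr_ge0 ?rnorm_ge0.
by under eq_bigr => i _ do rewrite comp_of_dual; exact: restr_sum.
Qed.

Lemma factors_lp_dual : factors G (dual E).
Proof.
apply: (factorsI ler01 (ler0n _ 2) to_dual_bounded of_dual_bounded) => y.
apply: lp_ext => N; rewrite comp_of_dual; apply: dual_ext => z.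
rewrite restrE to_dualE; apply: is_sum_unique (pairingP _ _) _.
have := @is_sum_single R k (fun i => comp y i (comp (single p1 z) i)) N.
rewrite comp_single; apply => i iN.
by rewrite comp_single_neq 1?eq_sym// (lin0 (dual_linearP _)).
Qed.

(** With [factors_lp_dual] this makes [to_dual] and [of_dual] mutually inverse. The finite sections
    of x converge to x in norm, so f x is the sum of the values of f on the components. *)
Lemma factors_dual_lp : factors (dual E) G.
Proof.
apply: (factorsI (ler0n _ 2) ler01 of_dual_bounded to_dual_bounded) => f.
apply: dual_ext => x; rewrite to_dualE; apply: is_sum_unique (pairingP _ _) _ => e e0.
have fL := dual_linearP f.
have f1 : 0 < 1 + rnorm f by rewrite ltr_pwDl// rnorm_ge0.
have [n0 n0P] := restrict_tail x (divr_gt0 e0 f1).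
exists n0 => n /n0P; rewrite ltr_pdivlMr// => /ltW; apply: le_trans.
have -> : \sum_(i < n) comp (of_dual f) i (comp x i) = f (\sum_(i < n) single p1 (comp x i)).
  by rewrite (lin_sum fL); apply: eq_bigr => i _; rewrite comp_of_dual restrE.
rewrite -restrict_ltnE -[f x - _]/((f x : K^o) - _) -(linB fL).
apply: le_trans (rnorm_dual_apply _ _) _; rewrite mulrC.
have -> : x - restrict (fun i => (i < n)%N) x = restrict (fun i => (n <= i)%N) x.
  apply: lp_ext => l; rewrite compB !comp_restrict.
  by case: ltnP => _; rewrite ?subrr ?subr0.
by rewrite ler_wpM2l ?rnorm_ge0// lerDr.
Qed.

End dual_lp_sum.

Section dual_identifications.
Variables (R : realType) (k : scalar_kind).
Local Notation K := (Defs.scalar R k).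

Lemma factors_scalars_dual : factors (K^o : normedModType K) (dual (K^o : normedModType K)).
Proof.
apply: (@factorsI R k _ _ 1 1 (fun z : K^o => (z : K) *: @dual_id R k)
  (fun f : dual (K^o : normedModType K) => f 1 : K^o)) => //.
- split=> [a x y|z]; first by rewrite scalerDl scalerA.
  rewrite rnormZ mul1r ler_piMr ?rnorm_ge0//.
  exact: rnorm_dual_mk ler01 (bounded_linear_id _).
- split=> // f; apply: le_trans (rnorm_dual_apply _ _) _.
  by rewrite mulrC -(of_real1 R k) rnorm_of_real normr1.
- by move=> z; rewrite dualZE dual_idE mulr1.
Qed.

(** [ell2] is itself an l^2-sum of copies of the scalars, so the duality of l^p-sums applies with p
    = q = 2. *)
Lemma factors_ell2_dual : factors (ell2 R k) (dual (ell2 R k)).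
Proof.
apply: factors_trans (factors_lp_sum (ler1n R 2) factors_scalars_dual) _.
by apply: factors_lp_dual; lra.
Qed.

Lemma factors_direct_sum_dual (E F : normedModType K) :
  factors (direct_sum (dual E) (dual F)) (dual (direct_sum E F)).
Proof.
pose B (h : dual (direct_sum E F)) : direct_sum (dual E) (dual F) :=
  (transpose (fun x => (x, 0) : direct_sum E F) h, transpose (fun y => (0, y) : direct_sum E F) h).
pose A (f : direct_sum (dual E) (dual F)) : dual (direct_sum E F) :=
  transpose (fst : direct_sum E F -> E) f.1 + transpose (snd : direct_sum E F -> F) f.2.
have iE := bounded_linear_pair (bounded_linear_id E) (bounded_linear_zero E F ler01).
have iF := bounded_linear_pair (bounded_linear_zero F E ler01) (bounded_linear_id F).
have fstC := bounded_linear_fst E F; have sndC := bounded_linear_snd E F.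
apply: (@factorsI R k _ _ 2 1 A B) => //.
- have [L1 C1] := bounded_linear_transpose ler01 fstC.
  have [L2 C2] := bounded_linear_transpose ler01 sndC.
  split=> [a x y|[f g]]; first by rewrite /A L1 L2 scalerDr addrACA.
  apply: le_trans (ler_rnormD _ _) _; rewrite (_ : 2 = 1 + 1)// mulrDl mul1r lerD//=.
    by apply: le_trans (C1 _) _; rewrite mul1r rnorm_pair le_max lexx.
  by apply: le_trans (C2 _) _; rewrite mul1r rnorm_pair le_max lexx orbT.
- exact: bounded_linear_pair (bounded_linear_transpose ler01 iE)
    (bounded_linear_transpose ler01 iF).
move=> [f g]; congr pair; apply: dual_ext => x.
  rewrite (transposeE _ _ iE) /A dualDE (transposeE _ _ fstC) (transposeE _ _ sndC) /=.
  by rewrite (lin0 (dual_linearP g)) addr0.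
rewrite (transposeE _ _ iF) /A dualDE (transposeE _ _ fstC) (transposeE _ _ sndC) /=.
by rewrite (lin0 (dual_linearP f)) add0r.
Qed.

End dual_identifications.

(** * The two ranges of exponents *)

Section upper_exponent_gt2.
Variables (R : realType) (k : scalar_kind).
Variables (p : R) (p1 : 1 <= p) (p2 : 2 < p).
Variables (w : nat -> R) (w0 : forall n, 0 < w n) (wstar : condition_star p w).
Local Notation Ysum W := (lp_sum p1 (fun N => Xpw k p1 (W N))).
Local Notation S := (lp_sum p1 (fun=> ell2 R k)).
Local Notation X := (Xpw k p1 w).
Local Notation B := (Bp k p1).

Definition ell2_weights : nat -> nat -> R := fun _ _ => 1.
Definition Bp_weights : nat -> nat -> R := fun N _ => v_weight p N.+1.
(** Index 0 is reserved for the summand handled by [zeroth_pairing]; the weights W move to the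
    indices N >= 1. *)
Definition cons_weights (w : nat -> R) (W : nat -> nat -> R) N : nat -> R :=
  if N is M.+1 then W M else w.

Lemma factors_cons_weights W :
  factors (direct_sum (Ysum W) X) (Ysum (cons_weights w W)).
Proof. exact: factors_lp_cons (fun N => Xpw k p1 (cons_weights w W N)). Qed.

Lemma factors_S : factors S (Ysum ell2_weights).
Proof. exact: factors_lp_power_ell2. Qed.

Lemma factors_S_X : factors (direct_sum S X) (Ysum (cons_weights w ell2_weights)).
Proof.
exact: factors_trans (factors_pair factors_S (factors_refl X)) (factors_cons_weights _).
Qed.

Lemma not_factors_X_S : ~ factors X (Ysum ell2_weights).
Proof. exact: (@not_factors_Xpw R k p p1 p2 w w0 wstar _ (fun=> 1)). Qed.

Lemma not_factors_B_S_X : ~ factors B (Ysum (cons_weights w ell2_weights)).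
Proof. by apply: not_factors_Bp => // -[|N]. Qed.

Lemma not_factors_X_B : ~ factors X B.
Proof.
by apply: (@not_factors_Xpw R k p p1 p2 w w0 wstar Bp_weights (fun N => v_weight p N.+1)) => // N;
  exact: v_weight_gt0.
Qed.

Lemma not_factors_lpX_B_X :
  ~ factors (lp_sum p1 (fun=> X)) (Ysum (cons_weights w Bp_weights)).
Proof.
apply: (@not_factors_lp_Xpw R k p p1 p2 w w0 wstar _ (v_weight p)) => [[|N]|[|N]] //.
by move=> _; exact: v_weight_gt0.
Qed.

End upper_exponent_gt2.

Lemma factors_undual (R : realType) (k : scalar_kind) (E F : normedModType (Defs.scalar R k))
    C D (rhoE : dual (dual E) -> E) (rhoF : dual (dual F) -> F) :
  reflexive_with C rhoE -> reflexive_with D rhoF -> factors (dual E) (dual F) -> factors E F.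
Proof.
move=> rE rF /factors_dual EF.
exact: factors_trans (factors_bidual rE) (factors_trans EF (factors_of_bidual rF)).
Qed.

Section upper_exponent_lt2.
Variables (R : realType) (k : scalar_kind) (p : R) (p1 : 1 < p) (p2 : p < 2).
Local Notation r := (conjugate_exponent p).
Local Notation r1 := (conjugate_exponent_ge1 p1).
Variables (w : nat -> R) (w0 : forall n, 0 < w n) (wstar : condition_star r w).
Local Notation Ysum W := (lp_sum r1 (fun N => Xpw k r1 (W N))).
Local Notation S := (lp_sum (ltW p1) (fun=> ell2 R k)).
Local Notation S' := (lp_sum r1 (fun=> ell2 R k)).
Local Notation X := (Xpw k r1 w).
Local Notation B := (Bp k r1).

Let r2 : 2 < r.
Proof. by rewrite /conjugate_exponent ltr_pdivlMr ?subr_gt0//; move: p2; lra. Qed.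

Let rp : r^-1 + p^-1 = 1.
Proof.
have p0 : p != 0 by rewrite gt_eqF// (lt_trans _ p1).
have pm1 : p - 1 != 0 by rewrite gt_eqF// subr_gt0.
by rewrite /conjugate_exponent; field; rewrite p0 pm1.
Qed.

Let factors_S_dual : factors S (dual S').
Proof.
apply: factors_trans (factors_lp_sum (ltW p1) (factors_ell2_dual R k)) _.
exact: factors_lp_dual.
Qed.

Let undual_Ysum (V W : nat -> nat -> R) :
  factors (dual (Ysum V)) (dual (Ysum W)) -> factors (Ysum V) (Ysum W).
Proof.
have [C [rho rhoP]] := reflexive_lp_sum_Xpw k r1 V r2.
have [D [sigma sigmaP]] := reflexive_lp_sum_Xpw k r1 W r2.
exact: factors_undual rhoP sigmaP.
Qed.

Let undual_X (W : nat -> nat -> R) : factors (dual X) (dual (Ysum W)) -> factors X (Ysum W).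
Proof.
have [rho rhoP] := reflexive_Xpw k r1 r2 w.
have [D [sigma sigmaP]] := reflexive_lp_sum_Xpw k r1 W r2.
exact: factors_undual rhoP sigmaP.
Qed.

Lemma dual_not_factors_X_S : ~ factors (dual X) S.
Proof.
move=> /factors_trans/(_ factors_S_dual)/factors_trans.
move=> /(_ _ (factors_dual (factors_S k r1 r2)))/undual_X.
exact: not_factors_X_S.
Qed.

Lemma dual_not_factors_B_S_X : ~ factors (dual B) (direct_sum S (dual X)).
Proof.
move=> /factors_trans/(_ (factors_pair factors_S_dual (factors_refl (dual X))))/factors_trans.
move=> /(_ _ (factors_direct_sum_dual S' X))/factors_trans.
move=> /(_ _ (factors_dual (factors_S_X k r1 r2 w)))/(@undual_Ysum (Bp_weights r)).
exact: not_factors_B_S_X.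
Qed.

Lemma dual_not_factors_X_B : ~ factors (dual X) (dual B).
Proof. by move=> /(@undual_X (Bp_weights r)); exact: not_factors_X_B. Qed.

(** Here the source is rewritten as well: by [factors_dual_lp] the dual of the l^r-sum of copies of
    X, with r conjugate to p, factors through the l^p-sum of copies of dual X. *)
Lemma dual_not_factors_lpX_B_X :
  ~ factors (lp_sum (ltW p1) (fun=> dual X)) (direct_sum (dual B) (dual X)).
Proof.
move=> /(factors_trans (factors_dual_lp r1 (ltW p1) rp (fun=> X)))/factors_trans.
move=> /(_ _ (factors_direct_sum_dual B X))/factors_trans.
move=> /(_ _ (factors_dual (factors_cons_weights k r1 w (Bp_weights r)))).
move=> /(@undual_Ysum (fun=> w)).
exact: not_factors_lpX_B_X.
Qed.

End upper_exponent_lt2.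

(** Four non-factorizations suffice. The sources in (b), (d), (e) contain X as a direct summand and
    the source in (f) contains B, while (a) would imply (c) because S is a direct summand of its
    target. *)
Lemma no_complemented_embeddings (R : realType) (k : scalar_kind)
    (S X B XX : normedModType (Defs.scalar R k)) :
  ~ factors X S -> ~ factors B (direct_sum S X) -> ~ factors X B ->
  ~ factors XX (direct_sum B X) ->
  ~ complemented_embedding B S /\
  ~ complemented_embedding (direct_sum S X) S /\
  ~ complemented_embedding B (direct_sum S X) /\
  ~ complemented_embedding (direct_sum S X) B /\
  ~ complemented_embedding (direct_sum B X) B /\
  ~ complemented_embedding (direct_sum B X) (direct_sum S X) /\
  ~ complemented_embedding XX (direct_sum B X).
Proof.
move=> XS BSX XB XXBX; do !split; move=> /complemented_embedding_factors.
- by move=> /factors_trans/(_ (factors_inl S X)).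
- by move=> /(factors_trans (factors_inr S X)).
- by [].
- by move=> /(factors_trans (factors_inr S X)).
- by move=> /(factors_trans (factors_inr B X)).
- by move=> /(factors_trans (factors_inl B X)).
- by [].
Qed.

Theorem proposition2p49 (R : realType) (k : scalar_kind) (p : R)
    (p1 : 1 < p) (p2 : p != 2) (w : nat -> R) (w_gt0 : forall n, 0 < w n)
    (w_star : condition_star (upper_exponent p) w) :
  let l2p := lp_power p1 (ell2 R k) in
  let X := X_space k p1 w in
  let B := B_space k p1 in
  ~ complemented_embedding B l2p /\
  ~ complemented_embedding (direct_sum l2p X) l2p /\
  ~ complemented_embedding B (direct_sum l2p X) /\
  ~ complemented_embedding (direct_sum l2p X) B /\
  ~ complemented_embedding (direct_sum B X) B /\
  ~ complemented_embedding (direct_sum B X) (direct_sum l2p X) /\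
  ~ complemented_embedding (lp_power p1 X) (direct_sum B X).
Proof.
move=> l2p X B; rewrite /l2p /X /B /lp_power {l2p X B}.
move: w_star; rewrite /X_space /B_space /upper_exponent.
case: ifP => [p_gt2|p_le2] star; apply: no_complemented_embeddings.
- by move=> /factors_trans/(_ (factors_S k _ p_gt2)); exact: not_factors_X_S.
- by move=> /factors_trans/(_ (factors_S_X k _ p_gt2 w)); exact: not_factors_B_S_X.
- exact: not_factors_X_B.
- move=> /factors_trans/(_ (factors_cons_weights k (ltW p1) w (Bp_weights p))).
  exact: not_factors_lpX_B_X.
- by apply: dual_not_factors_X_S => //; rewrite lt_neqAle p2 leNgt p_le2.
- by apply: dual_not_factors_B_S_X => //; rewrite lt_neqAle p2 leNgt p_le2.
- by apply: dual_not_factors_X_B => //; rewrite lt_neqAle p2 leNgt p_le2.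
- by apply: dual_not_factors_lpX_B_X => //; rewrite lt_neqAle p2 leNgt p_le2.
Qed.
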